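(* There is a loopless q-dialectical system $\Gamma$ such that for every p-dialectical system $\Lambda$ (loopless or not), $B_\Gamma\neq B_\Lambda$; that is, the limiting belief set $B_\Gamma$ of $\Gamma$ is not the limiting belief set of any p-dialectical system.
   Context: ''Computable'' means Turing computable. Arguments are identified with (codes of) natural numbers, so that limiting belief sets of different systems are compared as sets of natural numbers. $P(X)$ is the power set of $X$ and $P^{\mathrm{fin}}(X)$ the set of finite subsets of $X$. Two extra logical symbols, not arguments, are used: $\bot$ (contradiction) and $\between$ (counterexample). Consequence operators. Let $\mathcal{A}$ be a non-empty set. A Tarskian consequence operator on $\mathcal{A}$ is a function $H^\infty:P(\mathcal{A})\to P(\mathcal{A}\cup\{\bot,\between\})$ such that for all $F,G\subseteq\mathcal{A}$: (Monotony) $F\subseteq G$ implies $H^\infty(F)\subseteq H^\infty(G)$; (Inclusion) $F\subseteq H^\infty(F)$; (Iteration) $H^\infty(H^\infty(F)\cap\mathcal{A})=H^\infty(F)$. An approximated consequence operator on $\mathcal{A}$ is a computable function $H:\mathbb{N}\times P^{\mathrm{fin}}(\mathcal{A})\to P^{\mathrm{fin}}(\mathcal{A}\cup\{\bot,\between\})$ such that for all $n$ and finite $F,G$: $F\subseteq G$ implies $H(n,F)\subseteq H(n,G)$; $F\subseteq H(n,F)\subseteq H(n+1,F)$; and $H^\infty(Y):=\bigcup_{n\in\mathbb{N},\,F\subseteq Y,\,F\text{ finite}}H(n,F)$ is a Tarskian consequence operator on $\mathcal{A}$. Systems. A q-dialectical system is a triple $\Gamma=(\mathcal{A},H,r)$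 where $\mathcal{A}=\{a_i: i\in\mathbb{N}\}$ is an infinite set of arguments given by a computable listing $(a_i)_{i\in\mathbb{N}}$ without repetitions, $H$ is an approximated consequence operator on $\mathcal{A}$, and $r:\mathcal{A}\to\mathcal{A}$ is a computable acyclic function (i.e. $r^n(x)\neq x$ for all $n\geq 1$ and all $x$). It is assumed that $\bot,\between\notin H^\infty(\emptyset)$, so that the run below is well defined. A p-dialectical system is a q-dialectical system with $\bot\notin H^\infty(\mathcal{A})$. Runs. For a finite string $\sigma$ over $\mathcal{A}\cup\{\ast\}$ (where $\ast$ is a placeholder symbol not in $\mathcal{A}$), positions are numbered from $0$, $|\sigma|$ is its length, $\sigma\restriction_k$ is the string of its first $k$ entries, $\mathrm{ran}(\sigma)$ is the set of elements of $\mathcal{A}$ that occur in $\sigma$, and $\cdot$ is concatenation. The run of $\Gamma$ is the sequence of strings $\sigma^\Gamma_s$ ($s\in\mathbb{N}$) with $\sigma^\Gamma_0$ the empty string and $\sigma^\Gamma_{s+1}$ defined from $\sigma=\sigma^\Gamma_s$ as follows. Case 1: $\bot$ or $\between$ is in $H(s,\mathrm{ran}(\sigma))$. Let $k$ be least such that $\bot$ or $\between$ is in $H(s,\mathrm{ran}(\sigma\restriction_k))$. If $\bot\in H(s,\mathrm{ran}(\sigma\restriction_k))$, then $\sigma^\Gamma_{s+1}=(\sigma\restriction_{k-1})\cdot\ast$; otherwise $\sigma^\Gamma_{s+1}=(\sigma\restriction_{k-1})\cdot r(\sigma(k-1))$. Case 2: otherwise, $\sigma^\Gamma_{s+1}=\sigma\cdot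 a_{|\sigma|}$. Limits. For $n\in\mathbb{N}$, $\lim_s\sigma^\Gamma_s(n)$ exists and equals $a\in\mathcal{A}\cup\{\ast\}$ if for all sufficiently large $t$, $|\sigma^\Gamma_t|>n$ and $\sigma^\Gamma_t(n)=a$. $\Gamma$ is loopless if $\lim_s\sigma^\Gamma_s(n)$ exists for every $n$. The limiting belief set of $\Gamma$ is $B_\Gamma=\{a\in\mathcal{A}:\exists n\ (a=\lim_s\sigma^\Gamma_s(n))\}$. *)

(* Defs.v *)
From HB Require Import structures.
From Stdlib Require Cantor.
From mathcomp Require Import all_boot finmap.
From mathcomp Require Import boolp classical_sets.

Set Implicit Arguments.
Unset Strict Implicit.
Unset Printing Implicit Defensive.

Local Open Scope classical_set_scope.

(** * Turing computability *)

Inductive direction := MoveLeft | MoveRight | Stay.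

(* Deterministic one-tape machine over an arbitrary finite alphabet;
   [tm_delta q a = None] means that the machine halts. *)
Record turing_machine := TuringMachine {
  tm_state : finType;
  tm_symbol : finType;
  tm_blank : tm_symbol;
  tm_one : tm_symbol;
  tm_one_neq_blank : tm_one != tm_blank;
  tm_start : tm_state;
  tm_delta : tm_state -> tm_symbol -> option (tm_state * tm_symbol * direction)
}.

Section TuringMachines.
Variable M : turing_machine.

(* The tape is infinite in both directions and blank outside the recorded part;
   [left_part] is listed from the head outwards, i.e. from right to left. *)
Record configuration := Configuration {
  current : tm_state M;
  left_part : seq (tm_symbol M);
  scanned : tm_symbol M;
  right_part : seq (tm_symbol M)
}.

Definition tm_step (c : configuration) : option configuration :=
  let: Configuration q l a r := c in
  match tm_delta q a with
  | None => None
  | Some (q', a', MoveLeft) =>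
      Some (Configuration q' (behead l) (head (tm_blank M) l) (a' :: r))
  | Some (q', a', MoveRight) =>
      Some (Configuration q' (a' :: l) (head (tm_blank M) r) (behead r))
  | Some (q', a', Stay) => Some (Configuration q' l a' r)
  end.

(* The input x is written as x consecutive 1s, the head scanning the first. *)
Definition tm_init (x : nat) : configuration :=
  let w := nseq x (tm_one M) in
  Configuration (tm_start M) [::] (head (tm_blank M) w) (behead w).

(* The output is the number of 1s on the tape (Davis's convention). *)
Definition tm_output (c : configuration) : nat :=
  count_mem (tm_one M) (left_part c ++ scanned c :: right_part c).

Definition tm_computes (x y : nat) : Prop :=
  exists (t : nat) (c : configuration),
    [/\ iter t (obind tm_step) (Some (tm_init x)) = Some c,
        tm_step c = None & tm_output c = y].

End TuringMachines.

(* Computability of f : D -> Y, relative to codings of X and Y by natural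
   numbers: nothing is asked of the machine on inputs outside D. *)
Definition computable_on (X Y : Type) (cX : X -> nat) (cY : Y -> nat)
    (D : set X) (f : X -> Y) : Prop :=
  exists M : turing_machine,
    forall x : X, D x -> tm_computes M (cX x) (cY (f x)).

(** * Conclusions: arguments, contradiction and counterexample *)

Inductive conclusion := Bot | Cex | Arg of nat.

Definition conclusion_code (c : conclusion) : nat :=
  match c with Bot => 0 | Cex => 1 | Arg x => x.+2 end.

Definition conclusion_decode (n : nat) : conclusion :=
  match n with 0 => Bot | 1 => Cex | x.+2 => Arg x end.

Lemma conclusion_codeK : cancel conclusion_code conclusion_decode.
Proof. by case. Qed.

HB.instance Definition _ := Countable.copy conclusion (can_type conclusion_codeK).

(* Canonical index of a finite set: its elements are the positions of the
   binary digits 1. *)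
Definition fset_code (K : choiceType) (c : K -> nat) (F : {fset K}) : nat :=
  \sum_(x <- F) 2 ^ c x.

Definition query_code (q : nat * {fset nat}) : nat :=
  Cantor.to_nat (q.1, fset_code id q.2).

(** * Consequence operators *)

(* The subsets of [conclusions A] form P(A \cup {\bot, \between}). *)
Definition conclusions (A : set nat) : set conclusion :=
  Arg @` A `|` [set Bot; Cex].

(* An operator on P(A) is a function on all sets of naturals, of which only
   the values at subsets of A are relevant; likewise below for functions on
   the finite subsets of A and on A. *)
Record tarskian (A : set nat) (C : set nat -> set conclusion) : Prop := {
  tarskian_nonempty : A !=set0;
  tarskian_codomain : forall F, F `<=` A -> C F `<=` conclusions A;
  tarskian_monotony : forall F G,
    F `<=` A -> G `<=` A -> F `<=` G -> C F `<=` C G;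
  tarskian_inclusion : forall F, F `<=` A -> Arg @` F `<=` C F;
  tarskian_iteration : forall F, F `<=` A -> C (Arg @^-1` C F `&` A) = C F
}.

Definition limit_operator (H : nat -> {fset nat} -> {fset conclusion})
    (Y : set nat) : set conclusion :=
  [set c | exists (n : nat) (F : {fset nat}), [set` F] `<=` Y /\ c \in H n F].

Record approximated (A : set nat)
    (H : nat -> {fset nat} -> {fset conclusion}) : Prop := {
  approximated_computable :
    computable_on query_code (fset_code conclusion_code)
      [set q : nat * {fset nat} | [set` q.2] `<=` A] (fun q => H q.1 q.2);
  approximated_codomain : forall n (F : {fset nat}),
    [set` F] `<=` A -> [set` H n F] `<=` conclusions A;
  approximated_monotony : forall n (F G : {fset nat}),
    [set` F] `<=` A -> [set` G] `<=` A ->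
    (F `<=` G)%fset -> (H n F `<=` H n G)%fset;
  approximated_inclusion : forall n (F : {fset nat}),
    [set` F] `<=` A -> ([fset Arg x | x in F] `<=` H n F)%fset;
  approximated_stage : forall n (F : {fset nat}),
    [set` F] `<=` A -> (H n F `<=` H n.+1 F)%fset;
  approximated_tarskian : tarskian A (limit_operator H)
}.

(** * Dialectical systems *)

(* The set of arguments is the range of [listing]. *)
Record q_dialectical := QDialectical {
  listing : nat -> nat;
  consequence : nat -> {fset nat} -> {fset conclusion};
  revision : nat -> nat;
  listing_computable : computable_on id id setT listing;
  listing_injective : injective listing;
  consequence_approximated : approximated (range listing) consequence;
  revision_computable : computable_on id id (range listing) revision;
  revision_codomain : forall x, range listing x -> range listing (revision x);
  revision_acyclic : forall n x,
    0 < n -> range listing x -> iter n revision x <> x;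
  empty_not_bot : ~ limit_operator consequence set0 Bot;
  empty_not_cex : ~ limit_operator consequence set0 Cex
}.

Definition arguments (S : q_dialectical) : set nat := range (listing S).

Definition p_dialectical (S : q_dialectical) : Prop :=
  ~ limit_operator (consequence S) (arguments S) Bot.

(** * Runs *)

(* Strings over A \cup {*}, the placeholder * being [None]. *)
Definition arg_string := seq (option nat).

Definition ran (w : arg_string) : {fset nat} := [fset x in pmap id w]%fset.

Section Runs.
Variable S : q_dialectical.

Definition conflict (s : nat) (w : arg_string) : bool :=
  (Bot \in consequence S s (ran w)) || (Cex \in consequence S s (ran w)).

(* The least k such that there is a conflict at w restricted to k, when there
   is one at w. *)
Definition first_conflict (s : nat) (w : arg_string) : nat :=
  find (fun k => conflict s (take k w)) (iota 0 (size w).+1).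

(* In the first case k > 0 by [empty_not_bot] and [empty_not_cex], and
   w(k-1) is not * by minimality of k, so that [omap] does apply [revision]. *)
Definition run_step (s : nat) (w : arg_string) : arg_string :=
  if conflict s w then
    let k := first_conflict s w in
    if Bot \in consequence S s (ran (take k w))
    then rcons (take k.-1 w) None
    else rcons (take k.-1 w) (omap (revision S) (nth None w k.-1))
  else rcons w (Some (listing S (size w))).

Fixpoint run (s : nat) : arg_string :=
  if s is s'.+1 then run_step s' (run s') else [::].

Definition run_limit (n : nat) (a : option nat) : Prop :=
  exists t0, forall t, t0 <= t -> n < size (run t) /\ nth None (run t) n = a.

Definition loopless : Prop := forall n, exists a, run_limit n a.

Definition belief_set : set nat :=
  [set x | arguments S x /\ exists n, run_limit n (Some x)].

End Runs.

(* Main.v *)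
(* Why p-systems are weaker. If a loopless p-system Lambda has limit string
   l_0, l_1, ..., then l_p is the first element of the r-orbit of the p-th
   argument that is consistent with L = {l_0, ..., l_(p-1)}. Suppose that its
   belief set contains L and a = l_p, and let x be a later believed element of
   the r-orbit of a. If Gamma discards a and x, together with everything in
   between, but keeps L, then Lambda has to refute L + x; if Gamma afterwards
   takes x back, L + x is believed though it was refuted. To do this, Gamma
   declares a counterexample to a, so that it is revised to some c of the same
   block, which is made to contradict x; once L + x has been refuted, c is itself
   declared contradictory and x returns.

   Arguments are pairs (block, index) and are revised by increasing the index.
   Distinct arguments of one block contradict each other, so that each block has
   at most one believed member, its representative. All possible Lambda are dealt
   with by a finite injury argument, where strategy j only touches blocks above
   the numbers used by the strategies i < j. The element a must be such that no
   later element of its r-orbit lies in L or is believed and of higher priority: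
   among the believed elements far enough on an r-orbit, take the one whose
   position in the limit string is least. *)

From Stdlib Require Cantor.
From mathcomp Require Import all_boot finmap zify.
From mathcomp Require Import boolp classical_sets.
Require Import Defs.

Set Implicit Arguments.
Unset Strict Implicit.
Unset Printing Implicit Defensive.

(** * From counter programs to Turing machines *)

(** Computability means an actual Turing machine, so the operator of Gamma has to be produced by
    one. The construction therefore avoids unbounded search: a stage encodes one strategy and one
    guess, the guess carries its own certificate and time limit, and opponents are simulated only
    for that time. This makes the history [log] primitive recursive, and primitive recursion is
    compiled to Turing machines through counter programs. A consequence operator may only grow with
    the stage, so Gamma never withdraws a contradiction or a counterexample. Discarding is
    permanent, and an argument can return only if its obstacle was another argument that is itself
    eliminated later; hence the detour through [c]. The number [j] is both the priority of a
    strategy and the code of its opponent. The invariants of the construction assume nothing about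
    the simulated machines, so a [j] that codes no system is harmless; correctness of the simulation
    enters only in the diagonalization. Opponents with loops are ruled out separately: Gamma has
    beliefs in arbitrarily large blocks, whereas a system with a loop has a finite belief set. *)

Definition upd (T : Type) (f : nat -> T) (i : nat) (v : T) : nat -> T :=
  fun j => if j == i then v else f j.

Inductive cmd := Inc of nat | Dec of nat | Seq of cmd & cmd | While of nat & cmd.

Inductive exec : cmd -> (nat -> nat) -> (nat -> nat) -> Prop :=
| exec_inc r s : exec (Inc r) s (upd s r (s r).+1)
| exec_dec r s : exec (Dec r) s (upd s r (s r).-1)
| exec_seq c d s1 s2 s3 : exec c s1 s2 -> exec d s2 s3 -> exec (Seq c d) s1 s3
| exec_while0 r c s : s r = 0 -> exec (While r c) s s
| exec_whileS r c s1 s2 s3 : s1 r <> 0 -> exec c s1 s2 ->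
    exec (While r c) s2 s3 -> exec (While r c) s1 s3.

Fixpoint registers (c : cmd) : nat :=
  match c with
  | Inc r | Dec r => r.+1
  | Seq c d => maxn (registers c) (registers d)
  | While r c => maxn r.+1 (registers c)
  end.

Definition move (d : direction) (p : nat) : nat :=
  match d with MoveLeft => p.-1 | MoveRight => p.+1 | Stay => p end.

Section Fragments.
Variable sym : finType.

(* A machine with an exit ([None]), working on a one-way tape. *)
Record fragment := Fragment {
  fstate : finType;
  fstart : fstate;
  fdelta : fstate -> sym -> option fstate * sym * direction }.

Inductive exits (F : fragment) :
    option (fstate F) -> (nat -> sym) -> nat -> (nat -> sym) -> nat -> Prop :=
| exits_now f p : exits None f p f p
| exits_step q f p o a d f' p' : fdelta q (f p) = (o, a, d) ->
    (d = MoveLeft -> 0 < p) -> exits o (upd f p a) (move d p) f' p' ->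
    exits (Some q) f p f' p'.

Definition fseq (F G : fragment) : fragment :=
  @Fragment (fstate F + fstate G)%type (inl (fstart F))
    (fun q a => match q with
      | inl q => let: (o, a', d) := fdelta q a in
          (Some (if o is Some q' then inl q' else inr (fstart G)), a', d)
      | inr q => let: (o, a', d) := fdelta q a in (omap inr o, a', d)
      end).

(** The extra state [None] performs the test. An exit of the body is [None], and wrapping it in
    [Some] turns it into a return to that state. *)
Definition fwhile (t : sym -> bool) (F : fragment) : fragment :=
  @Fragment (option (fstate F)) None
    (fun q a => match q with
      | None => (if t a then Some (Some (fstart F)) else None, a, Stay)
      | Some q => let: (o, a', d) := fdelta q a in (Some o, a', d)
      end).

Lemma upd_id (T : Type) (f : nat -> T) i : upd f i (f i) = f.
Proof. by apply/funext => j; rewrite /upd; case: eqP => [->|]. Qed.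


(** Simulation of a fragment inside a larger one: [h] sends the exit of [F] to the place where [G]
    goes on, so one statement serves both sequences and loops. *)
Lemma exits_embed F G (h : option (fstate F) -> option (fstate G)) :
  (forall q a o a' d, fdelta q a = (o, a', d) ->
     exists2 q', h (Some q) = Some q' & fdelta q' a = (h o, a', d)) ->
  forall o f p f1 p1 f2 p2, exits o f p f1 p1 -> exits (h None) f1 p1 f2 p2 ->
  exits (h o) f p f2 p2.
Proof.
move=> hP o f p f1 p1 f2 p2 e1 e2; elim: e1 e2 => {o f p f1 p1} //.
move=> q f p o a d f' p' /hP[q' -> E] dp _ IH /IH; exact: exits_step.
Qed.

Lemma exits_fseq (F G : fragment) f p f1 p1 f2 p2 :
  exits (Some (fstart F)) f p f1 p1 -> exits (Some (fstart G)) f1 p1 f2 p2 ->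
  exits (Some (fstart (fseq F G))) f p f2 p2.
Proof.
move=> eF eG.
apply: (@exits_embed F (fseq F G)
  (fun o => Some (if o is Some q then inl q else inr (fstart G))) _ _ _ _ _ _ _ _ eF).
  by move=> q a o a' d E; exists (inl q) => //=; rewrite E.
apply: (@exits_embed G (fseq F G) (omap inr) _ _ _ _ _ _ _ _ eG); last exact: exits_now.
by move=> q a o a' d E; exists (inr q) => //=; rewrite E.
Qed.

Lemma exits_fwhile0 (t : sym -> bool) F f p : ~~ t (f p) -> exits (Some (fstart (fwhile t F))) f p f p.
Proof.
move=> /negbTE tf; apply: (@exits_step (fwhile t F) _ _ _ None (f p) Stay) => //=.
  by rewrite tf.
by rewrite upd_id; apply: exits_now.
Qed.

Lemma exits_fwhileS (t : sym -> bool) F f p f1 p1 f2 p2 : t (f p) ->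
  exits (Some (fstart F)) f p f1 p1 ->
  exits (Some (fstart (fwhile t F))) f1 p1 f2 p2 ->
  exits (Some (fstart (fwhile t F))) f p f2 p2.
Proof.
move=> tf eF eW.
apply: (@exits_step (fwhile t F) _ _ _ (Some (Some (fstart F))) (f p) Stay) => //=.
  by rewrite tf.
rewrite upd_id; apply: (@exits_embed F (fwhile t F) Some _ _ _ _ _ _ _ _ eF eW).
by move=> q a o a' d E; exists (Some q) => //=; rewrite E.
Qed.

End Fragments.

Section Compilation.
Variable K : nat.
Let sym : finType := {ffun 'I_K.+1 -> bool}.
Definition no_mark : sym := [ffun=> false].

(* Register r is the number of marks on track r, which fill an initial segment
   of the cells 1, 2, ...; cell 0 is blank, so that the head can find its way
   back to cell 1. *)
Definition tape_of (s : nat -> nat) (p : nat) : sym :=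
  if p is p'.+1 then [ffun r : 'I_K.+1 => p' < s r] else no_mark.

Definition mark (r : 'I_K.+1) (b : bool) (a : sym) : sym :=
  [ffun i => if i == r then b else a i].

(** State [true] walks right to the first cell free on track [r] and marks it; state [false] walks
    back to the blank cell 0 and leaves at cell 1. *)
Definition finc (r : 'I_K.+1) : fragment sym :=
  @Fragment sym bool true (fun q a =>
    if q then if a r then (Some true, a, MoveRight)
              else (Some false, mark r true a, Stay)
    else if a == no_mark then (None, a, MoveRight) else (Some false, a, MoveLeft)).

(** [(true, true)] tests cell 1, so that a zero register is left alone; [(true, false)] looks for
    the first free cell, [(false, true)] erases the mark before it, and [(false, false)] walks
    back. *)
Definition fdec (r : 'I_K.+1) : fragment sym :=
  @Fragment sym (bool * bool)%type (true, true) (fun q a =>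
    match q with
    | (true, true) => if a r then (Some (true, false), a, MoveRight) else (None, a, Stay)
    | (true, false) => if a r then (Some (true, false), a, MoveRight)
                       else (Some (false, true), a, MoveLeft)
    | (false, true) => (Some (false, false), mark r false a, MoveLeft)
    | (false, false) =>
        if a == no_mark then (None, a, MoveRight) else (Some (false, false), a, MoveLeft)
    end).

(** Every cell from 1 to [p] carries a mark on track [r], so the first blank cell on the way left is
    cell 0. *)
Lemma exits_back (F : fragment sym) q r s p :
  (forall a, fdelta q a = if a == no_mark then (None, a, MoveRight)
                          else (Some q, a, MoveLeft)) ->
  p <= s r -> r <= K ->
  exits (F := F) (Some q) (tape_of s) p (tape_of s) 1.
Proof.
move=> qP + rK; elim: p => [|p IH] ps.
  apply: (@exits_step _ F _ _ _ None no_mark MoveRight) => //.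
    by rewrite qP eqxx.
  by rewrite -[X in upd _ _ X]/(tape_of s 0) upd_id; apply: exits_now.
apply: (@exits_step _ F _ _ _ (Some q) (tape_of s p.+1) MoveLeft) => //.
  rewrite qP; case: eqP => // /ffunP/(_ (Ordinal (rK : r < K.+1))).
  by rewrite !ffunE /= ps.
by rewrite upd_id; apply: IH; apply: ltnW.
Qed.

Lemma exits_finc (r : 'I_K.+1) s :
  exits (Some (fstart (finc r))) (tape_of s) 1 (tape_of (upd s r (s r).+1)) 1.
Proof.
suff walk n p : s r - p = n -> p <= s r ->
    exits (F := finc r) (Some true) (tape_of s) p.+1
      (tape_of (upd s r (s r).+1)) 1 by apply: walk erefl _.
elim: n p => [|n IH] p En ps.
  have Ep : p = s r by lia.
  apply: (@exits_step _ (finc r) _ _ _ (Some false) (mark r true (tape_of s p.+1)) Stay) => //=.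
    by rewrite ffunE Ep ltnn.
  rewrite /=.
  have -> : upd (tape_of s) p.+1 (mark r true (tape_of s p.+1))
            = tape_of (upd s r (s r).+1).
    apply/funext => i; rewrite /upd; case: eqP => [->|/eqP ip].
      apply/ffunP => j; rewrite !ffunE -val_eqE /=; case: eqP => // ->; lia.
    case: i ip => [//|i] ip; apply/ffunP => j; rewrite !ffunE.
    by case: eqP => // ->; apply/idP/idP; lia.
  apply: (@exits_back (finc r) false r) => //; last by rewrite -ltnS.
  by rewrite /upd eqxx Ep.
apply: (@exits_step _ (finc r) _ _ _ (Some true) (tape_of s p.+1) MoveRight) => //=.
  by rewrite ffunE ifT //; lia.
by rewrite upd_id; apply: IH; lia.
Qed.

Lemma exits_fdec (r : 'I_K.+1) s :
  exits (Some (fstart (fdec r))) (tape_of s) 1 (tape_of (upd s r (s r).-1)) 1.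
Proof.
case: (posnP (s r)) => [s0|s_gt0].
  have -> : (s r).-1 = s r by rewrite s0.
  rewrite upd_id.
  apply: (@exits_step _ (fdec r) _ _ _ None (tape_of s 1) Stay) => //=.
    by rewrite ffunE s0.
  by rewrite upd_id; apply: exits_now.
apply: (@exits_step _ (fdec r) _ _ _ (Some (true, false)) (tape_of s 1) MoveRight) => //=.
  by rewrite ffunE s_gt0.
rewrite upd_id.
suff walk n p : s r - p = n -> 0 < p <= s r ->
    exits (F := fdec r) (Some (true, false)) (tape_of s) p.+1
      (tape_of (upd s r (s r).-1)) 1 by apply: walk erefl _.
elim: n p => [|n IH] p En ps.
  have Ep : p = s r by lia.
  apply: (@exits_step _ (fdec r) _ _ _ (Some (false, true)) (tape_of s p.+1) MoveLeft) => //=.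
    by rewrite ffunE Ep ltnn.
  rewrite upd_id.
  apply: (@exits_step _ (fdec r) _ _ _ (Some (false, false)) (mark r false (tape_of s p)) MoveLeft) => //=.
    by lia.
  have -> : upd (tape_of s) p (mark r false (tape_of s p))
            = tape_of (upd s r (s r).-1).
    apply/funext => i; rewrite /upd; case: eqP => [->|/eqP ip].
      case: p {En ps} Ep => [|p] Ep; first lia.
      apply/ffunP => j; rewrite !ffunE -val_eqE /=; case: eqP => // _; lia.
    case: i ip => [//|i] ip; apply/ffunP => j; rewrite !ffunE.
    by case: eqP => // ->; apply/idP/idP; lia.
  apply: (@exits_back (fdec r) (false, false) r) => //; last by rewrite -ltnS.
  by rewrite /upd eqxx; lia.
apply: (@exits_step _ (fdec r) _ _ _ (Some (true, false)) (tape_of s p.+1) MoveRight) => //=.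
  by rewrite ffunE ifT //; lia.
by rewrite upd_id; apply: IH; lia.
Qed.

Fixpoint compile (c : cmd) : fragment sym :=
  match c with
  | Inc r => finc (inord r)
  | Dec r => fdec (inord r)
  | Seq c d => fseq (compile c) (compile d)
  | While r c => fwhile (fun a : sym => a (inord r)) (compile c)
  end.

Lemma compileP c s s' : registers c <= K.+1 -> exec c s s' ->
  exits (Some (fstart (compile c))) (tape_of s) 1 (tape_of s') 1.
Proof.
move=> + e; elim: e => {c s s'}.
- by move=> r s rK; have := exits_finc (inord r) s; rewrite inordK.
- by move=> r s rK; have := exits_fdec (inord r) s; rewrite inordK.
- move=> c d s1 s2 s3 _ IH1 _ IH2 /=; rewrite geq_max => /andP[/IH1 e1 /IH2 e2].
  exact: exits_fseq e1 e2.
- move=> r c s s0 /=; rewrite geq_max => /andP[rK _].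
  by apply: exits_fwhile0; rewrite ffunE inordK // s0.
- move=> r c s1 s2 s3 s0 _ IH1 _ IH2 /= rcK.
  move: (rcK); rewrite geq_max => /andP[rK cK].
  apply: exits_fwhileS (IH1 cK) (IH2 rcK).
  by rewrite ffunE inordK // lt0n; apply/eqP.
Qed.

End Compilation.

Section Machine.
Variables (K : nat) (F : fragment ({ffun 'I_K.+1 -> bool} : finType)).
Let sym : finType := {ffun 'I_K.+1 -> bool}.

(** The input symbol is the column marked on track 0 only, so a block of [x] input symbols is
    already the tape with [x] in register 0 and zeros elsewhere. *)
Definition one_mark : sym := [ffun r => r == ord0].

Lemma one_mark_neq : one_mark != no_mark K.
Proof. by apply/eqP => /ffunP/(_ ord0); rewrite !ffunE eqxx. Qed.

Definition machine : turing_machine :=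
  @TuringMachine (option (fstate F)) sym (no_mark K) one_mark one_mark_neq
    (Some (fstart F))
    (fun q a => if q is Some q then Some (fdelta q a) else None).

Definition represents (c : configuration machine) o (f : nat -> sym) (p : nat) :=
  [/\ current c = o,
      forall i, nth (no_mark K) (left_part c) i = if i < p then f (p.-1 - i) else no_mark K
    & forall i, nth (no_mark K) (scanned c :: right_part c) i = f (p + i)].

Lemma machine_exits o f p f' p' c : exits o f p f' p' -> represents c o f p ->
  exists t c', iter t (obind (@tm_step machine)) (Some c) = Some c'
    /\ represents c' None f' p'.
Proof.
move=> e; elim: e c => {o f p f' p'} [f p|q f p o a d f' p' E dp _ IH] c rc.
  by exists 0, c.
case: c rc => cq l x r [/= -> Hl Hr].
have Ex : x = f p by have := Hr 0; rewrite addn0.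
have [c'] : exists2 c', tm_step (@Configuration machine (Some q) l x r) = Some c'
    & represents c' o (upd f p a) (move d p).
  clear IH; rewrite /= Ex E; case: d E dp => E dp; eexists; try reflexivity; split=> //=.
  - move=> i; rewrite nth_behead Hl; have := dp erefl => p0.
    rewrite /upd; case: ltnP => ip; case: ltnP => // ip'; try lia.
    by rewrite ifN; [congr f; lia | lia].
  - have p0 := dp erefl; case=> [|i] /=.
      rewrite -nth0 Hl p0 /upd ifN; [congr f; lia|lia].
    case: i => [|i] /=; first by rewrite /upd ifT //; lia.
    by rewrite -[nth _ _ _]/(nth (no_mark K) (x :: r) i.+1) Hr /upd ifN; [congr f; lia|lia].
  - case=> [|i] /=; first by rewrite /upd subn0 eqxx.
    rewrite Hl /upd ltnS; case: ltnP => // ip; rewrite ifN; [congr f; lia|lia].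
  - move=> i; have -> : nth (no_mark K) (head (no_mark K) r :: behead r) i = nth (no_mark K) r i.
      by case: (r) i => [|y r'] [|i] //=; rewrite nth_nil.
    by rewrite -[nth _ _ _]/(nth (no_mark K) (x :: r) i.+1) Hr /upd ifN; [congr f; lia|lia].
  - move=> i; rewrite Hl /upd; case: ltnP => // ip; rewrite ifN //; lia.
  - case=> [|i] /=; first by rewrite /upd addn0 eqxx.
    by rewrite -[nth _ _ _]/(nth (no_mark K) (x :: r) i.+1) Hr /upd ifN //; lia.
move=> Ec /IH[t [c'' [Et rc'']]]; exists t.+1, c''; split => //.
by rewrite iterSr -[obind _ (Some _)]/(tm_step _) Ec.
Qed.

End Machine.

Lemma count_initial (T : eqType) (x0 y : T) (s : seq T) n : x0 != y ->
  (forall i, (nth x0 s i == y) = (i < n)) -> count_mem y s = n.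
Proof.
move=> xy; elim: s n => [|z s IH] n H.
  have := H 0; rewrite nth_nil (negbTE xy); case: n {H} => //.
case: n H => [|n] H.
  have := H 0 => /= ->; rewrite add0n; apply: IH => i.
  by rewrite ltn0 -(ltn0 i.+1) -H.
by have := H 0 => /= ->; rewrite add1n; congr _.+1; apply: IH => i; exact: (H i.+1).
Qed.

(** The output counts the columns equal to [one_mark], those marked on track 0 and nowhere else;
    this is why the other registers are required to end at zero. *)
Lemma cmd_computable c (f : nat -> nat) :
  (forall x, exec c (upd (fun=> 0) 0 x) (upd (fun=> 0) 0 (f x))) ->
  computable_on id id classical_sets.setT f.
Proof.
move=> cP; pose K := registers c; exists (machine (compile K c)) => x _.
have HK : registers c <= K.+1 by [].
have e := compileP HK (cP x).
have [|t [[q l a r] [Et [/= Eq Hl Hr]]]] := machine_exits (c := tm_init (machine (compile K c)) x) e.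
  split=> //= i; first by rewrite nth_nil if_same.
  rewrite -[RHS]/[ffun r : 'I_K.+1 => i < upd (fun=> 0) 0 x r].
  have -> : nth (no_mark K) (head (no_mark K) (nseq x (one_mark K)) ::
      behead (nseq x (one_mark K))) i = nth (no_mark K) (nseq x (one_mark K)) i.
    by case: (x) i => [|y] [|i] //=; rewrite nth_nil.
  rewrite nth_nseq; apply/ffunP => j; rewrite ffunE /upd.
  have -> : (nat_of_ord j == 0) = (j == ord0) by [].
  by case ix: (i < x); rewrite ffunE; case: (j == ord0); rewrite ?ix ?ltn0.
exists t, (Configuration q l a r); split=> //; first by rewrite /= Eq.
rewrite /tm_output /= count_cat.
have E0 : no_mark K != one_mark K by rewrite eq_sym one_mark_neq.
rewrite (@count_initial _ (no_mark K) _ l 0) //; last first.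
  move=> i; rewrite Hl ltn0; case: ifP => ip; last exact: negbTE.
  case: i ip => [|//] _; apply/negbTE; rewrite /tape_of /=.
  exact: E0.
rewrite add0n; apply: (@count_initial _ (no_mark K) _ (a :: r)) => // i.
rewrite Hr /=; apply/eqP/idP => [/ffunP/(_ ord0)|ix].
  by rewrite !ffunE eqxx.
by apply/ffunP => j; rewrite !ffunE /upd -val_eqE /=; case: eqP.
Qed.

(** * Primitive recursive functions are Turing computable *)

#[global] Arguments Cantor.to_nat : simpl never.
Notation pair_nat x y := (Cantor.to_nat (x, y)).
Definition block (z : nat) : nat := (Cantor.of_nat z).1.
Definition index_in (z : nat) : nat := (Cantor.of_nat z).2.

(* Unary functions suffice for primitive recursion thanks to the pairing. *)
Inductive primrec : (nat -> nat) -> Prop :=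
| primrec_succ : primrec succn
| primrec_zero : primrec (fun=> 0)
| primrec_id : primrec id
| primrec_fst : primrec block
| primrec_snd : primrec index_in
| primrec_pair f g : primrec f -> primrec g -> primrec (fun x => pair_nat (f x) (g x))
| primrec_comp f g : primrec f -> primrec g -> primrec (fun x => f (g x))
| primrec_iter f : primrec f -> primrec (fun x => iter (index_in x) f (block x)).

(* The registers from b on hold the entries of l, then zeros. *)
Definition regs (b : nat) (s : nat -> nat) (l : seq nat) : nat -> nat :=
  fun i => if i < b then s i else nth 0 l (i - b).

(** Scratch registers above [b] start and end at zero and those below [b] are preserved, so that
    implementations can be nested at different offsets. *)
Definition implements (b : nat) (c : cmd) (f : nat -> nat) : Prop :=
  forall s x, exec c (regs b s [:: x]) (regs b s [:: f x]).

Lemma nth_set (l : seq nat) k v i :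
  nth 0 (set_nth 0 l k v) i = if i == k then v else nth 0 l i.
Proof. by rewrite nth_set_nth. Qed.

Lemma upd_regs b s l k v : upd (regs b s l) (b + k) v = regs b s (set_nth 0 l k v).
Proof.
apply/funext => i; rewrite /upd /regs nth_set_nth /=.
case: eqP => [->|ik]; first by rewrite ltnNge leq_addr /= addKn eqxx.
by case: ltnP => // bi; rewrite ifN //; apply/eqP => ik'; apply: ik; lia.
Qed.

Lemma regsE b s l k : regs b s l (b + k) = nth 0 l k.
Proof. by rewrite /regs ltnNge leq_addr /= addKn. Qed.

Lemma eq_regs b s l l' : (forall i, nth 0 l i = nth 0 l' i) -> regs b s l = regs b s l'.
Proof. by move=> ll; apply/funext => i; rewrite /regs ll. Qed.

Lemma regs_shift b s l l' : regs b s (l ++ l') = regs (b + size l) (regs b s l) l'.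
Proof.
apply/funext => i; rewrite /regs nth_cat; case: (ltnP i b) => ib.
  by rewrite ifT //; lia.
rewrite -(ltn_add2l b) subnKC //.
by case: ltnP => il //; congr nth; lia.
Qed.

Lemma exec_eq c s s1 s2 : exec c s s1 -> s1 = s2 -> exec c s s2.
Proof. by move=> e <-. Qed.

Ltac cases_eq :=
  repeat match goal with |- context [?x == ?y] => case: (x =P y) => ? end;
  subst; try lia.

Section Registers.
Variables (b : nat) (s : nat -> nat).
Local Notation R := (regs b s).

Lemma exec_Inc k l : exec (Inc (b + k)) (R l) (R (set_nth 0 l k (nth 0 l k).+1)).
Proof. by rewrite -upd_regs -(regsE b s l); apply: exec_inc. Qed.

Lemma exec_Dec k l : exec (Dec (b + k)) (R l) (R (set_nth 0 l k (nth 0 l k).-1)).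
Proof. by rewrite -upd_regs -(regsE b s l); apply: exec_dec. Qed.

Lemma exec_While0 k c l : nth 0 l k = 0 -> exec (While (b + k) c) (R l) (R l).
Proof. by move=> l0; apply: exec_while0; rewrite regsE. Qed.

Lemma exec_WhileS k c l l' s' : nth 0 l k != 0 -> exec c (R l) (R l') ->
  exec (While (b + k) c) (R l') s' -> exec (While (b + k) c) (R l) s'.
Proof. by move=> /eqP l0; apply: exec_whileS; rewrite regsE. Qed.

Lemma exec_While1 k c l l' : nth 0 l k != 0 -> nth 0 l' k = 0 ->
  exec c (R l) (R l') -> exec (While (b + k) c) (R l) (R l').
Proof. by move=> lk l'k e; apply: exec_WhileS lk e _; apply: exec_While0. Qed.

Definition clear k := While (b + k) (Dec (b + k)).
Definition add_to k k1 := While (b + k) (Seq (Dec (b + k)) (Inc (b + k1))).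
Definition add_to2 k k1 k2 :=
  While (b + k) (Seq (Dec (b + k)) (Seq (Inc (b + k1)) (Inc (b + k2)))).

Lemma exec_clear k l : exec (clear k) (R l) (R (set_nth 0 l k 0)).
Proof.
move En: (nth 0 l k) => n; elim: n l En => [|n IH] l En.
  apply: exec_eq; first exact: exec_While0.
  by apply: eq_regs => i; rewrite nth_set; case: eqP => // ->.
apply: exec_WhileS; [by rewrite En | exact: exec_Dec|].
apply: exec_eq; first by apply: IH; rewrite nth_set eqxx En.
by apply: eq_regs => i; rewrite !nth_set; case: eqP.
Qed.

Lemma exec_add_to k k1 l : k != k1 ->
  exec (add_to k k1) (R l) (R (set_nth 0 (set_nth 0 l k1 (nth 0 l k1 + nth 0 l k)) k 0)).
Proof.
move=> kk; move En: (nth 0 l k) => n; elim: n l En => [|n IH] l En.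
  apply: exec_eq; first exact: exec_While0.
  apply: eq_regs => i; rewrite !nth_set.
  by cases_eq.
apply: exec_WhileS; first by rewrite En.
  by apply: exec_seq; [exact: exec_Dec | exact: exec_Inc].
apply: exec_eq.
  by apply: IH; rewrite !nth_set (negbTE kk) eqxx En.
apply: eq_regs => i; rewrite !nth_set.
rewrite eqxx [k1 == k]eq_sym (negbTE kk).
by cases_eq.
Qed.

Lemma exec_add_to2 k k1 k2 l : uniq [:: k; k1; k2] ->
  exec (add_to2 k k1 k2) (R l)
    (R (set_nth 0 (set_nth 0 (set_nth 0 l k1 (nth 0 l k1 + nth 0 l k))
          k2 (nth 0 l k2 + nth 0 l k)) k 0)).
Proof.
rewrite /= !inE !negb_or andbT => /andP[/andP[kk1 kk2] k12].
move En: (nth 0 l k) => n; elim: n l En => [|n IH] l En.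
  apply: exec_eq; first exact: exec_While0.
  apply: eq_regs => i; rewrite !nth_set.
  by cases_eq.
apply: exec_WhileS; first by rewrite En.
  apply: exec_seq; first exact: exec_Dec.
  by apply: exec_seq; exact: exec_Inc.
apply: exec_eq.
  by apply: IH; rewrite !nth_set; rewrite (negbTE kk1) (negbTE kk2) eqxx En.
apply: eq_regs => i; rewrite !nth_set.
rewrite !eqxx [k1 == k]eq_sym [k2 == k]eq_sym [k2 == k1]eq_sym.
rewrite (negbTE kk1) (negbTE kk2) (negbTE k12).
by cases_eq.
Qed.

(** One step of the Cantor enumeration. Register 3 is a flag, cleared by the first loop when [x] is
    positive; that loop parks [x.-1] in register 4, which makes it run at most once. *)
Definition unpair_step :=
  Seq (Inc (b + 3))
 (Seq (While (b + 1) (Seq (Dec (b + 1)) (Seq (add_to 1 4) (Seq (Inc (b + 2)) (Dec (b + 3))))))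
 (Seq (add_to 4 1)
      (While (b + 3) (Seq (add_to 2 1) (Seq (Inc (b + 1)) (Dec (b + 3))))))).

Lemma exec_unpair_step n x y :
  exec unpair_step (R [:: n; x; y])
    (let p := if x is x'.+1 then (x', y.+1) else (y.+1, 0) in R [:: n; p.1; p.2]).
Proof.
case: x => [|x].
- apply: exec_eq.
    apply: exec_seq; first exact: exec_Inc.
    apply: exec_seq; first exact: exec_While0.
    apply: exec_seq; first exact: exec_add_to.
    apply: exec_While1; last first.
    + apply: exec_seq; first exact: exec_add_to.
      by apply: exec_seq; [exact: exec_Inc | exact: exec_Dec].
    + by [].
    + by [].
  by apply: eq_regs; do 6 case=> //.
- apply: exec_eq.
    apply: exec_seq; first exact: exec_Inc.
    apply: exec_seq.
      apply: exec_While1; last first.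
      + apply: exec_seq; first exact: exec_Dec.
        apply: exec_seq; first exact: exec_add_to.
        by apply: exec_seq; [exact: exec_Inc | exact: exec_Dec].
      + by [].
      + by [].
    apply: exec_seq; first exact: exec_add_to.
    exact: exec_While0.
  by apply: eq_regs; do 6 case=> //=; rewrite ?addn0 ?add0n.
Qed.

Definition unpair := While (b + 0) (Seq (Dec (b + 0)) unpair_step).

Lemma exec_unpair n : exec unpair (R [:: n]) (R [:: 0; block n; index_in n]).
Proof.
have key m k : m + k = n ->
    exec unpair (R [:: k; block m; index_in m]) (R [:: 0; block n; index_in n]).
  elim: k m => [|k IH] m; first by rewrite addn0 => ->; apply: exec_While0.
  rewrite addnS -addSn => /IH; apply: exec_WhileS => //.
  apply: exec_seq; first exact: exec_Dec.
  apply: exec_eq; first exact: exec_unpair_step.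
  by rewrite /block /index_in /=; case: (Cantor.of_nat m) => -[].
have := key 0 n (add0n n); congr exec; apply: eq_regs; by do 4 case=> //.
Qed.

(** The Cantor code of [(x, y)] is [y] plus the triangular number of [x + y]. Register 0 counts down
    from [x + y], and each of its values is added to register 2, which starts at [y]. *)
Definition pairing :=
  Seq (add_to2 1 0 2)
 (Seq (While (b + 0) (Seq (add_to2 0 1 2) (Seq (add_to 1 0) (Dec (b + 0)))))
      (add_to 2 0)).

Lemma exec_pairing x y : exec pairing (R [:: x; y]) (R [:: pair_nat x y]).
Proof.
pose T n := nat_rec (fun=> nat) 0 (fun i m => i.+1 + m) n.
have loop n m : exec (While (b + 0) (Seq (add_to2 0 1 2) (Seq (add_to 1 0) (Dec (b + 0)))))
    (R [:: n; 0; m]) (R [:: 0; 0; m + T n]).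
  elim: n m => [|n IH] m.
    have -> : m + T 0 = m by exact: addn0.
    exact: exec_While0.
  have -> : m + T n.+1 = m + n.+1 + T n by rewrite /T /= -plusE; lia.
  apply: exec_WhileS (IH _) => //.
  apply: exec_eq.
    apply: exec_seq; first exact: exec_add_to2.
    by apply: exec_seq; [exact: exec_add_to | exact: exec_Dec].
  by apply: eq_regs; do 4 case=> //=; lia.
apply: exec_eq.
  apply: exec_seq.
    have e := exec_add_to2 [:: x; y] (isT : uniq [:: 1; 0; 2]).
    exact: e.
  by apply: exec_seq; [exact: loop | exact: exec_add_to].
apply: eq_regs; case=> [|[|[|[|i]]]] //=.
by rewrite add0n [x + y]addnC.
Qed.

End Registers.

Lemma primrec_implements f : primrec f -> forall b, exists c, implements b c f.
Proof.
elim=> {f} [||||| f g _ IHf _ IHg | f g _ IHf _ IHg | f _ IHf] b.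
- by exists (Inc (b + 0)) => s x; apply: exec_Inc.
- by exists (clear b 0) => s x; apply: exec_clear.
- exists (clear b 1) => s x; apply: exec_eq; first exact: exec_clear.
  by apply: eq_regs; do 3 case=> //.
- exists (Seq (unpair b) (Seq (clear b 2) (add_to b 1 0))) => s x.
  apply: exec_eq.
    apply: exec_seq; first exact: exec_unpair.
    by apply: exec_seq; [exact: exec_clear | exact: exec_add_to].
  by apply: eq_regs; do 4 case=> //.
- exists (Seq (unpair b) (Seq (clear b 1) (add_to b 2 0))) => s x.
  apply: exec_eq.
    apply: exec_seq; first exact: exec_unpair.
    by apply: exec_seq; [exact: exec_clear | exact: exec_add_to].
  by apply: eq_regs; do 4 case=> //.
- have [cf cfP] := IHf (b + 2); have [cg cgP] := IHg (b + 1).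
  exists (Seq (add_to2 b 0 1 2) (Seq cf (Seq (add_to b 2 0) (Seq cg (pairing b))))) => s x.
  apply: exec_seq; first exact: exec_add_to2.
  apply: exec_seq; first by rewrite (regs_shift _ _ [:: 0; x] [:: x]); apply: cfP.
  rewrite -(regs_shift _ _ [:: 0; x]).
  have e : exec (add_to b 2 0) (regs b s [:: 0; x; f x]) (regs b s [:: f x; x]).
    by apply: exec_eq; [exact: exec_add_to | apply: eq_regs; do 4 case=> //].
  apply: exec_seq e _; apply: exec_seq; last exact: exec_pairing.
  rewrite (regs_shift _ _ [:: f x] [:: g x]) (regs_shift _ _ [:: f x] [:: x]).
  exact: cgP.
- have [cf cfP] := IHf b; have [cg cgP] := IHg b.
  by exists (Seq cg cf) => s x; apply: exec_seq; [apply: cgP | apply: cfP].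
- have [cf cfP] := IHf (b + 1).
  exists (Seq (unpair b) (Seq (add_to b 2 0)
    (Seq (While (b + 0) (Seq (Dec (b + 0)) cf)) (add_to b 1 0)))) => s x.
  apply: exec_seq; first exact: exec_unpair.
  have e : exec (add_to b 2 0) (regs b s [:: 0; block x; index_in x])
      (regs b s [:: index_in x; block x]).
    by apply: exec_eq; [exact: exec_add_to | apply: eq_regs; do 4 case=> //].
  apply: exec_seq e _.
  have loop n y : exec (While (b + 0) (Seq (Dec (b + 0)) cf))
      (regs b s [:: n; y]) (regs b s [:: 0; iter n f y]).
    elim: n y => [|n IH] y; first exact: exec_While0.
    rewrite iterSr; apply: exec_WhileS (IH _) => //.
    apply: exec_seq; first exact: exec_Dec.
    by rewrite (regs_shift _ _ [:: n] [:: y]) (regs_shift _ _ [:: n] [:: f y]); apply: cfP.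
  apply: exec_seq; first exact: loop.
  apply: exec_eq; first exact: exec_add_to.
  by apply: eq_regs; do 3 case=> //.
Qed.

Lemma primrec_computable f : primrec f -> computable_on id id setT f.
Proof.
move=> /primrec_implements/(_ 0)[c cP]; apply: (@cmd_computable c) => x.
have E y : upd (fun=> 0) 0 y = regs 0 (fun=> 0) [:: y].
  by apply/funext => -[|i]; rewrite /upd /regs //= nth_nil.
by rewrite !E; apply: cP.
Qed.

(** * Primitive recursion on structured data *)

Lemma block_pair x y : block (pair_nat x y) = x.
Proof. by rewrite /block Cantor.cancel_of_to. Qed.

Lemma index_in_pair x y : index_in (pair_nat x y) = y.
Proof. by rewrite /index_in Cantor.cancel_of_to. Qed.

Lemma pair_nat_eta z : pair_nat (block z) (index_in z) = z.
Proof.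
by rewrite -[RHS]Cantor.cancel_to_of /block /index_in; case: (Cantor.of_nat z).
Qed.

Lemma leq_pair x y : y + x <= pair_nat x y.
Proof. by apply/leP; apply: Cantor.to_nat_non_decreasing. Qed.

Lemma index_in_le z : index_in z <= z.
Proof. by rewrite -{2}[z]pair_nat_eta; have := leq_pair (block z) (index_in z); lia. Qed.

Class coded (T : Type) := Coded { enc : T -> nat; dec : nat -> T; encK : cancel enc dec }.
(** For a coding onto all numbers, [dec] is realized by the identity and hence primitive recursive.
    Stage numbers are decoded in this way into machines and guesses. *)
Class surcoded (T : Type) (cT : coded T) := { decK : cancel dec enc }.

#[refine] Instance coded_nat : coded nat := {| enc := id; dec := id |}.
Proof. by []. Defined.
#[export] Instance surcoded_nat : surcoded coded_nat. Proof. by split. Qed.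

#[refine] Instance coded_bool : coded bool := {| enc := nat_of_bool; dec := fun n => n == 1 |}.
Proof. by case. Defined.

Section CodedPair.
Context {A B : Type} {cA : coded A} {cB : coded B}.

#[refine] #[export] Instance coded_pair : coded (A * B) :=
  {| enc := fun p => pair_nat (enc p.1) (enc p.2);
     dec := fun n => (dec (block n), dec (index_in n)) |}.
Proof. by case=> x y; rewrite block_pair index_in_pair !encK. Defined.

#[export] Instance surcoded_pair {sA : surcoded cA} {sB : surcoded cB} : surcoded coded_pair.
Proof. by split=> n /=; rewrite !decK pair_nat_eta. Qed.

#[refine] #[export] Instance coded_option : coded (option A) :=
  {| enc := fun o => if o is Some x then (enc x).+1 else 0;
     dec := fun n => if n is m.+1 then Some (dec m) else None |}.
Proof. by case=> //= x; rewrite encK. Defined.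

Fixpoint enc_seq (s : seq A) : nat :=
  if s is x :: s' then (pair_nat (enc x) (enc_seq s')).+1 else 0.

(** A number is enough fuel for its own decoding, since [index_in m <= m]. *)
Fixpoint dec_seq (fuel n : nat) : seq A :=
  match fuel, n with
  | k.+1, m.+1 => dec (block m) :: dec_seq k (index_in m)
  | _, _ => [::]
  end.

Lemma enc_seqK k s : enc_seq s <= k -> dec_seq k (enc_seq s) = s.
Proof.
elim: k s => [|k IH] [|x s] //; rewrite [enc_seq _]/= ltnS => sk.
rewrite [LHS]/= block_pair index_in_pair encK IH //.
exact: leq_trans (leq_addr _ _) (leq_trans (leq_pair _ _) sk).
Qed.

#[refine] #[export] Instance coded_seq : coded (seq A) :=
  {| enc := enc_seq; dec := fun n => dec_seq n n |}.
Proof. by move=> s; apply: enc_seqK. Defined.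

#[export] Instance surcoded_seq {sA : surcoded cA} : surcoded coded_seq.
Proof.
split=> n /=; suff key k : n <= k -> enc_seq (dec_seq k n) = n by exact: key.
elim: k n => [|k IH] [|n] // nk; rewrite [dec_seq _ _]/= [enc_seq _]/=.
by rewrite decK IH ?pair_nat_eta //; have := index_in_le n; lia.
Qed.

Lemma size_enc_seq (s : seq A) : size s <= enc_seq s.
Proof.
elim: s => // x s IH; rewrite [enc_seq _]/= [size _]/= ltnS.
exact: leq_trans IH (leq_trans (leq_addr _ _) (leq_pair _ _)).
Qed.

End CodedPair.

Definition prim {X Y : Type} {cX : coded X} {cY : coded Y} (f : X -> Y) : Prop :=
  exists2 g, primrec g & forall x, g (enc x) = enc (f x).

Lemma eq_prim {X Y : Type} {cX : coded X} {cY : coded Y} (f f' : X -> Y) :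
  f =1 f' -> prim f -> prim f'.
Proof. by move=> ff [g pg gE]; exists g => // x; rewrite gE ff. Qed.

Lemma prim_nat (f : nat -> nat) : primrec f <-> prim f.
Proof.
split=> [pf|[g pg gE]]; first by exists f.
by have <- : g = f by apply/funext.
Qed.

Lemma primrec_const n : primrec (fun=> n).
Proof.
elim: n => [|n IH]; first exact: primrec_zero.
exact: (primrec_comp primrec_succ IH).
Qed.

Section Basics.
Context {X : Type} {cX : coded X}.

Lemma prim_id : prim (fun x : X => x).
Proof. by exists id => //; apply: primrec_id. Qed.

Lemma prim_enc : prim (fun x : X => enc x).
Proof. by exists id => //; apply: primrec_id. Qed.

Lemma prim_dec {sX : surcoded cX} : prim (fun n : nat => dec n : X).
Proof. by exists id; [apply: primrec_id | move=> n; rewrite decK]. Qed.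

Lemma prim_const {Y : Type} {cY : coded Y} (y : Y) : prim (fun _ : X => y).
Proof. by exists (fun=> enc y) => //; apply: primrec_const. Qed.

Context {Y : Type} {cY : coded Y} {Z : Type} {cZ : coded Z}.

Lemma prim_comp (f : Y -> Z) (g : X -> Y) : prim f -> prim g -> prim (fun x => f (g x)).
Proof.
move=> [f' pf fE] [g' pg gE]; exists (fun n => f' (g' n)); first exact: primrec_comp.
by move=> x; rewrite gE fE.
Qed.

Lemma prim_pair (f : X -> Y) (g : X -> Z) : prim f -> prim g -> prim (fun x => (f x, g x)).
Proof.
move=> [f' pf fE] [g' pg gE]; exists (fun n => pair_nat (f' n) (g' n)).
  exact: primrec_pair.
by move=> x; rewrite gE fE.
Qed.

Lemma prim_fst (h : X -> Y * Z) : prim h -> prim (fun x => (h x).1).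
Proof.
move=> [h' ph hE]; exists (fun n => block (h' n)).
  exact: (primrec_comp primrec_fst ph).
by move=> x; rewrite hE block_pair.
Qed.

Lemma prim_snd (h : X -> Y * Z) : prim h -> prim (fun x => (h x).2).
Proof.
move=> [h' ph hE]; exists (fun n => index_in (h' n)).
  exact: (primrec_comp primrec_snd ph).
by move=> x; rewrite hE index_in_pair.
Qed.

Lemma prim_iter (n : X -> nat) (z : X -> Y) (F : X -> Y -> Y) :
  prim n -> prim z -> prim (fun p : X * Y => F p.1 p.2) ->
  prim (fun x => iter (n x) (F x) (z x)).
Proof.
move=> [n' pn nE] [z' pz zE] [F' pF FE].
(* Iteration in [primrec] has no parameter, so the state carries [x] along with the iterated
   value. *)
pose st p := pair_nat (block p) (F' p).
exists (fun x => index_in (iter (n' x) st (pair_nat x (z' x)))).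
  have ps : primrec st by apply: primrec_pair => //; apply: primrec_fst.
  have := primrec_comp (primrec_iter ps)
    (primrec_pair (primrec_pair primrec_id pz) pn).
  move=> /(primrec_comp primrec_snd); congr primrec; apply/funext => x.
  by rewrite block_pair index_in_pair.
move=> x; rewrite nE zE [enc (n x)]/=.
assert (key : forall k, iter k st (pair_nat (enc x) (enc (z x))) = enc (x, iter k (F x) (z x))).
  elim=> [//|k IH]; rewrite !iterS IH /st /= block_pair; congr (pair_nat _ _).
  exact: (FE (x, iter k (F x) (z x))).
by rewrite key index_in_pair.
Qed.

End Basics.

Lemma prim_succ {X : Type} {cX : coded X} (n : X -> nat) : prim n -> prim (fun x => (n x).+1).
Proof. by apply: prim_comp; apply/prim_nat; apply: primrec_succ. Qed.

Lemma prim_nat_of_bool {X : Type} {cX : coded X} (b : X -> bool) : prim b -> prim (fun x => nat_of_bool (b x)).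
Proof. by []. Qed.

Lemma prim_if {X : Type} {cX : coded X} {Y : Type} {cY : coded Y} (b : X -> bool) (f g : X -> Y) :
  prim b -> prim f -> prim g -> prim (fun x => if b x then f x else g x).
Proof.
move=> pb pf pg.
have := prim_iter (F := fun x _ => f x) (prim_nat_of_bool pb) pg (prim_comp pf (prim_fst prim_id)).
by apply: eq_prim => x; case: (b x).
Qed.

Lemma prim_negb {X : Type} {cX : coded X} (b : X -> bool) : prim b -> prim (fun x => ~~ b x).
Proof. by move=> pb; apply: (prim_if pb); apply: prim_const. Qed.

Lemma prim_andb {X : Type} {cX : coded X} (b c : X -> bool) : prim b -> prim c -> prim (fun x => b x && c x).
Proof. by move=> pb pc; apply: (prim_if pb pc); apply: prim_const. Qed.

Lemma prim_orb {X : Type} {cX : coded X} (b c : X -> bool) : prim b -> prim c -> prim (fun x => b x || c x).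
Proof. by move=> pb pc; apply: (prim_if pb (prim_const _) pc). Qed.

Lemma prim_pred {X : Type} {cX : coded X} (n : X -> nat) : prim n -> prim (fun x => (n x).-1).
Proof.
move=> pn; have := prim_fst (prim_iter (F := fun _ (p : nat * nat) => (p.2, p.2.+1)) pn
  (prim_const (0, 0)) (prim_pair (prim_snd (prim_snd prim_id))
    (prim_succ (prim_snd (prim_snd prim_id))))).
apply: eq_prim => x; suff -> : iter (n x) (fun p : nat * nat => (p.2, p.2.+1)) (0, 0) = ((n x).-1, n x) by []. 
by elim: (n x) => //= m ->.
Qed.

Lemma prim_sub {X : Type} {cX : coded X} (m n : X -> nat) : prim m -> prim n -> prim (fun x => m x - n x).
Proof.
move=> pm pn.
have := prim_iter (F := fun=> predn) pn pm (prim_pred (prim_snd prim_id)).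
apply: eq_prim => x; elim: (n x) => [|k]; first by rewrite subn0.
by rewrite iterS subnS => ->.
Qed.

Lemma prim_add {X : Type} {cX : coded X} (m n : X -> nat) : prim m -> prim n -> prim (fun x => m x + n x).
Proof.
move=> pm pn.
have := prim_iter (F := fun=> succn) pn pm (prim_succ (prim_snd prim_id)).
by apply: eq_prim => x; elim: (n x) => [|k]; rewrite ?addn0 // iterS addnS => ->.
Qed.

Lemma prim_eq0 {X : Type} {cX : coded X} (n : X -> nat) : prim n -> prim (fun x => n x == 0).
Proof.
move=> pn.
apply: (@eq_prim _ _ _ _ (fun x => iter (n x) (fun=> false) true)).
  by move=> x; case: (n x).
by apply: prim_iter => //; apply: prim_const.
Qed.

Lemma prim_leq {X : Type} {cX : coded X} (m n : X -> nat) : prim m -> prim n -> prim (fun x => m x <= n x).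
Proof. by move=> pm pn; apply/prim_eq0/prim_sub. Qed.

Lemma prim_eqn {X : Type} {cX : coded X} (m n : X -> nat) : prim m -> prim n -> prim (fun x => m x == n x).
Proof.
move=> pm pn; have := prim_andb (prim_leq pm pn) (prim_leq pn pm).
by apply: eq_prim => x; rewrite -eqn_leq.
Qed.

Lemma prim_pair_nat {X : Type} {cX : coded X} (m n : X -> nat) : prim m -> prim n -> prim (fun x => pair_nat (m x) (n x)).
Proof. by move=> pm pn; apply: (prim_comp (@prim_enc (nat * nat) _) (prim_pair pm pn)). Qed.

Lemma prim_block {X : Type} {cX : coded X} (n : X -> nat) : prim n -> prim (fun x => block (n x)).
Proof. by apply: prim_comp; apply/prim_nat; apply: primrec_fst. Qed.

Lemma prim_index_in {X : Type} {cX : coded X} (n : X -> nat) : prim n -> prim (fun x => index_in (n x)).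
Proof. by apply: prim_comp; apply/prim_nat; apply: primrec_snd. Qed.

Lemma prim_Some {X A : Type} {cX : coded X} {cA : coded A} (f : X -> A) : prim f -> prim (fun x => Some (f x)).
Proof.
move=> [f' pf fE]; exists (fun n => (f' n).+1) => [|x]; last by rewrite fE.
exact: (primrec_comp primrec_succ pf).
Qed.

Lemma prim_option {X Y A : Type} {cX : coded X} {cY : coded Y} {cA : coded A} (o : X -> option A) (f : X -> A -> Y) (g : X -> Y) :
  prim o -> prim (fun p : X * A => f p.1 p.2) -> prim g ->
  prim (fun x => if o x is Some a then f x a else g x).
Proof.
move=> [o' /prim_nat po oE] [f' /prim_nat pf fE] [g' /prim_nat pg gE].
exists (fun n => if o' n == 0 then g' n else f' (pair_nat n (o' n).-1)).
  apply/prim_nat; apply: prim_if pg _; first exact: prim_eq0.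
  by apply: (prim_comp pf); apply: prim_pair_nat; [apply: prim_id | apply: prim_pred].
move=> x; rewrite oE gE; case: (o x) => [a|] //=.
by have := fE (x, a).
Qed.

Lemma prim_cons {X A : Type} {cX : coded X} {cA : coded A} (f : X -> A) (s : X -> seq A) : prim f -> prim s -> prim (fun x => f x :: s x).
Proof.
move=> [f' /prim_nat pf fE] [s' /prim_nat ps sE].
exists (fun n => (pair_nat (f' n) (s' n)).+1); last by move=> x; rewrite fE sE.
by apply/prim_nat/prim_succ; apply: prim_pair_nat.
Qed.

Lemma prim_seq {X Y A : Type} {cX : coded X} {cY : coded Y} {cA : coded A} (s : X -> seq A) (f : X -> A -> seq A -> Y) (g : X -> Y) :
  prim s -> prim (fun p : X * (A * seq A) => f p.1 p.2.1 p.2.2) -> prim g ->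
  prim (fun x => if s x is a :: t then f x a t else g x).
Proof.
move=> [s' /prim_nat ps sE] [f' /prim_nat pf fE] [g' /prim_nat pg gE].
exists (fun n => if s' n == 0 then g' n else f' (pair_nat n (s' n).-1)).
  apply/prim_nat; apply: prim_if pg _; first exact: prim_eq0.
  by apply: (prim_comp pf); apply: prim_pair_nat; [apply: prim_id | apply: prim_pred].
move=> x; rewrite sE gE; case: (s x) => [//|a t].
by have := fE (x, (a, t)).
Qed.


Section Folds.
Context {X : Type} {cX : coded X} {Y : Type} {cY : coded Y} {A : Type} {cA : coded A}.

Lemma prim_foldl (F : X -> Y -> A -> Y) (z : X -> Y) (s : X -> seq A) :
  prim (fun p : X * (Y * A) => F p.1 p.2.1 p.2.2) -> prim z -> prim s ->
  prim (fun x => foldl (F x) (z x) (s x)).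
Proof.
move=> pF pz ps.
(* The code of a list bounds its length, so iterating this step that many times consumes the list;
   surplus iterations meet the empty list and change nothing. *)
pose st x (p : Y * seq A) := if p.2 is a :: t then (F x p.1 a, t) else p.
have pst : prim (fun p : X * (Y * seq A) => st p.1 p.2).
  apply: (prim_seq (f := fun p a t => (F p.1 p.2.1 a, t))).
  - by do 2 apply: prim_snd; apply: prim_id.
  - apply: prim_pair; last by do 2 apply: prim_snd; apply: prim_id.
    pose h (q : X * (Y * seq A) * (A * seq A)) := (q.1.1, (q.1.2.1, q.2.1)).
    apply: (prim_comp (g := h) pF); repeat apply: prim_pair.
    + by do 2 apply: prim_fst; apply: prim_id.
    + by apply: prim_fst; apply: prim_snd; apply: prim_fst; apply: prim_id.
    + by apply: prim_fst; apply: prim_snd; apply: prim_id.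
  - by apply: prim_snd; apply: prim_id.
have := prim_fst (prim_iter (prim_comp prim_enc ps) (prim_pair pz ps) pst).
apply: eq_prim => x.
rewrite [X in iter X _ _](_ : _ = enc_seq (s x)) //.
have := @size_enc_seq A cA (s x); move: (enc_seq (s x)) => n; elim: n (z x) (s x) => [|n IH] z0 [|a t] //.
  by move=> _; rewrite iterSr IH.
by rewrite [size _]/= ltnS iterSr => /IH ->.
Qed.

End Folds.

Section Lists.
Context {X : Type} {cX : coded X} {A : Type} {cA : coded A}.

Lemma prim_rev (s : X -> seq A) : prim s -> prim (fun x => rev (s x)).
Proof.
move=> ps; apply: (@eq_prim _ _ _ _ (fun x => foldl (fun l a => a :: l) [::] (s x))).
  move=> x; rewrite -[RHS]cats0; elim: (s x) [::] => //= a l IH r.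
  by rewrite IH rev_cons cat_rcons.
apply: prim_foldl => //; last exact: prim_const.
by apply: prim_cons; [do 2 apply: prim_snd | apply: prim_fst; apply: prim_snd]; apply: prim_id.
Qed.

Lemma prim_foldr {Y : Type} {cY : coded Y} (F : X -> A -> Y -> Y) (z : X -> Y) (s : X -> seq A) :
  prim (fun p : X * (A * Y) => F p.1 p.2.1 p.2.2) -> prim z -> prim s ->
  prim (fun x => foldr (F x) (z x) (s x)).
Proof.
move=> pF pz ps.
have pF' : prim (fun p : X * (Y * A) => F p.1 p.2.2 p.2.1).
  pose h (p : X * (Y * A)) := (p.1, (p.2.2, p.2.1)).
  apply: (prim_comp (g := h) pF); repeat apply: prim_pair.
  - by apply: prim_fst; apply: prim_id.
  - by do 2 apply: prim_snd; apply: prim_id.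
  - by apply: prim_fst; apply: prim_snd; apply: prim_id.
have := prim_foldl (F := fun x y a => F x a y) pF' pz (prim_rev ps).
by apply: eq_prim => x; rewrite foldl_rev.
Qed.
End Lists.

Ltac prim_user := fail.

Ltac prim_step :=
  first
  [ assumption
  | exact: prim_id
  | exact: prim_const
  | exact: (prim_fst prim_id)
  | exact: (prim_snd prim_id)
  | exact: (prim_block prim_id)
  | exact: (prim_index_in prim_id)
  | prim_user
  | lazymatch goal with
    | |- prim (fun x => (_, _)) => apply: prim_pair
    | |- prim (fun x => _.1) => apply: prim_fst
    | |- prim (fun x => _.2) => apply: prim_snd
    | |- prim (fun x => block _) => apply: prim_block
    | |- prim (fun x => index_in _) => apply: prim_index_in
    | |- prim (fun x => Cantor.to_nat (_, _)) => apply: prim_pair_nat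
    | |- prim (fun x => _.+1) => apply: prim_succ
    | |- prim (fun x => _.-1) => apply: prim_pred
    | |- prim (fun x => _ + _) => apply: prim_add
    | |- prim (fun x => _ - _) => apply: prim_sub
    | |- prim (fun x => _ <= _) => apply: prim_leq
    | |- prim (fun x => @eq_op _ _ _) => apply: prim_eqn
    | |- prim (fun x => ~~ _) => apply: prim_negb
    | |- prim (fun x => _ && _) => apply: prim_andb
    | |- prim (fun x => _ || _) => apply: prim_orb
    | |- prim (fun x => nat_of_bool _) => apply: prim_nat_of_bool
    | |- prim (fun x => Some _) => apply: prim_Some
    | |- prim (fun x => _ :: _) => apply: prim_cons
    | |- prim (fun x => rev _) => apply: prim_rev
    | |- prim (fun x => iter _ _ _) => apply: prim_iter
    | |- prim (fun x => foldl _ _ _) => apply: prim_foldl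
    | |- prim (fun x => foldr _ _ _) => apply: prim_foldr
    | |- prim (fun x => match _ with _ => _ end) =>
        first [apply: prim_if | apply: prim_option | apply: prim_seq]
    | |- prim (fun x => dec _) => apply: (prim_comp prim_dec)
    end ].

Ltac prim := intros; repeat prim_step.


Section MoreLists.
Context {X : Type} {cX : coded X} {A : Type} {cA : coded A} {B : Type} {cB : coded B}.

Lemma prim_map (f : X -> A -> B) (s : X -> seq A) :
  prim (fun p : X * A => f p.1 p.2) -> prim s -> prim (fun x => map (f x) (s x)).
Proof.
move=> pf ps; apply: (@eq_prim _ _ _ _ (fun x => foldr (fun a t => f x a :: t) [::] (s x))).
  by move=> x; elim: (s x) => //= a t ->.
prim.
by apply: (prim_comp (g := fun p : X * (A * seq B) => (p.1, p.2.1)) pf); prim.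
Qed.

Lemma prim_all (f : X -> A -> bool) (s : X -> seq A) :
  prim (fun p : X * A => f p.1 p.2) -> prim s -> prim (fun x => all (f x) (s x)).
Proof.
move=> pf ps; apply: (@eq_prim _ _ _ _ (fun x => foldr (fun a b => f x a && b) true (s x))).
  by move=> x; elim: (s x) => //= a t ->.
prim.
by apply: (prim_comp (g := fun p : X * (A * bool) => (p.1, p.2.1)) pf); prim.
Qed.

Lemma prim_has (f : X -> A -> bool) (s : X -> seq A) :
  prim (fun p : X * A => f p.1 p.2) -> prim s -> prim (fun x => has (f x) (s x)).
Proof.
move=> pf ps; apply: (@eq_prim _ _ _ _ (fun x => foldr (fun a b => f x a || b) false (s x))).
  by move=> x; elim: (s x) => //= a t ->.
prim.
by apply: (prim_comp (g := fun p : X * (A * bool) => (p.1, p.2.1)) pf); prim.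
Qed.

Lemma prim_filter (f : X -> A -> bool) (s : X -> seq A) :
  prim (fun p : X * A => f p.1 p.2) -> prim s -> prim (fun x => filter (f x) (s x)).
Proof.
move=> pf ps; apply: (@eq_prim _ _ _ _
  (fun x => foldr (fun a t => if f x a then a :: t else t) [::] (s x))).
  by move=> x; elim: (s x) => //= a t ->.
prim.
by apply: (prim_comp (g := fun p : X * (A * seq A) => (p.1, p.2.1)) pf); prim.
Qed.

Lemma prim_rcons (s : X -> seq A) (a : X -> A) : prim s -> prim a -> prim (fun x => rcons (s x) (a x)).
Proof.
move=> ps pa; apply: (@eq_prim _ _ _ _ (fun x => foldr (fun b t => b :: t) [:: a x] (s x))).
  by move=> x; elim: (s x) => //= b t ->.
by prim.
Qed.

Lemma prim_size (s : X -> seq A) : prim s -> prim (fun x => size (s x)).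
Proof.
move=> ps; apply: (@eq_prim _ _ _ _ (fun x => foldr (fun _ n => n.+1) 0 (s x))).
  by move=> x; elim: (s x) => //= a t ->.
by prim.
Qed.

Lemma prim_head (a : X -> A) (s : X -> seq A) : prim a -> prim s -> prim (fun x => head (a x) (s x)).
Proof.
move=> pa ps; apply: (@eq_prim _ _ _ _ (fun x => if s x is b :: _ then b else a x)).
  by move=> x; case: (s x).
by prim.
Qed.

Lemma prim_behead (s : X -> seq A) : prim s -> prim (fun x => behead (s x)).
Proof.
move=> ps; apply: (@eq_prim _ _ _ _ (fun x => if s x is b :: t then t else [::])).
  by move=> x; case: (s x).
by prim.
Qed.

Lemma prim_last (a : X -> A) (s : X -> seq A) : prim a -> prim s -> prim (fun x => last (a x) (s x)).
Proof.
move=> pa ps; apply: (@eq_prim _ _ _ _ (fun x => foldl (fun _ b => b) (a x) (s x))).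
  by move=> x; elim: (s x) (a x) => //=.
by prim.
Qed.

Lemma prim_path (e : X -> A -> A -> bool) (a : X -> A) (s : X -> seq A) :
  prim (fun p : X * (A * A) => e p.1 p.2.1 p.2.2) -> prim a -> prim s ->
  prim (fun x => path (e x) (a x) (s x)).
Proof.
move=> pe pa ps; apply: (@eq_prim _ _ _ _
  (fun x => (foldl (fun p b => (p.1 && e x p.2 b, b)) (true, a x) (s x)).1)).
  move=> x; rewrite -[RHS]/(true && path (e x) (a x) (s x)).
  by elim: (s x) true (a x) => [|b t IH] c d /=; rewrite ?andbT ?IH ?andbA.
prim.
by apply: (prim_comp (g := fun p : X * ((bool * A) * A) => (p.1, (p.2.1.2, p.2.2))) pe); prim.
Qed.

End MoreLists.

Lemma prim_iota0 {X : Type} {cX : coded X} (n : X -> nat) : prim n -> prim (fun x => iota 0 (n x)).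
Proof.
move=> pn; apply: (@eq_prim _ _ _ _ (fun x => iter (n x) (fun s => rcons s (size s)) [::])).
  move=> x; elim: (n x) => // k; rewrite iterS => ->.
  by rewrite size_iota -cats1 -addn1 iotaD.
by prim; [apply: prim_rcons; prim; apply: prim_size; prim].
Qed.

Lemma prim_mem {X : Type} {cX : coded X} (y : X -> nat) (s : X -> seq nat) :
  prim y -> prim s -> prim (fun x => y x \in s x).
Proof.
move=> py ps; apply: (@eq_prim _ _ _ _ (fun x => has (fun z => z == y x) (s x))).
  by move=> x; rewrite has_pred1.
by apply: prim_has => //; prim; apply: (prim_comp py); prim.
Qed.

(** * Finite sets of numbers as binary numerals *)

Definition bit (n x : nat) : bool := odd (iter x half n).
Definition elements (n : nat) : seq nat := [seq x <- iota 0 n | bit n x].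
Definition add_bit (x n : nat) : nat := if bit n x then n else n + 2 ^ x.
Definition code_of (s : seq nat) : nat := foldr add_bit 0 s.

Lemma prim_half {X : Type} {cX : coded X} (n : X -> nat) : prim n -> prim (fun x => (n x)./2).
Proof.
move=> pn; apply: (@eq_prim _ _ _ _
  (fun x => (iter (n x) (fun p : nat * nat => (p.2, p.1.+1)) (0, 0)).1)); last by prim.
move=> x; suff -> : iter (n x) (fun p : nat * nat => (p.2, p.1.+1)) (0, 0) = ((n x)./2, uphalf (n x)) by [].
by elim: (n x) => // k; rewrite iterS => ->.
Qed.

Lemma prim_odd {X : Type} {cX : coded X} (n : X -> nat) : prim n -> prim (fun x => odd (n x)).
Proof.
move=> pn; apply: (@eq_prim _ _ _ _ (fun x => iter (n x) negb false)); last by prim.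
by move=> x; elim: (n x) => // k; rewrite iterS => ->.
Qed.

Lemma prim_exp2 {X : Type} {cX : coded X} (n : X -> nat) : prim n -> prim (fun x => 2 ^ n x).
Proof.
move=> pn; apply: (@eq_prim _ _ _ _ (fun x => iter (n x) (fun m => m + m) 1)); last by prim.
by move=> x; elim: (n x) => // k; rewrite iterS expnS mul2n addnn => ->.
Qed.

Lemma prim_bit {X : Type} {cX : coded X} (n y : X -> nat) : prim n -> prim y -> prim (fun x => bit (n x) (y x)).
Proof. move=> pn py; apply: prim_odd; prim; apply: prim_half; prim. Qed.

Ltac prim_user ::=
  lazymatch goal with
  | |- prim (fun x => map _ _) => apply: prim_map
  | |- prim (fun x => all _ _) => apply: prim_all
  | |- prim (fun x => has _ _) => apply: prim_has
  | |- prim (fun x => filter _ _) => apply: prim_filter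
  | |- prim (fun x => rcons _ _) => apply: prim_rcons
  | |- prim (fun x => size _) => apply: prim_size
  | |- prim (fun x => head _ _) => apply: prim_head
  | |- prim (fun x => behead _) => apply: prim_behead
  | |- prim (fun x => last _ _) => apply: prim_last
  | |- prim (fun x => path _ _ _) => apply: prim_path
  | |- prim (fun x => iota 0 _) => apply: prim_iota0
  | |- prim (fun x => @in_mem _ _ _) => apply: prim_mem
  | |- prim (fun x => _./2) => apply: prim_half
  | |- prim (fun x => odd _) => apply: prim_odd
  | |- prim (fun x => 2 ^ _) => apply: prim_exp2
  | |- prim (fun x => bit _ _) => apply: prim_bit
  end.

Lemma prim_elements {X : Type} {cX : coded X} (n : X -> nat) :
  prim n -> prim (fun x => elements (n x)).
Proof. by move=> pn; rewrite /elements; prim; apply: (prim_comp pn); prim. Qed.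

Lemma prim_code_of {X : Type} {cX : coded X} (s : X -> seq nat) :
  prim s -> prim (fun x => code_of (s x)).
Proof. by move=> ps; rewrite /code_of /add_bit; prim. Qed.

Section FsetCode.

(** Halving the sum drops the summand with exponent 0 and lowers all other exponents by one, which
    drives the induction on [x]. *)
Lemma bit_sum (s : seq nat) x : uniq s -> bit (\sum_(y <- s) 2 ^ y) x = (x \in s).
Proof.
elim: x s => [|x IH] s us.
  rewrite /bit /= (big_morph odd oddD (erefl _)).
  elim: s us => [|y s IHs] /=; first by rewrite big_nil.
  case/andP=> ys us; rewrite big_cons inE IHs // oddX.
  by case: y ys => [|y] //= /negbTE ->.
pose s' := [seq y.-1 | y <- s & y != 0].
have -> : bit (\sum_(y <- s) 2 ^ y) x.+1 = bit (\sum_(y <- s') 2 ^ y) x.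
  rewrite /bit iterSr; congr (odd (iter _ _ _)).
  rewrite big_map big_filter; elim: s us {s'} => [|y s IHs] /=; first by rewrite !big_nil.
  case/andP=> ys us; rewrite big_cons halfD IHs //.
  case: y ys => [|y] ys; last by rewrite big_cons /= expnS mul2n odd_double doubleK.
  suff: odd (\sum_(y <- s) 2 ^ y) = false by move=> ->; rewrite andbF big_cons.
  rewrite (big_morph odd oddD (erefl _)) big_seq big1 // => -[|z]; first by rewrite (negbTE ys).
  by rewrite oddX.
rewrite IH; last first.
  rewrite map_inj_in_uniq ?filter_uniq // => y z; rewrite !mem_filter.
  by case: y; case: z => //= y z _ _ ->.
apply/mapP/idP => [[y]|xs]; last by exists x.+1; rewrite ?mem_filter.
by rewrite mem_filter; case: y => //= y yS ->.
Qed.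

Lemma bit_fset_code (F : {fset nat}) x : bit (fset_code id F) x = (x \in F).
Proof. by rewrite /fset_code bit_sum // fset_uniq. Qed.

Lemma fset_codeU1 (K : choiceType) (c : K -> nat) (x : K) (F : {fset K}) : x \notin F ->
  fset_code c (x |` F)%fset = fset_code c F + 2 ^ c x.
Proof.
move=> xF; rewrite /fset_code addnC.
rewrite (perm_big (x :: F)) /=; first by rewrite big_cons.
apply: uniq_perm; rewrite /= ?fset_uniq ?xF // => y.
by rewrite !inE.
Qed.

Lemma code_ofE (s : seq nat) : code_of s = fset_code id [fset x in s]%fset.
Proof.
elim: s => [|x s IH].
  by rewrite /fset_code big_seq big1 // => x; rewrite !inE.
have E : [fset y in x :: s]%fset = (x |` [fset y in s])%fset.
  by apply/fsetP => y; rewrite !inE.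
rewrite /= IH E /add_bit bit_fset_code; case: ifP => [xs|xs].
  by congr fset_code; apply/fsetP => y; rewrite !inE; case: eqP => // ->; move: xs; rewrite !inE.
by rewrite fset_codeU1 // xs.
Qed.

Lemma mem_elements (F : {fset nat}) : elements (fset_code id F) =i F.
Proof.
move=> x; rewrite mem_filter bit_fset_code mem_iota add0n /=.
case: (boolP (x \in F)) => //= xF.
(* An element [x] is below [2 ^ x], hence below the code of the set: the range searched by
   [elements] is large enough. *)
rewrite -(fsetD1K xF) fset_codeU1 ?fsetD11 //.
by apply: leq_trans (leq_addl _ _); apply: ltn_expl.
Qed.

End FsetCode.

(** * Simulation of Turing machines *)

(* Start state, blank, one, and the transition table, whose last component
   codes the direction; states and symbols are numbers. *)
Definition machine_code : Type := nat * (nat * (nat * seq ((nat * nat) * ((nat * nat) * nat)))).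
Definition conf_code : Type := nat * (seq nat * (nat * seq nat)).

Definition lookup (tb : seq ((nat * nat) * ((nat * nat) * nat))) (q a : nat) :
    option ((nat * nat) * nat) :=
  foldr (fun e o => if (e.1.1 == q) && (e.1.2 == a) then Some e.2 else o) None tb.

Definition code_step (m : machine_code) (c : conf_code) : option conf_code :=
  if lookup m.2.2.2 c.1 c.2.2.1 is Some v then
    Some (if v.2 == 0 then
            (v.1.1, (behead c.2.1, (head m.2.1 c.2.1, v.1.2 :: c.2.2.2)))
          else if v.2 == 1 then
            (v.1.1, (v.1.2 :: c.2.1, (head m.2.1 c.2.2.2, behead c.2.2.2)))
          else (v.1.1, (c.2.1, (v.1.2, c.2.2.2))))
  else None.

Definition code_init (m : machine_code) (x : nat) : conf_code :=
  (m.1, ([::], (head m.2.1 (iter x (cons m.2.2.1) [::]), behead (iter x (cons m.2.2.1) [::])))).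

Definition code_run (m : machine_code) (x t : nat) : conf_code :=
  iter t (fun c => if code_step m c is Some c' then c' else c) (code_init m x).

Definition ones (m : machine_code) (s : seq nat) : nat := size [seq a <- s | a == m.2.2.1].

Definition eval (m : machine_code) (x t : nat) : option nat :=
  if code_step m (code_run m x t) is Some _ then None
  else Some (ones m (code_run m x t).2.1 + ones m ((code_run m x t).2.2.1 :: (code_run m x t).2.2.2)).

Lemma code_runS m x t : code_run m x t.+1 =
  if code_step m (code_run m x t) is Some c then c else code_run m x t.
Proof. by []. Qed.

Lemma prim_code_step {X : Type} {cX : coded X} (m : X -> machine_code) (c : X -> conf_code) :
  prim m -> prim c -> prim (fun x => code_step (m x) (c x)).
Proof.
move=> pm pc; rewrite /code_step /lookup; prim.
all: first [apply: (prim_comp pm) | apply: (prim_comp pc)]; prim.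
Qed.

Lemma prim_eval {X : Type} {cX : coded X} (m : X -> machine_code) (x t : X -> nat) :
  prim m -> prim x -> prim t -> prim (fun y => eval (m y) (x y) (t y)).
Proof.
move=> pm px pt.
have pr : prim (fun y => code_run (m y) (x y) (t y)).
  rewrite /code_run /code_init; prim.
  all: try (apply: prim_code_step; prim).
  all: try by apply: (prim_comp pm); prim.
rewrite /eval /ones; prim; try (apply: prim_code_step; prim).
all: apply: (prim_comp pm); prim.
Qed.

Section CodeOfMachine.
Variable M : turing_machine.

Definition state_code (q : tm_state M) : nat := enum_rank q.
Definition symbol_code (a : tm_symbol M) : nat := enum_rank a.
Definition direction_code (d : direction) : nat :=
  match d with MoveLeft => 0 | MoveRight => 1 | Stay => 2 end.
Definition action_code (v : tm_state M * tm_symbol M * direction) :=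
  ((state_code v.1.1, symbol_code v.1.2), direction_code v.2).

Definition table (s : seq (tm_state M * tm_symbol M)) :=
  pmap (fun p => omap (fun v => ((state_code p.1, symbol_code p.2), action_code v))
                   (tm_delta p.1 p.2)) s.

Definition code_of_machine : machine_code :=
  (state_code (tm_start M), (symbol_code (tm_blank M), (symbol_code (tm_one M),
    table (enum {: tm_state M * tm_symbol M})))).

Definition code_of_conf (c : configuration M) : conf_code :=
  (state_code (current c), (map symbol_code (left_part c),
    (symbol_code (scanned c), map symbol_code (right_part c)))).

Lemma state_code_inj : injective state_code.
Proof. by move=> q q' /val_inj/enum_rank_inj. Qed.

Lemma symbol_code_inj : injective symbol_code.
Proof. by move=> a a' /val_inj/enum_rank_inj. Qed.

Lemma lookup_table s q a : lookup (table s) (state_code q) (symbol_code a) =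
  if (q, a) \in s then omap action_code (tm_delta q a) else None.
Proof.
elim: s => [|[q' a'] s IH] //=; rewrite inE xpair_eqE.
case E: (tm_delta q' a') => [v|] /=; rewrite IH.
  rewrite !(inj_eq state_code_inj, inj_eq symbol_code_inj) [q == _]eq_sym [a == _]eq_sym.
  by case: (q' =P q) => [<-|] //=; case: (a' =P a) => [<-|] //=; rewrite E.
by case: eqP => [->|] //=; case: eqP => [->|] //=; rewrite E /=; case: ifP.
Qed.

Lemma code_stepE c : code_step code_of_machine (code_of_conf c) = omap code_of_conf (tm_step c).
Proof.
case: c => q l a r; rewrite /code_step lookup_table mem_enum inE /=.
case: (tm_delta q a) => [[[q' a'] d]|] //=.
by case: d => //=; congr Some; rewrite /code_of_conf /=; [case: l | case: r].
Qed.

Lemma code_initE x : code_init code_of_machine x = code_of_conf (tm_init M x).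
Proof.
have E : iter x (cons (symbol_code (tm_one M))) [::] = map symbol_code (nseq x (tm_one M)).
  by elim: x => //= x ->.
by rewrite /code_init /code_of_conf /= E; case: (nseq _ _).
Qed.

Lemma onesE s : ones code_of_machine (map symbol_code s) = count_mem (tm_one M) s.
Proof.
rewrite /ones size_filter count_map; apply: eq_count => a /=.
exact: (inj_eq symbol_code_inj).
Qed.

Lemma code_runE x t c : iter t (obind (@tm_step M)) (Some (tm_init M x)) = Some c ->
  code_run code_of_machine x t = code_of_conf c.
Proof.
elim: t c => [|t IH] c; first by case=> <-; apply: code_initE.
rewrite iterS; case E: (iter _ _ _) => [c'|] // sc.
by rewrite code_runS (IH c') // code_stepE; move: sc => /= ->.
Qed.

Lemma code_run_halted x t t' : t <= t' ->
  code_step code_of_machine (code_run code_of_machine x t) = None ->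
  code_run code_of_machine x t' = code_run code_of_machine x t.
Proof.
move=> tt h; rewrite -(subnK tt); elim: (t' - t) => // k IH.
by rewrite addSn code_runS IH h.
Qed.

Lemma evalP x y : tm_computes M x y ->
  (exists t0, forall t, t0 <= t -> eval code_of_machine x t = Some y) /\
  (forall t v, eval code_of_machine x t = Some v -> v = y).
Proof.
case=> T [c [Ec hc <-]].
have h : code_step code_of_machine (code_run code_of_machine x T) = None.
  by rewrite (code_runE Ec) code_stepE hc.
have late t : T <= t -> eval code_of_machine x t = Some (tm_output c).
  move=> Tt; rewrite /eval (code_run_halted Tt h) h (code_runE Ec) /=.
  by rewrite -map_cons !onesE /tm_output count_cat.
split; first by exists T.
move=> t v; case: (leqP T t) => [/late -> [] //|/ltnW tT].
have [] := late T (leqnn T).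
rewrite /eval; case h': (code_step _ (code_run _ _ t)) => [//|].
by rewrite (code_run_halted tT h') h' => -[<-] [].
Qed.

End CodeOfMachine.

(* Nothing is known of the outputs outside the domain D. *)
Definition evaluates (X Y : Type) (m : machine_code) (cX : X -> nat) (cY : Y -> nat)
    (D : set X) (f : X -> Y) : Prop :=
  forall x, D x ->
  (exists t0, forall t, t0 <= t -> eval m (cX x) t = Some (cY (f x))) /\
  (forall t v, eval m (cX x) t = Some v -> v = cY (f x)).

Lemma computable_on_evaluates (X Y : Type) (cX : X -> nat) (cY : Y -> nat) (D : set X)
  (f : X -> Y) : computable_on cX cY D f -> exists m, evaluates m cX cY D f.
Proof. by case=> M MP; exists (code_of_machine M) => x /MP/evalP. Qed.

(** * Limits of runs *)

Section RunTheory.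
Variable S : q_dialectical.
Notation C := (consequence S).
Notation r := (revision S).
Notation A := (arguments S).

Definition entails (F : {fset nat}) (c : conclusion) : Prop := exists n, c \in C n F.

Definition valid (w : arg_string) : Prop := forall x, Some x \in w -> A x.

Lemma in_ran (w : arg_string) x : (x \in ran w) = (Some x \in w).
Proof. by rewrite !inE mem_pmap; apply/mapP/idP => [[y yw ->]|xw]; [|exists (Some x)]. Qed.

Lemma valid_ran w : valid w -> ([set` ran w] `<=` A)%classic.
Proof. by move=> vw x /=; rewrite in_ran => /vw. Qed.

Lemma consequence_mono m n (F G : {fset nat}) c : m <= n ->
  (F `<=` G)%fset -> ([set` G] `<=` A)%classic -> c \in C m F -> c \in C n G.
Proof.
have aC := consequence_approximated S => mn FG GA.
have FA : ([set` F] `<=` A)%classic by move=> x /= /(fsubsetP FG)/GA.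
move=> cF; have := fsubsetP (approximated_monotony aC m FA GA FG) _ cF.
rewrite -(subnK mn); elim: (n - m) => // k IH /IH.
by rewrite addSn => /(fsubsetP (approximated_stage aC (k + m) GA)).
Qed.

Lemma ran_prefix w w' : prefix w w' -> (ran w `<=` ran w')%fset.
Proof.
case/prefixP => v ->; apply/fsubsetP => x; rewrite !in_ran mem_cat => ->; exact: orTb.
Qed.

Lemma valid_prefix w w' : prefix w w' -> valid w' -> valid w.
Proof. by case/prefixP => v -> vw x xw; apply: vw; rewrite mem_cat xw. Qed.

Lemma conflict_mono s s' w w' : s <= s' -> prefix w w' -> valid w' ->
  conflict S s w -> conflict S s' w'.
Proof.
move=> ss ww vw; rewrite /conflict.
by case/orP => h; rewrite (consequence_mono ss (ran_prefix ww) (valid_ran vw) h) ?orbT.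
Qed.

Lemma conflict_nil s : ~~ conflict S s [::].
Proof.
apply/negP; have F0 : ran [::] = fset0 by apply/fsetP => x; rewrite in_ran !inE.
by case/orP; rewrite F0 => h; [apply: (@empty_not_bot S) | apply: (@empty_not_cex S)];
  exists s, fset0; split=> // x; rewrite /= inE.
Qed.

(** The empty string has no conflict, so the cut position is positive; a placeholder does not change
    [ran], so the entry blamed is an argument. *)
Lemma run_stepP s w :
  (~~ conflict S s w /\ run_step S s w = rcons w (Some (listing S (size w)))) \/
  exists u x v, [/\ w = u ++ Some x :: v, ~~ conflict S s u,
    conflict S s (rcons u (Some x)) &
    run_step S s w = rcons u (if Bot \in C s (ran (rcons u (Some x))) then None else Some (r x))].
Proof.
rewrite /run_step; case: ifP => cw; last by left.
right; pose P k := conflict S s (take k w).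
have hP : has P (iota 0 (size w).+1).
  by apply/hasP; exists (size w); rewrite ?mem_iota /P ?take_size //; lia.
have := nth_find 0 hP; have := @before_find _ 0 P (iota 0 (size w).+1).
move: hP; rewrite has_find size_iota -/(first_conflict S s w).
move: (first_conflict S s w) => k kw low; rewrite nth_iota // add0n => ck.
case: k kw low ck => [|k] kw low ck.
  by move: ck; rewrite /P take0 (negbTE (conflict_nil s)).
have uk := low k (ltnSn k); rewrite nth_iota ?add0n ?(ltnW kw) // in uk.
have kw' : k < size w by [].
have Et : take k.+1 w = rcons (take k w) (nth None w k) by rewrite (take_nth None).
have [x Ex] : exists x, nth None w k = Some x.
  case E: (nth None w k) => [x|]; first by exists x.
  move: ck; rewrite /P Et E /conflict.
  have -> : ran (rcons (take k w) None) = ran (take k w).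
    by apply/fsetP => x; rewrite !in_ran mem_rcons inE.
  by rewrite -/(conflict S s _) -/(P k) uk.
exists (take k w), x, (drop k.+1 w).
rewrite /= Ex -Ex -drop_nth // cat_take_drop; split=> //.
- by rewrite -/(P k) uk.
- by rewrite -Et.
- by rewrite Et Ex; case: ifP.
Qed.

Lemma run_valid t : valid (run S t).
Proof.
elim: t => [|t IH] //=; case: (run_stepP t (run S t)) => [[_ ->]|[u [x [v [E _ _ ->]]]]] y.
  rewrite mem_rcons inE => /orP[/eqP[->]|/IH //]; by exists (size (run S t)).
rewrite E in IH; rewrite mem_rcons inE => /orP[|yu]; last by apply: IH; rewrite mem_cat yu.
case: ifP => // _ /eqP[->]; apply: revision_codomain.
by apply: IH; rewrite mem_cat mem_head orbT.
Qed.

Lemma revision_neq x : A x -> r x <> x.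
Proof. by move=> Ax; apply: (@revision_acyclic S 1). Qed.

(* The second clause alone would not determine the entry following w in the
   run: the run has to be caught when w has just been completed. *)
Definition stable (w : arg_string) : Prop :=
  exists t0, run S t0 = w /\ forall t, t0 <= t -> prefix w (run S t).

Lemma stable_nil : stable [::].
Proof. by exists 0; split=> // t _; apply: prefix0s. Qed.

Lemma stable_valid w : stable w -> valid w.
Proof. by case=> t0 [<- _]; apply: run_valid. Qed.

Lemma prefix_size_cat (T : eqType) (w u v : seq T) :
  prefix w (u ++ v) -> size w <= size u -> prefix w u.
Proof.
by move=> + wu; rewrite !prefixE takel_cat.
Qed.

(** If [w] reached beyond [u], it would contain the entry after [u], which changes at this very
    step. *)
Lemma prefix_conflict_step w t u x v y : prefix w (run S t) ->
  run S t = u ++ Some x :: v -> run S t.+1 = rcons u y -> y <> Some x ->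
  prefix w (run S t.+1) -> prefix w u.
Proof.
move=> wt Et Et1; rewrite Et1 => yx wu.
case: (leqP (size w) (size u)) => wsu.
  by apply: (@prefix_size_cat _ _ _ [:: y]); rewrite // cats1.
have Ew : w = rcons u y.
  move: wu; rewrite prefixE => /eqP; rewrite take_oversize // size_rcons.
  by [].
case: yx; move: wt; rewrite Et Ew -cat_rcons => /prefix_size_cat.
rewrite !size_rcons leqnn => /(_ isT); rewrite prefixE size_rcons.
rewrite take_oversize ?size_rcons // => /eqP/rcons_inj[] //.
Qed.

Lemma step_neq s u x v t : run S t = u ++ Some x :: v ->
  (if Bot \in C s (ran (rcons u (Some x))) then None else Some (r x)) <> Some x.
Proof.
move=> Et; case: ifP => // _ [] E; apply: (@revision_neq x) => //.
by apply: (run_valid (t := t)); rewrite Et mem_cat mem_head orbT.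
Qed.

(** A conflict persists, so at a late stage the run would be cut inside [w]. *)
Lemma stable_consistent w s : stable w -> ~~ conflict S s w.
Proof.
case=> t0 [E w_pre]; apply/negP => cs.
pose t := maxn s t0; have wt := w_pre t (leq_maxr _ _).
have wt1 := w_pre t.+1 (leqW (leq_maxr _ _)).
have ct : conflict S t w.
  by apply: conflict_mono (prefix_refl _) _ cs; [apply: leq_maxl | apply: valid_prefix wt (@run_valid t)].
have := conflict_mono (leqnn t) wt (@run_valid t) ct.
case: (run_stepP t (run S t)) => [[/negbTE -> _]//|[u [x [v [Et cu _ Et1]]]]] _.
have wu := prefix_conflict_step wt Et Et1 (@step_neq t u x v t Et) wt1.
have uv : valid u by apply: valid_prefix (@run_valid t); rewrite Et prefix_prefix.
by rewrite (conflict_mono (leqnn t) wu uv ct) in cu.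
Qed.

(** Consider the first time at which the entry [v] is lost: as [w] survives, the cut is exactly at
    [v], and the string then ends with the replacement of [v]. *)
Lemma stable_advance w v t : (forall t', t <= t' -> prefix w (run S t')) ->
  run S t = rcons w v ->
  stable (rcons w v) \/
  exists t' x, [/\ t < t', v = Some x &
    (run S t' = rcons w None /\ entails (ran (rcons w v)) Bot) \/
    (run S t' = rcons w (Some (r x)) /\ entails (ran (rcons w v)) Cex)].
Proof.
move=> w_pre Et.
case: (pselect (forall t', t <= t' -> prefix (rcons w v) (run S t'))) => [h|].
  by left; exists t.
move=> /existsNP[t1 /not_implyP[tt1 /negP nt1]]; right.
have ex : exists t', (t <= t') && ~~ prefix (rcons w v) (run S t') by exists t1; rewrite tt1.
case: (ex_minnP ex) => -[|m] /andP[tm nm] mmin.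
  by move: nm tm; rewrite leqn0 => + /eqP t0; rewrite -t0 Et prefix_refl.
have tm' : t <= m.
  rewrite leqNgt; apply/negP => mt; have E : t = m.+1 by lia.
  by move: nm; rewrite -E Et prefix_refl.
have pm : prefix (rcons w v) (run S m).
  by apply/negPn/negP => h; have := mmin m; rewrite tm' h => /(_ isT); rewrite ltnn.
case: (run_stepP m (run S m)) => [[_ E]|[u [x [v' [Em _ cu Em1]]]]].
  have h : prefix (run S m) (run S m.+1) by rewrite /= E -cats1 prefix_prefix.
  by rewrite (prefix_trans pm h) in nm.
have wm : prefix w (run S m) by apply: w_pre.
have wu := prefix_conflict_step wm Em Em1 (@step_neq m u x v' m Em) (w_pre m.+1 (leqW tm')).
have Eu : u = w.
  case/prefixP: wu Em Em1 pm nm => -[|a w'] ->; first by rewrite cats0.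
  move=> Em Em1; rewrite Em -catA prefixE -cats1 size_cat /= take_cat ltnNge leq_addr /= addKn /=.
  rewrite take0 eqseq_cat // eqxx /= => /eqP[<-].
  by rewrite -/(run S m.+1) /= Em1 -cats1 -catA /= prefixE size_cat /= take_cat ltnNge leq_addr /= addKn /= take0 eqxx.
have Ev : v = Some x.
  by move: pm; rewrite Em Eu -cat_rcons prefixE size_rcons take_cat size_rcons ltnn subnn take0 cats0 => /eqP/rcons_inj[].
exists m.+1, x; split=> //; rewrite Ev -Eu [run S m.+1]/=; move: cu Em1; rewrite /conflict.
case: ifP => [hb _ ->|hb /= hc ->]; first by left; split=> //; exists m.
by right; split=> //; exists m.
Qed.

(** Only positive evidence is recorded. That the surviving argument is not refuted itself comes
    separately, from the consistency of stable strings. *)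
Definition settles (w : arg_string) (v : option nat) : Prop :=
  let chain i := iter i r (listing S (size w)) in
  exists k, (forall i, i < k -> entails (ran (rcons w (Some (chain i)))) Cex) /\
    (v = Some (chain k) \/ v = None /\ entails (ran (rcons w (Some (chain k)))) Bot).

(** The second alternative is a loop: the entry after [w] is revised forever. *)
Lemma stable_extend w : stable w ->
  (exists v, stable (rcons w v) /\ settles w v) \/
  forall k, exists t, [/\ k <= t, run S t = rcons w (Some (iter k r (listing S (size w)))) &
    forall i, i < k -> entails (ran (rcons w (Some (iter i r (listing S (size w)))))) Cex].
Proof.
move=> sw; case: (sw) => t0 [Et0 w_pre].
case: (pselect (exists v, stable (rcons w v) /\ settles w v)) => [|nex]; [by left | right].
suff key k : exists t, [/\ k <= t, t0 <= t,
    run S t = rcons w (Some (iter k r (listing S (size w)))) &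
    forall i, i < k -> entails (ran (rcons w (Some (iter i r (listing S (size w)))))) Cex].
  by move=> k; have [t [? ? ? ?]] := key k; exists t.
elim: k => [|k [t [kt tt Et chain]]].
  exists t0.+1; split=> //=; rewrite Et0.
  by case: (run_stepP t0 w) => [[_ ->]//|[u [x [v [E _ _ _]]]]];
    have := stable_consistent t0 sw; rewrite /run_step => /negbTE ->.
have wt t' : t <= t' -> prefix w (run S t') by move=> tt'; apply: w_pre; apply: leq_trans tt'.
case: (stable_advance wt Et) => [st|[t' [x [lt [<-] [[E eB]|[E eC]]]]]].
- by case: nex; eexists; split; first exact: st; exists k; split=> //; left.
- have wt' t'' : t' <= t'' -> prefix w (run S t'') by move=> ?; apply: wt; lia.
  case: (stable_advance wt' E) => [st|[? [? [? //]]]].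
  by case: nex; exists None; split=> //; exists k; split=> //; right.
- exists t'; split=> //; try lia.
  move=> i; rewrite ltnS leq_eqVlt => /orP[/eqP -> //|]; exact: chain.
Qed.

Lemma run_limit_inj n a b : run_limit S n a -> run_limit S n b -> a = b.
Proof.
move=> [t1 h1] [t2 h2]; have [_ <-] := h1 (maxn t1 t2) (leq_maxl _ _).
by have [_ <-] := h2 (maxn t1 t2) (leq_maxr _ _).
Qed.

Lemma stable_limit w n : stable w -> n < size w -> run_limit S n (nth None w n).
Proof.
case=> t0 [_ w_pre] nw; exists t0 => t /w_pre/prefixP[v ->].
by rewrite size_cat nth_cat nw; split=> //; lia.
Qed.

(** In a loop the run returns to length [size w + 1] again and again, so [size w] is the only later
    position that could have a limit; but there consecutive revisions differ by acyclicity. *)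
Lemma stable_next w n v : size w <= n -> stable w -> run_limit S n v ->
  exists v', stable (rcons w v') /\ settles w v'.
Proof.
move=> wn sw [t0 lim]; case: (stable_extend sw) => // chain.
have [t [kt Et _]] := chain t0; have [t' [kt' Et' _]] := chain t0.+1.
have [] := lim t kt; have [] := lim t' (ltnW kt').
rewrite Et Et' !size_rcons !ltnS => nw Ev _; have E : n = size w by lia.
rewrite E !nth_rcons ltnn eqxx in Ev * => Ev'; move: Ev'; rewrite -Ev iterS => -[E'].
case: (@revision_neq (iter t0 r (listing S (size w)))) => //.
by apply: (run_valid (t := t)); rewrite Et mem_rcons mem_head.
Qed.

Lemma limit_stable n v : run_limit S n v -> forall m, m <= n.+1 ->
  exists w, size w = m /\ stable w.
Proof.
move=> lim; elim=> [|m IH] mn; first by exists [::]; split=> //; apply: stable_nil.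
have [w [wm sw]] := IH (ltnW mn).
have [|v' [sw' _]] := stable_next _ sw lim; first by rewrite wm.
by exists (rcons w v'); rewrite size_rcons wm.
Qed.

(** Limits exist on an initial segment of the positions, so one missing limit leaves only finitely
    many of them and a bounded belief set. *)
Lemma infinite_loopless : (forall b, exists2 x, b <= x & belief_set S x) -> loopless S.
Proof.
move=> inf n; apply: contrapT => nolim.
have low m v : run_limit S m v -> m < n.
  move=> lim; rewrite ltnNge; apply/negP => nm; apply: nolim.
  have [w [wm sw]] := limit_stable lim (leqnn m.+1).
  by exists (nth None w n); apply: stable_limit; rewrite // wm ltnS.
have [b bP] : exists b, forall m x, m < n -> run_limit S m (Some x) -> x < b.
  elim: (n) => [|k [b bP]]; first by exists 0.
  case: (pselect (exists x, run_limit S k (Some x))) => [[x kx]|nx].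
    exists (maxn b x.+1) => m y; rewrite ltnS leq_eqVlt => /orP[/eqP -> ky|mk my].
      by have [->] := run_limit_inj ky kx; lia.
    by have := bP m y mk my; lia.
  exists b => m y; rewrite ltnS leq_eqVlt => /orP[/eqP -> ky|mk my]; last exact: bP my.
  by case: nx; exists y.
have [x bx [_ [m lim]]] := inf b.
by have := bP m x (low _ _ lim) lim; rewrite ltnNge bx.
Qed.

Lemma settles_loopless :
  (forall w, stable w -> exists k,
     ~ entails (ran (rcons w (Some (iter k r (listing S (size w)))))) Cex) -> loopless S.
Proof.
move=> noCex n; have [w [wn sw]] : exists w, size w = n.+1 /\ stable w.
  elim: (n.+1) => [|m [w [wm sw]]]; first by exists [::]; split=> //; apply: stable_nil.
  case: (stable_extend sw) => [[v [sv _]]|chain].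
    by exists (rcons w v); rewrite size_rcons wm.
  have [k nk] := noCex w sw; have [t [_ _ /(_ k (ltnSn k))]] := chain k.+1; by [].
by exists (nth None w n); apply: stable_limit; rewrite ?wn.
Qed.

Lemma loopless_limits : loopless S -> exists l : nat -> option nat,
  [/\ forall n, settles (mkseq l n) (l n),
      forall n s, ~~ conflict S s (mkseq l n),
      forall n, valid (mkseq l n) &
      forall x, belief_set S x <-> exists n, l n = Some x].
Proof.
move=> /choice[l lP]; exists l.
have sl n : stable (mkseq l n).
  case: n => [|n]; first exact: stable_nil.
  have [w [wn sw]] := limit_stable (lP n) (leqnn _).
  suff <- : w = mkseq l n.+1 by [].
  apply: (@eq_from_nth _ None); rewrite ?size_mkseq // wn => i iw.
  rewrite nth_mkseq //; apply: run_limit_inj (lP i); apply: stable_limit => //.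
  by rewrite wn.
split.
- move=> n; have [|v [sv wv]] := stable_next _ (sl n) (lP n); first by rewrite size_mkseq.
  suff <- : v = l n by []; apply: run_limit_inj (lP n).
  have := stable_limit (n := n) sv; rewrite size_rcons size_mkseq => /(_ (ltnSn n)).
  by rewrite nth_rcons size_mkseq ltnn eqxx.
- by move=> n s; apply: stable_consistent.
- by move=> n; apply: stable_valid.
- move=> x; split=> [[_ [n lim]]|[n En]]; first by exists n; apply: run_limit_inj lim.
  split; last by exists n; rewrite -En.
  by apply: (stable_valid (sl n.+1)); rewrite -En; apply: map_f; rewrite mem_iota; lia.
Qed.

End RunTheory.

(** * The construction *)

(* An event is due to the strategy [owner] at the stage [horizon]: it discards
   the blocks in [killed], makes [blocker] the representative of its block and
   declares it contradictory with the block [blocked]. The strategy then waits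
   for the opponent to refute [goal], or has finished if [goal] is empty. *)
Definition event : Type := nat * (nat * (seq nat * (nat * (nat * seq nat)))).
Definition owner (e : event) : nat := e.1.
Definition horizon (e : event) : nat := e.2.1.
Definition killed (e : event) : seq nat := e.2.2.1.
Definition blocker (e : event) : nat := e.2.2.2.1.
Definition blocked (e : event) : nat := e.2.2.2.2.1.
Definition goal (e : event) : seq nat := e.2.2.2.2.2.

Definition dead (lg : seq event) (b : nat) : bool := has (fun e => b \in killed e) lg.

(** The default 0 makes the argument of index 0 the representative of an untouched block. *)
Definition rep (lg : seq event) (b : nat) : nat :=
  foldr (fun e m => if block (blocker e) == b
                    then (if m <= index_in (blocker e) then index_in (blocker e) else m) else m) 0 lg.

(** An event blocks only as long as its blocker can still be believed; discarding the block of the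
    blocker is what releases the blocked one. *)
Definition live (lg : seq event) (e : event) : bool :=
  ~~ dead lg (block (blocker e)) && (index_in (blocker e) == rep lg (block (blocker e))).

Definition believed (lg : seq event) (z : nat) : bool :=
  ~~ dead lg (block z) && (index_in z == rep lg (block z)) &&
  all (fun e => ~~ (live lg e && (blocked e == block z))) lg.

(* Strategy j leaves the blocks below this bound alone. *)
Definition bound (lg : seq event) (j : nat) : nat :=
  j + foldr (fun e m => if owner e < j then (if m <= horizon e then horizon e else m) else m) 0 lg.

(** A later event of a stronger strategy hides the events of [j]. This expresses injury: [j] counts
    as idle again. *)
Definition current (lg : seq event) (j : nat) : option event :=
  foldr (fun e o => if owner e <= j then Some e else o) None lg.

(** [Cex] has code 1, so the test reads the second binary digit of the code of the consequence
    set. *)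
Definition refuted (m : machine_code) (n t : nat) (s : seq nat) : bool :=
  if eval m (pair_nat n (code_of s)) t is Some v then odd v./2 else false.

Definition returns (m : machine_code) (t y z : nat) : bool :=
  if eval m y t is Some v then v == z else false.

(* Codes of machines for the listing, the consequence and the revision. *)
Definition codes : Type := machine_code * (machine_code * machine_code).

(** Only refutations are checked, since consistency is not decidable: the last argument of a row may
    be refuted as well. This is excluded later for arguments that the opponent believes. *)
Definition row_ok (M : codes) (n t : nat) (L : seq nat) (row : nat * seq nat) : bool :=
  returns M.1 t (size L) row.1 &&
  path (fun y z => returns M.2.2 t y z && refuted M.2.1 n t (y :: L)) row.1 row.2.

(* The q-th row certifies the q-th entry of the limit string of the opponent;
   the entries are collected last first. *)
Definition certify (M : codes) (n t : nat) (rows : seq (nat * seq nat)) : bool * seq nat :=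
  foldl (fun st row => (st.1 && row_ok M n t st.2 row, last row.1 row.2 :: st.2)) (true, [::]) rows.

(* The rows of the entries before a, the row leading to a, further revisions of
   a, the index of the new representative of the block of a, the stage of the
   consequence operator and the computation time used in the verification. *)
Definition guess : Type :=
  seq (nat * seq nat) * ((nat * seq nat) * (seq nat * (nat * (nat * nat)))).

Section Guess.
Variables (M : codes) (g : guess).
Definition g_stage : nat := g.2.2.2.2.1.
Definition g_time : nat := g.2.2.2.2.2.
Definition g_cert : bool * seq nat := certify M g_stage g_time g.1.
Definition g_old : seq nat := g_cert.2.
Definition g_arg : nat := last g.2.1.1 g.2.1.2.
Definition g_next : seq nat := g.2.2.1.
Definition g_target : nat := last g_arg g_next.
Definition g_new : nat := pair_nat (block g_arg) g.2.2.2.1.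
End Guess.

Definition certified (M : codes) (g : guess) : bool :=
  (g_cert M g).1 && row_ok M (g_stage g) (g_time g) (g_old M g) g.2.1 &&
  path (returns M.2.2 (g_time g)) (g_arg g) (g_next g) &&
  (g_arg g \notin g_old M g) && all (fun y => y \notin g_old M g) (g_next g).

(** The conditions on [g_next] ensure that the new event leaves no revision of [a] up to the target
    believed. That the block of [a] precedes that of the target makes every blocker smaller than
    what it blocks, so Gamma decides it first. *)
Definition opens (M : codes) (lg : seq event) (s j : nat) (g : guess) : bool :=
  certified M g &&
  all (believed lg) (g_arg g :: g_old M g) && believed lg (g_target g) &&
  (bound lg j <= block (g_arg g)) && (block (g_arg g) < block (g_target g)) &&
  all (fun y => ~~ (believed lg y && (block y < bound lg j)) && (y != g_new g)) (g_next g) &&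
  (index_in (g_arg g) < g.2.2.2.1) && (block (g_arg g) < s) &&
  all (fun z => block z < s) (g_old M g) && all (fun z => block z < s) (g_next g).

Definition opening (M : codes) (lg : seq event) (s j : nat) (g : guess) : event :=
  (j, (s,
   ([seq b <- iota 0 s | (bound lg j <= b) && (b != block (g_arg g)) &&
       (b != block (g_target g)) && (b \notin map block (g_old M g))],
   (g_new g, (block (g_target g), g_target g :: g_old M g))))).

(** Repeating the old blocker leaves all representatives unchanged, and the event itself is never
    live because it discards the block of its own blocker. *)
Definition closing (e : event) (s j : nat) : event :=
  (j, (s, ([:: block (blocker e)], (blocker e, (blocked e, [::]))))).

Definition try_open (M : codes) (lg : seq event) (s j : nat) (g : guess) : seq event :=
  if opens M lg s j g then opening M lg s j g :: lg else lg.

Definition try_close (M : codes) (lg : seq event) (s j : nat) (g : guess) (e : event) : seq event :=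
  if (0 < size (goal e)) && refuted M.2.1 (g_stage g) (g_time g) (goal e)
  then closing e s j :: lg else lg.

(* Stage (j, (g, i)) only tries the guess g for strategy j; thanks to i, every
   guess is tried infinitely often. *)
Definition log_step (s : nat) (lg : seq event) : seq event :=
  if current lg (block s) is Some e then
    if owner e == block s
    then try_close (dec (block s)) lg s (block s) (dec (block (index_in s))) e
    else try_open (dec (block s)) lg s (block s) (dec (block (index_in s)))
  else try_open (dec (block s)) lg s (block s) (dec (block (index_in s))).

Fixpoint log (s : nat) : seq event := if s is s'.+1 then log_step s' (log s') else [::].

(** The last clause ignores whether the event is live, so that every clause persists as the log
    grows, as monotony in the stage demands. This is sound because a blocker that is no longer live
    is itself discarded or has a counterexample. *)
Definition some_bot (lg : seq event) (s : seq nat) : bool :=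
  has (fun z => dead lg (block z)) s ||
  has (fun z => has (fun y => (block z == block y) && (z != y)) s) s ||
  has (fun e => (blocker e \in s) && has (fun z => block z == blocked e) s) lg.

Definition some_cex (lg : seq event) (s : seq nat) : bool :=
  has (fun z => index_in z < rep lg (block z)) s.

(** * The construction is primitive recursive *)

Section PrimConstruction.
Context {X : Type} {cX : coded X}.

Lemma prim_dead (lg : X -> seq event) (b : X -> nat) :
  prim lg -> prim b -> prim (fun x => dead (lg x) (b x)).
Proof. by move=> plg pb; rewrite /dead /killed; prim; apply: (prim_comp pb); prim. Qed.

Lemma prim_rep (lg : X -> seq event) (b : X -> nat) :
  prim lg -> prim b -> prim (fun x => rep (lg x) (b x)).
Proof. by move=> plg pb; rewrite /rep /blocker; prim; apply: (prim_comp pb); prim. Qed.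

End PrimConstruction.

Ltac prim_sub :=
  match goal with
  | H : prim ?f |- prim _ => by apply: (prim_comp H); prim
  end.

Lemma prim_live {X : Type} {cX : coded X} (lg : X -> seq event) (e : X -> event) :
  prim lg -> prim e -> prim (fun x => live (lg x) (e x)).
Proof.
by move=> plg pe; rewrite /live /blocker; prim; [apply: prim_dead; prim | apply: prim_rep; prim].
Qed.

Lemma prim_believed {X : Type} {cX : coded X} (lg : X -> seq event) (z : X -> nat) :
  prim lg -> prim z -> prim (fun x => believed (lg x) (z x)).
Proof.
move=> plg pz; rewrite /believed /blocked; prim.
- by apply: prim_dead; prim.
- by apply: prim_rep; prim.
- by apply: prim_live; prim; prim_sub.
- by prim_sub.
Qed.

Lemma prim_bound {X : Type} {cX : coded X} (lg : X -> seq event) (j : X -> nat) :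
  prim lg -> prim j -> prim (fun x => bound (lg x) (j x)).
Proof. by move=> plg pj; rewrite /bound /owner /horizon; prim; prim_sub. Qed.

Lemma prim_current {X : Type} {cX : coded X} (lg : X -> seq event) (j : X -> nat) :
  prim lg -> prim j -> prim (fun x => current (lg x) (j x)).
Proof. by move=> plg pj; rewrite /current /owner; prim; prim_sub. Qed.

Lemma prim_refuted {X : Type} {cX : coded X} (m : X -> machine_code) (n t : X -> nat) (s : X -> seq nat) :
  prim m -> prim n -> prim t -> prim s -> prim (fun x => refuted (m x) (n x) (t x) (s x)).
Proof.
by move=> pm pn pt ps; rewrite /refuted; prim; apply: prim_eval; prim; apply: prim_code_of.
Qed.

Lemma prim_returns {X : Type} {cX : coded X} (m : X -> machine_code) (t y z : X -> nat) :
  prim m -> prim t -> prim y -> prim z -> prim (fun x => returns (m x) (t x) (y x) (z x)).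
Proof. by move=> pm pt py pz; rewrite /returns; prim; [apply: prim_eval | prim_sub]. Qed.

Lemma prim_row_ok {X : Type} {cX : coded X} (M : X -> codes) (n t : X -> nat) (L : X -> seq nat)
  (row : X -> nat * seq nat) : prim M -> prim n -> prim t -> prim L -> prim row ->
  prim (fun x => row_ok (M x) (n x) (t x) (L x) (row x)).
Proof.
move=> pM pn pt pL pr; rewrite /row_ok; prim.
- by apply: prim_returns; prim.
- by apply: prim_returns; prim; prim_sub.
- by apply: prim_refuted; prim; prim_sub.
Qed.

Lemma prim_certify {X : Type} {cX : coded X} (M : X -> codes) (n t : X -> nat)
  (rows : X -> seq (nat * seq nat)) : prim M -> prim n -> prim t -> prim rows ->
  prim (fun x => certify (M x) (n x) (t x) (rows x)).
Proof.
move=> pM pn pt pr; rewrite /certify; prim.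
by apply: prim_row_ok; prim; prim_sub.
Qed.

Section PrimGuess.
Context {X : Type} {cX : coded X} (M : X -> codes) (g : X -> guess).
Hypotheses (pM : prim M) (pg : prim g).

Lemma prim_g_stage : prim (fun x => g_stage (g x)). Proof. by rewrite /g_stage; prim. Qed.
Lemma prim_g_time : prim (fun x => g_time (g x)). Proof. by rewrite /g_time; prim. Qed.
Lemma prim_g_cert : prim (fun x => g_cert (M x) (g x)).
Proof. by rewrite /g_cert; apply: prim_certify; prim; rewrite /g_stage /g_time; prim. Qed.
Lemma prim_g_old : prim (fun x => g_old (M x) (g x)).
Proof. by apply: prim_snd; apply: prim_g_cert. Qed.
Lemma prim_g_arg : prim (fun x => g_arg (g x)). Proof. by rewrite /g_arg; prim. Qed.
Lemma prim_g_next : prim (fun x => g_next (g x)). Proof. by rewrite /g_next; prim. Qed.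
Lemma prim_g_target : prim (fun x => g_target (g x)).
Proof. by rewrite /g_target; prim; [apply: prim_g_arg | apply: prim_g_next]. Qed.
Lemma prim_g_new : prim (fun x => g_new (g x)).
Proof. by rewrite /g_new; prim; apply: prim_g_arg. Qed.
End PrimGuess.

Ltac prim_more :=
  repeat first
  [ prim_step
  | lazymatch goal with
    | |- prim (fun x => dead _ _) => apply: prim_dead
    | |- prim (fun x => rep _ _) => apply: prim_rep
    | |- prim (fun x => believed _ _) => apply: prim_believed
    | |- prim (fun x => bound _ _) => apply: prim_bound
    | |- prim (fun x => current _ _) => apply: prim_current
    | |- prim (fun x => refuted _ _ _ _) => apply: prim_refuted
    | |- prim (fun x => returns _ _ _ _) => apply: prim_returns
    | |- prim (fun x => row_ok _ _ _ _ _) => apply: prim_row_ok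
    | |- prim (fun x => g_stage _) => apply: prim_g_stage
    | |- prim (fun x => g_time _) => apply: prim_g_time
    | |- prim (fun x => g_cert _ _) => apply: prim_g_cert
    | |- prim (fun x => g_old _ _) => apply: prim_g_old
    | |- prim (fun x => g_arg _) => apply: prim_g_arg
    | |- prim (fun x => g_next _) => apply: prim_g_next
    | |- prim (fun x => g_target _) => apply: prim_g_target
    | |- prim (fun x => g_new _) => apply: prim_g_new
    end
  | match goal with H : prim ?f |- prim _ => apply: (prim_comp H) end ].

Lemma prim_certified {X : Type} {cX : coded X} (M : X -> codes) (g : X -> guess) :
  prim M -> prim g -> prim (fun x => certified (M x) (g x)).
Proof. by move=> pM pg; rewrite /certified; prim_more. Qed.

Lemma prim_opens {X : Type} {cX : coded X} (M : X -> codes) (lg : X -> seq event)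
  (s j : X -> nat) (g : X -> guess) : prim M -> prim lg -> prim s -> prim j -> prim g ->
  prim (fun x => opens (M x) (lg x) (s x) (j x) (g x)).
Proof.
by move=> pM plg ps pj pg; rewrite /opens; prim_more; apply: prim_certified.
Qed.

Lemma prim_try_open {X : Type} {cX : coded X} (M : X -> codes) (lg : X -> seq event)
  (s j : X -> nat) (g : X -> guess) : prim M -> prim lg -> prim s -> prim j -> prim g ->
  prim (fun x => try_open (M x) (lg x) (s x) (j x) (g x)).
Proof.
move=> pM plg ps pj pg; rewrite /try_open /opening; prim_more.
exact: prim_opens.
Qed.

Lemma prim_try_close {X : Type} {cX : coded X} (M : X -> codes) (lg : X -> seq event)
  (s j : X -> nat) (g : X -> guess) (e : X -> event) :
  prim M -> prim lg -> prim s -> prim j -> prim g -> prim e ->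
  prim (fun x => try_close (M x) (lg x) (s x) (j x) (g x) (e x)).
Proof.
move=> pM plg ps pj pg pe.
by rewrite /try_close /closing /goal /blocker /blocked; prim_more.
Qed.

Lemma prim_log_step {X : Type} {cX : coded X} (s : X -> nat) (lg : X -> seq event) :
  prim s -> prim lg -> prim (fun x => log_step (s x) (lg x)).
Proof.
move=> ps plg; rewrite /log_step /owner; prim_more.
all: first [apply: prim_try_close | apply: prim_try_open | idtac]; prim_more.
Qed.

Lemma prim_log {X : Type} {cX : coded X} (s : X -> nat) : prim s -> prim (fun x => log (s x)).
Proof.
move=> ps; apply: (@eq_prim _ _ _ _
  (fun x => (iter (s x) (fun p : nat * seq event => (p.1.+1, log_step p.1 p.2)) (0, [::])).2)).
  move=> x; suff -> : iter (s x) (fun p : nat * seq event => (p.1.+1, log_step p.1 p.2)) (0, [::])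
    = (s x, log (s x)) by [].
  by elim: (s x) => // n; rewrite iterS => ->.
by prim; apply: prim_log_step; prim.
Qed.

Lemma prim_some_bot {X : Type} {cX : coded X} (lg : X -> seq event) (s : X -> seq nat) :
  prim lg -> prim s -> prim (fun x => some_bot (lg x) (s x)).
Proof. by move=> plg ps; rewrite /some_bot /blocker /blocked; prim_more. Qed.

Lemma prim_some_cex {X : Type} {cX : coded X} (lg : X -> seq event) (s : X -> seq nat) :
  prim lg -> prim s -> prim (fun x => some_cex (lg x) (s x)).
Proof. by move=> plg ps; rewrite /some_cex; prim_more. Qed.

(** * Invariants of the construction *)

Lemma rep_cons e lg b : rep (e :: lg) b =
  if block (blocker e) == b then maxn (rep lg b) (index_in (blocker e)) else rep lg b.
Proof. by rewrite /=; case: ifP => //; case: ifP; lia. Qed.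

Lemma dead_cons e lg b : dead (e :: lg) b = (b \in killed e) || dead lg b.
Proof. by []. Qed.

Lemma bound_cons e lg j : bound (e :: lg) j =
  if owner e < j then maxn (bound lg j) (j + horizon e) else bound lg j.
Proof. by rewrite /bound /=; case: ifP => //; case: ifP; lia. Qed.

Lemma current_cons e lg j : current (e :: lg) j = if owner e <= j then Some e else current lg j.
Proof. by []. Qed.

Lemma rep_ge lg (e : event) : e \in lg -> index_in (blocker e) <= rep lg (block (blocker e)).
Proof.
elim: lg => // f lg IH; rewrite inE rep_cons => /orP[/eqP ->|/IH]; first by rewrite eqxx; lia.
by case: ifP; lia.
Qed.

Lemma bound_ge lg j : j <= bound lg j.
Proof. exact: leq_addr. Qed.

(** The summand [j] in [bound] makes this strict, which keeps the block [bound lg j] itself out of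
    reach of weaker strategies. *)
Lemma bound_lt lg j j' : j < j' -> bound lg j < bound lg j'.
Proof.
move=> jj; elim: lg => [|e lg IH]; first by rewrite /bound /= !addn0.
by rewrite !bound_cons; case: ifP; case: ifP; lia.
Qed.

Lemma bound_horizon lg (e : event) j : e \in lg -> owner e < j -> j + horizon e <= bound lg j.
Proof.
elim: lg => // f lg IH; rewrite inE bound_cons => /orP[/eqP ->|/IH h] ej.
  by rewrite ej; lia.
by have := h ej; case: ifP; lia.
Qed.

Lemma current_owner lg j e : current lg j = Some e -> e \in lg /\ owner e <= j.
Proof.
elim: lg => // f lg IH; rewrite current_cons; case: ifP => [fj [<-]|_ /IH[el ej]].
  by rewrite mem_head.
by rewrite inE el orbT.
Qed.

Definition idle lg j : bool := if current lg j is Some e then owner e != j else true.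

Definition ordered (lg : seq event) : Prop :=
  forall e : event, e \in lg -> block (blocker e) < blocked e.

Definition acts_above (e : event) (N : nat) : Prop :=
  [/\ forall b : nat, b \in killed e -> N <= b, N <= block (blocker e) & N <= blocked e].

Lemma dead_above e lg N b : acts_above e N -> b < N -> dead (e :: lg) b = dead lg b.
Proof. by case=> k _ _ bN; rewrite /=; case: (boolP (b \in killed e)) => //= /k; lia. Qed.

Lemma rep_above e lg N b : acts_above e N -> b < N -> rep (e :: lg) b = rep lg b.
Proof. by case=> _ k _ bN; rewrite rep_cons; case: eqP => //; lia. Qed.

Lemma live_above e lg N e' : acts_above e N -> block (blocker e') < N ->
  live (e :: lg) e' = live lg e'.
Proof. by move=> eN bN; rewrite /live (dead_above lg eN bN) (rep_above lg eN bN). Qed.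

(** Discarding is irreversible and representatives only increase, so a lost liveness never comes
    back. *)
Lemma live_cons e lg (e' : event) : e' \in lg -> live (e :: lg) e' -> live lg e'.
Proof.
move=> /rep_ge ge; rewrite /live rep_cons dead_cons negb_or => /andP[/andP[_ ->]].
by case: ifP => _ /eqP; lia.
Qed.

Lemma believed_above e lg N z : ordered lg -> acts_above e N -> block z < N ->
  believed (e :: lg) z = believed lg z.
Proof.
move=> ord eN zN; rewrite /believed (dead_above lg eN zN) (rep_above lg eN zN).
congr (_ && _); rewrite /=.
have [_ _ bN] := eN; have -> : (blocked e == block z) = false by apply/eqP; lia.
rewrite andbF /=; apply: eq_in_all => e' /ord oe'.
case: eqP => [E|_]; last by rewrite !andbF.
by rewrite (@live_above e lg N) // -?E; lia.
Qed.

Lemma believedP lg z : reflect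
  [/\ ~~ dead lg (block z), index_in z = rep lg (block z) &
      forall e : event, e \in lg -> live lg e -> blocked e <> block z] (believed lg z).
Proof.
rewrite /believed; apply: (iffP andP) => [[/andP[d /eqP i] /allP a]|[d /eqP i a]].
  by split=> // e /a; rewrite negb_and => + l E; rewrite l E eqxx.
split; first by rewrite d.
by apply/allP => e el; rewrite negb_and; case: (boolP (live lg e)) => //= /(a e el)/eqP.
Qed.

Lemma believed_block lg y z : believed lg y -> believed lg z -> block y = block z -> y = z.
Proof.
move=> /believedP[_ iy _] /believedP[_ iz _] E.
by rewrite -(pair_nat_eta y) -(pair_nat_eta z) iy iz E.
Qed.

Definition fresh lg b : Prop :=
  [/\ ~~ dead lg b, rep lg b = 0 & forall e : event, e \in lg -> blocked e <> b].

Lemma fresh_believed lg b : fresh lg b -> believed lg (pair_nat b 0).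
Proof. by case=> d r f; apply/believedP; rewrite block_pair index_in_pair; split=> // e /f. Qed.

Definition codes_of (j : nat) : codes := dec j.

(** By [waits_goal], all live obstacles to the goal sit in the block of [blocker e], so discarding
    this one block makes the whole goal believed. [waits_target] keeps a member of the goal above
    the bound, a source of large beliefs once the strategy has finished. *)
Record waits (lg : seq event) (j : nat) (e : event) : Prop := {
  waits_bound : bound lg j <= block (blocker e);
  waits_blocker : believed lg (blocker e);
  waits_guess : exists2 g, certified (codes_of j) g &
    [/\ goal e = g_target g :: g_old (codes_of j) g,
        forall z : nat, z \in g_old (codes_of j) g -> believed lg z,
        forall y : nat, y \in g_arg g :: g_next g -> ~~ believed lg y &
        forall y : nat, y \in g_arg g :: g_next g -> block y < horizon e];
  waits_goal : forall z : nat, z \in goal e -> [/\ block z < horizon e, ~~ dead lg (block z),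
    index_in z = rep lg (block z), block z <> block (blocker e) &
    forall e' : event, e' \in lg -> live lg e' -> blocked e' = block z ->
      block (blocker e') = block (blocker e)];
  waits_target : exists2 z : nat, z \in goal e & bound lg j <= block z
}.

Record finished (lg : seq event) (j : nat) (e : event) : Prop := {
  finished_refuted : exists2 G, exists n t, refuted (codes_of j).2.1 n t G &
    (forall z : nat, z \in G -> believed lg z /\ block z < horizon e) /\
    exists2 z : nat, z \in G & bound lg j <= block z
}.

(** [coherent_chain] is what makes the beliefs read off the log agree with the run of Gamma: a live
    event could otherwise deny belief in a block that the run keeps, its blocker not being held.
    [coherent_idle] supplies an untouched block for each idle strategy. *)
Record coherent (s : nat) (lg : seq event) : Prop := {
  coherent_event : forall e : event, e \in lg -> [/\ horizon e < s,
    forall b : nat, b \in killed e -> b < horizon e & block (blocker e) < blocked e < horizon e];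
  coherent_chain : forall e : event, e \in lg -> live lg e -> ~~ dead lg (blocked e) ->
    believed lg (blocker e);
  coherent_idle : forall j, idle lg j -> fresh lg (bound lg j);
  coherent_waits : forall j e, current lg j = Some e -> owner e = j -> goal e != [::] ->
    waits lg j e;
  coherent_finished : forall j e, current lg j = Some e -> owner e = j -> goal e = [::] ->
    finished lg j e
}.

Lemma coherent_ordered s lg : coherent s lg -> ordered lg.
Proof. by move=> cl e /(coherent_event cl)[_ _ /andP[]]. Qed.

(** * Preservation of the invariants when an event is added *)

Section Preservation.
Variables (s j : nat) (lg : seq event) (e : event).
Hypotheses (cl : coherent s lg) (ej : owner e = j) (es : horizon e = s).
Hypotheses (eN : acts_above e (bound lg j)).

Let ord := coherent_ordered cl.

Lemma preserved_block j' e' z : j' < j -> current lg j' = Some e' -> owner e' = j' ->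
  z < horizon e' -> z < bound lg j.
Proof.
move=> jj /current_owner[el _] eo zh; have oj : owner e' < j by rewrite eo.
by have := bound_horizon el oj; lia.
Qed.

Lemma waits_preserved j' e' : j' < j -> current lg j' = Some e' -> owner e' = j' ->
  waits lg j' e' -> waits (e :: lg) j' e'.
Proof.
move=> jj ce oe [w1 w2 [g cg [g1 g2 g3 g4]] w4 [z0 z0g z0b]].
have low z : z < horizon e' -> z < bound lg j by apply: (preserved_block jj ce oe).
have bel z : block z < horizon e' -> believed (e :: lg) z = believed lg z.
  by move=> /low; apply: believed_above.
have Eb : bound (e :: lg) j' = bound lg j' by rewrite bound_cons ifN //; lia.
have [el _] := current_owner ce; have [_ _ /andP[h1 h2]] := coherent_event cl el.
split.
- by rewrite Eb.
- by rewrite bel //; lia.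
- exists g => //; split=> //; last by move=> y yg; rewrite bel ?g3 ?g4.
  move=> y yg; rewrite bel ?g2 //.
  by have [] := w4 y _; rewrite ?g1 ?inE ?yg ?orbT.
- move=> z zg; have [z1 z2 z3 z4 z5] := w4 z zg; have zN := low _ z1.
  rewrite (dead_above lg eN zN) (rep_above lg eN zN); split=> // e''.
  have [_ _ bN] := eN; rewrite inE => /orP[/eqP -> _ E|e''l l'' E]; first lia.
  apply: z5 => //; move: l''; rewrite (@live_above e lg (bound lg j)) //.
  by have := ord e''l; lia.
- by exists z0 => //; rewrite Eb.
Qed.

Lemma finished_preserved j' e' : j' < j -> current lg j' = Some e' -> owner e' = j' ->
  finished lg j' e' -> finished (e :: lg) j' e'.
Proof.
move=> jj ce oe [[G rG [bG [z0 z0G z0b]]]].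
have Eb : bound (e :: lg) j' = bound lg j' by rewrite bound_cons ifN //; lia.
split; exists G => //; split; last by exists z0 => //; rewrite Eb.
move=> z /bG[bz hz]; split=> //; rewrite (@believed_above e lg (bound lg j)) //.
exact: (preserved_block jj ce oe hz).
Qed.

(** The part common to openings and closings. What stronger strategies rely on lies below their
    horizons, which the event cannot reach; weaker strategies become idle with a bound of at least
    [s], above every block mentioned so far. *)
Lemma coherent_cons :
  (forall b : nat, b \in killed e -> b < s) -> block (blocker e) < blocked e < s ->
  (forall e' : event, e' \in e :: lg -> live (e :: lg) e' -> ~~ dead (e :: lg) (blocked e') ->
     believed (e :: lg) (blocker e')) ->
  (goal e != [::] -> waits (e :: lg) j e) ->
  (goal e = [::] -> finished (e :: lg) j e) -> coherent s.+1 (e :: lg).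
Proof.
move=> ks bs chain hw hf.
have ev e' : e' \in e :: lg -> [/\ horizon e' < s.+1,
    forall b : nat, b \in killed e' -> b < horizon e' & block (blocker e') < blocked e' < horizon e'].
  rewrite inE => /orP[/eqP ->|/(coherent_event cl)[h1 h2 h3]]; first by rewrite es.
  by split=> //; lia.
split=> //.
- move=> j'; rewrite /idle current_cons ej; case: ifP => jj; last first.
    move=> /(coherent_idle cl)[f1 f2 f3].
    have bb : bound lg j' < bound lg j by apply: bound_lt; lia.
    have -> : bound (e :: lg) j' = bound lg j' by rewrite bound_cons ifN //; lia.
    rewrite /fresh (dead_above lg eN bb) (rep_above lg eN bb); split=> // e'.
    by have [_ _ bN] := eN; rewrite inE => /orP[/eqP ->|/f3 //]; lia.
  rewrite ej => jj'; have Eb : s <= bound (e :: lg) j'.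
    have jlt : owner e < j' by rewrite ej ltn_neqAle jj' jj.
    by apply: leq_trans (bound_horizon (mem_head e lg) jlt); rewrite es leq_addl.
  split.
  - apply/hasPn => e' /ev[h1 h2 h3]; apply/negP => /h2; lia.
  - have: forall e' : event, e' \in e :: lg -> block (blocker e') < s.
      by move=> e' /ev[h1 h2 h3]; lia.
    elim: (e :: lg) (bound _ _) Eb => // f l IH b sb h; rewrite rep_cons IH //.
      by case: eqP => // E; have := h f (mem_head _ _); lia.
    by move=> e' el; apply: h; rewrite inE el orbT.
  - by move=> e' /ev[h1 h2 h3]; lia.
- move=> j' e'; rewrite current_cons ej; case: ifP => jj.
    by case=> <- E; move: (E); rewrite ej => <-.
  move=> ce oe ge; apply: waits_preserved => //; first lia.
  exact: (coherent_waits cl ce oe ge).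
- move=> j' e'; rewrite current_cons ej; case: ifP => jj.
    by case=> <- E; move: (E); rewrite ej => <-.
  move=> ce oe ge; apply: finished_preserved => //; first lia.
  exact: (coherent_finished cl ce oe ge).
Qed.

End Preservation.

Section Opening.
Variables (s j : nat) (lg : seq event) (g : guess).
Notation M := (codes_of j).
Hypotheses (cl : coherent s lg) (op : opens M lg s j g).
Notation L := (g_old M g).
Notation a := (g_arg g).
Notation x := (g_target g).
Notation c := (g_new g).
Let e : event := opening M lg s j g.

Let opened : certified M g /\
  [/\ believed lg a, forall l : nat, l \in L -> believed lg l & believed lg x] /\
  [/\ bound lg j <= block a, block a < block x & index_in a < index_in c] /\
  [/\ forall y : nat, y \in g_next g -> ~~ (believed lg y && (block y < bound lg j)),
      forall y : nat, y \in g_next g -> y != c,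
      block a < s, forall l : nat, l \in L -> block l < s &
      forall y : nat, y \in g_next g -> block y < s] /\
  [/\ a \notin L, forall y : nat, y \in g_next g -> y \notin L & x \in g_next g].
Proof.
move: op; rewrite /opens => /andP[/andP[/andP[/andP[/andP[/andP[/andP[/andP[/andP[ce]]]]]]]]].
move=> /= /andP[ba /allP bL] bx aN ax /allP ys ak as_ /allP Ls /allP yss.
have [aL yL] : a \notin L /\ forall y : nat, y \in g_next g -> y \notin L.
  by move: ce => /andP[/andP[_ aL] /allP yL].
split=> //; split=> //; split; first by rewrite index_in_pair.
split; first by split=> // y /ys /andP[].
split=> //; have := mem_last a (g_next g); rewrite -/x inE.
by case: eqP => // E; move: ax; rewrite E ltnn.
Qed.

Let ba : believed lg a. Proof. by have [_ [[]]] := opened. Qed.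
Let bL (l : nat) : l \in L -> believed lg l. Proof. by have [_ [[_ h _] _]] := opened; apply: h. Qed.
Let bx : believed lg x. Proof. by have [_ [[]]] := opened. Qed.
Let aN : bound lg j <= block a. Proof. by have [_ [_ [[]]]] := opened. Qed.
Let ax : block a < block x. Proof. by have [_ [_ [[]]]] := opened. Qed.
Let aL : a \notin L. Proof. by have [_ [_ [_ [_ []]]]] := opened. Qed.
Let xy : x \in g_next g. Proof. by have [_ [_ [_ [_ []]]]] := opened. Qed.
Let yL (y : nat) : y \in g_next g -> y \notin L.
Proof. by have [_ [_ [_ [_ [_ h _]]]]] := opened; apply: h. Qed.
Let ys (y : nat) : y \in g_next g -> block y < s.
Proof. by have [_ [_ [_ [[_ _ _ _ h] _]]]] := opened; apply: h. Qed.
Let ac : index_in a < index_in c. Proof. by have [_ [_ [[]]]] := opened. Qed.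
Let bc : block c = block a. Proof. by rewrite block_pair. Qed.

Lemma opening_above : acts_above e (bound lg j).
Proof.
split; rewrite /killed /blocker /blocked /=; last 2 first.
- by rewrite bc.
- by have := aN; have := ax; lia.
by move=> b; rewrite mem_filter => /andP[/andP[/andP[/andP[]]]].
Qed.

Let eN := opening_above.

Let killedE (b : nat) : b \in killed e =
  [&& b < s, bound lg j <= b, b != block a, b != block x & b \notin map block L].
Proof.
by rewrite /killed [_.1]/= mem_filter mem_iota add0n leq0n andTb andbC -!andbA.
Qed.

Let new_believed : believed (e :: lg) c.
Proof.
have [da ia pa] := believedP _ _ ba.
apply/believedP; rewrite bc; split.
- by rewrite dead_cons killedE eqxx !andbF.
- by rewrite rep_cons /blocker /= bc eqxx -ia; have := ac; lia.
- move=> e'; rewrite inE => /orP[/eqP -> _ E|el /(live_cons el)]; last exact: pa.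
  by move: ax; rewrite -E ltnn.
Qed.

Let new_live : live (e :: lg) e.
Proof. by have [d i _] := believedP _ _ new_believed; rewrite /live d -i /=. Qed.

Let keep_believed z : believed lg z -> block z \notin killed e ->
  block z <> block a -> block z <> block x -> believed (e :: lg) z.
Proof.
move=> /believedP[dz iz pz] kz za zx; apply/believedP; split.
- by rewrite dead_cons negb_or kz.
- by rewrite rep_cons /blocker /= bc; case: eqP => // E; case: za.
- move=> e'; rewrite inE => /orP[/eqP -> _ E|el /(live_cons el)]; last exact: pz.
  by case: zx.
Qed.

Let old_believed (l : nat) : l \in L -> believed (e :: lg) l.
Proof.
move=> lL; apply: keep_believed; first exact: bL.
- by rewrite killedE (map_f block lL) !andbF.
- by move=> E; move: aL; rewrite -(believed_block (bL lL) ba E) lL.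
- by move=> E; move: (yL xy); rewrite -(believed_block (bL lL) bx E) lL.
Qed.

(** Below the bound nothing changes. In the block of [a] or of a member of [L] the believed argument
    is another one, the block of the target is blocked by the new event, and all other blocks in
    range are discarded. *)
Let next_unbelieved (y : nat) : y \in a :: g_next g -> ~~ believed (e :: lg) y.
Proof.
have [_ ia _] := believedP _ _ ba.
rewrite inE => /orP[/eqP ->|yg].
  apply/negP => /believedP[_]; rewrite rep_cons /blocker /= bc eqxx => + _.
  by have := ac; lia.
have [_ [_ [_ [[h1 h2 _ _ _] _]]]] := opened.
apply/negP => by'; case: (ltnP (block y) (bound lg j)) => yN.
  move: (h1 y yg); rewrite yN andbT -(believed_above (coherent_ordered cl) eN yN).
  by rewrite by'.
have [dy _ py] := believedP _ _ by'.
case: (block y =P block a) => [E|/eqP ya].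
  by move: (h2 y yg); rewrite (believed_block by' new_believed) ?eqxx ?bc.
case: (block y =P block x) => [E|/eqP yx].
  by apply: (py e); rewrite ?mem_head ?new_live.
case: (boolP (block y \in map block L)) => [/mapP[l lL E]|yB].
  by move: (yL yg); rewrite (believed_block by' (old_believed lL) E) lL.
by move: dy; rewrite dead_cons killedE (ys yg) yN ya yx yB.
Qed.

(** The danger is that the new event blocks the blocker of an older live event [e']. Then
    [blocked e'] is above the block of the target, so it is discarded now, unless a member of [L]
    lies in it; but such a member was believed, which [e'] being live excludes. *)
Let chain (e' : event) : e' \in e :: lg -> live (e :: lg) e' ->
  ~~ dead (e :: lg) (blocked e') -> believed (e :: lg) (blocker e').
Proof.
rewrite inE => /orP[/eqP -> _ _|el lv]; first exact: new_believed.
rewrite dead_cons negb_or => /andP[kb db].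
have lv0 := live_cons el lv.
have [_ _ pc] := believedP _ _ (coherent_chain cl el lv0 db).
have /andP[dc /eqP ic] := lv.
apply/believedP; split=> // e''; rewrite inE => /orP[/eqP -> _ E|el'' /(live_cons el'')]; last exact: pc.
have [_ _ /andP[b1 b2]] := coherent_event cl el.
have b3 : horizon e' < s by have [] := coherent_event cl el.
have E' : block x = block (blocker e') by [].
case: (boolP (blocked e' \in map block L)) => [/mapP[l lL El]|nB].
  by have [_ _ pl] := believedP _ _ (bL lL); case: (pl e').
have xb : block x < blocked e' by rewrite E'.
move: kb; rewrite killedE nB andbT => /negP[].
have axb := ltn_trans ax xb.
rewrite (ltn_trans b2 b3) (ltnW (leq_ltn_trans aN axb)) (gtn_eqF axb).
by rewrite (gtn_eqF xb).
Qed.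

Lemma coherent_opening : coherent s.+1 (e :: lg).
Proof.
have [cg [_ [_ [[_ _ as_ Ls _] _]]]] := opened.
apply: (@coherent_cons _ j) => //.
- by move=> b; rewrite killedE => /andP[].
- by rewrite /blocker /blocked /= bc ax ys.
- move=> _; split=> //.
  + by rewrite bound_cons ltnn /blocker /= bc.
  + exists g => //; split=> // y; rewrite inE => /orP[/eqP -> //|]; exact: ys.
  + move=> z; rewrite -[goal e]/(x :: L) inE => /orP[/eqP ->|zL].
      have [dx ix px] := believedP _ _ bx.
      split; first exact: ys.
      * by rewrite dead_cons killedE eqxx !andbF.
      * by rewrite rep_cons /blocker /= bc; case: eqP => // E; move: ax; rewrite E ltnn.
      * by rewrite /blocker /= bc => E; move: ax; rewrite E ltnn.
      * move=> e'; rewrite inE => /orP[/eqP -> //|el /(live_cons el) lv E].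
        by case: (px e').
    have [dz iz pz] := believedP _ _ (old_believed zL).
    split=> //; first exact: Ls.
      rewrite /blocker /= bc => E.
      by move: aL; rewrite -(believed_block (bL zL) ba E) zL.
    by move=> e' el lv E; case: (pz e').
  + exists x; first by rewrite mem_head.
    by rewrite bound_cons ltnn; have := aN; have := ax; lia.
Qed.

End Opening.

Section Closing.
Variables (s j : nat) (lg : seq event) (e0 : event) (n t : nat).
Hypotheses (cl : coherent s lg) (cur : current lg j = Some e0) (oj : owner e0 = j).
Hypotheses (g0 : goal e0 != [::]) (ref : refuted (codes_of j).2.1 n t (goal e0)).
Let e : event := closing e0 s j.
Let w := coherent_waits cl cur oj g0.
Let el0 : e0 \in lg. Proof. by have [] := current_owner cur. Qed.

Let closed_dead : dead (e :: lg) (block (blocker e0)).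
Proof. by rewrite dead_cons /killed /= mem_head. Qed.

Let goal_believed (z : nat) : z \in goal e0 -> believed (e :: lg) z.
Proof.
move=> /(waits_goal w)[_ dz iz nz pz]; apply/believedP; split.
- by rewrite dead_cons /killed /= inE negb_or dz andbT; apply/eqP.
- by rewrite rep_cons -[blocker e]/(blocker e0); case: eqP => // E; case: nz.
- move=> e'; rewrite inE => /orP[/eqP -> /andP[]|el lv E].
    by rewrite -[blocker e]/(blocker e0) closed_dead.
  move: (lv) => /andP[]; rewrite (pz e' el (live_cons el lv) E).
  by rewrite closed_dead.
Qed.

Lemma closing_above : acts_above e (bound lg j).
Proof.
have [h1 h2 /andP[h3 h4]] := coherent_event cl el0.
split; rewrite /killed /blocker /blocked /=; last 2 first.
- exact: waits_bound w.
- by have := waits_bound w; rewrite /blocker /blocked in h3 *; lia.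
- by move=> b; rewrite inE => /eqP ->; apply: waits_bound w.
Qed.

Lemma coherent_closing : coherent s.+1 (e :: lg).
Proof.
have [h1 h2 /andP[h3 h4]] := coherent_event cl el0.
have Eb : bound (e :: lg) j = bound lg j by rewrite bound_cons /= ltnn.
apply: (@coherent_cons _ j) => //.
- exact: closing_above.
- by move=> b; rewrite inE => /eqP ->; rewrite /blocker /blocked in h3 h4 *; lia.
- by rewrite -[blocker e]/(blocker e0) -[blocked e]/(blocked e0); lia.
- move=> e'; rewrite inE => /orP[/eqP -> /andP[]|el lv].
    by rewrite -[blocker e]/(blocker e0) closed_dead.
  rewrite dead_cons negb_or => /andP[_ db].
  have [_ _ pc] := believedP _ _ (coherent_chain cl el (live_cons el lv) db).
  have /andP[dc /eqP ic] := lv.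
  apply/believedP; split=> // e''; rewrite inE => /orP[/eqP -> /andP[]|el'' /(live_cons el'')].
    by rewrite -[blocker e]/(blocker e0) closed_dead.
  exact: pc.
- move=> _; split; exists (goal e0); first by exists n, t.
  split=> [z zg|]; first by split; [exact: goal_believed | have [] := waits_goal w zg; rewrite -[horizon e]/s; lia].
  by have [z zg zb] := waits_target w; exists z => //; rewrite Eb.
Qed.

End Closing.

Lemma coherent_log s : coherent s (log s).
Proof.
elim: s => [|s IH].
  by split=> // j _; split.
have weak : coherent s.+1 (log s).
  case: IH => h1 h2 h3 h4 h5; split=> // e /h1[? ? ?]; split=> //; lia.
have opn : idle (log s) (block s) -> coherent s.+1
    (try_open (dec (block s)) (log s) s (block s) (dec (block (index_in s)))).
  by move=> _; rewrite /try_open; case: ifP => // op; apply: coherent_opening.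
rewrite /= /log_step; move: opn; rewrite /idle.
case cur: (current _ _) => [e|]; last by apply.
case: eqP => [oj _|_]; last by apply.
rewrite /try_close; case: ifP => // /andP[g0 ref].
by apply: coherent_closing IH cur oj _ ref; move: g0; case: (goal e).
Qed.

(** * Convergence of the construction *)

Definition acts (s : nat) : bool := log s.+1 != log s.

Lemma log_cases s : ~~ acts s \/ exists e, [/\ log s.+1 = e :: log s, owner e = block s,
  horizon e = s, acts_above e (bound (log s) (block s)) &
  (idle (log s) (block s) /\ goal e != [::]) \/
  (goal e = [::] /\ exists e0, [/\ current (log s) (block s) = Some e0,
     owner e0 = block s & goal e0 != [::]])].
Proof.
have cl := coherent_log s.
rewrite /acts; case: eqP => E; [by left | right].
have opn : log s.+1 = try_open (dec (block s)) (log s) s (block s) (dec (block (index_in s))) ->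
    idle (log s) (block s) -> exists e, [/\ log s.+1 = e :: log s, owner e = block s,
    horizon e = s, acts_above e (bound (log s) (block s)) &
    (idle (log s) (block s) /\ goal e != [::]) \/
    (goal e = [::] /\ exists e0, [/\ current (log s) (block s) = Some e0,
       owner e0 = block s & goal e0 != [::]])].
  rewrite /try_open; case: ifP => // op -> idl; eexists; split; first reflexivity; try by [].
    exact: opening_above op.
  by left.
move: opn E; rewrite [log _]/= /log_step /idle.
case cur: (current _ _) => [e|]; last by move=> opn _; apply: opn.
case: eqP => [oj _|oj opn _]; last by apply: opn => //; apply/eqP.
rewrite /try_close; case: ifP => // /andP[g0 ref] _.
have g0' : goal e != [::] by move: g0; case: (goal e).
eexists; split; first reflexivity; try by [].
  exact: closing_above cl cur oj g0' ref.
by right; split=> //; exists e.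
Qed.

Lemma log_sub s s' : s <= s' -> {subset log s <= log s'}.
Proof.
move=> ss; rewrite -(subnK ss); elim: (s' - s) => // k IH e /IH.
rewrite addSn; case: (log_cases (k + s)) => [/negPn/eqP -> //|[f [-> _ _ _ _]]].
by rewrite inE => ->; rewrite orbT.
Qed.

Lemma dead_mono s s' b : s <= s' -> dead (log s) b -> dead (log s') b.
Proof. by move=> /log_sub sub /hasP[e /sub el eb]; apply/hasP; exists e. Qed.

Lemma rep_mono s s' b : s <= s' -> rep (log s) b <= rep (log s') b.
Proof.
move=> ss; rewrite -(subnK ss); elim: (s' - s) => // k IH; apply: leq_trans IH _.
rewrite addSn; case: (log_cases (k + s)) => [/negPn/eqP -> //|[f [-> _ _ _ _]]].
by rewrite rep_cons; case: ifP; lia.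
Qed.

Lemma bound_mono s s' j : s <= s' -> bound (log s) j <= bound (log s') j.
Proof.
move=> ss; rewrite -(subnK ss); elim: (s' - s) => // k IH; apply: leq_trans IH _.
rewrite addSn; case: (log_cases (k + s)) => [/negPn/eqP -> //|[f [-> _ _ _ _]]].
by rewrite bound_cons; case: ifP; lia.
Qed.

(* 0 while j is idle, 1 while it waits, 2 once it has finished. *)
Definition phase (s j : nat) : nat :=
  if current (log s) j is Some e then
    if owner e == j then (if goal e == [::] then 2 else 1) else 0
  else 0.

(** An action of [j] either opens from the idle state or closes from the waiting one, and only
    stronger strategies can reset it. *)
Lemma phase_step s j : (acts s -> j <= block s) ->
  phase s j <= phase s.+1 j /\ (acts s -> block s = j -> phase s j < phase s.+1 j).
Proof.
rewrite /phase; case: (log_cases s) => [/[dup] na /negPn/eqP -> _|[e [E oe _ _ he]] low].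
  by split=> // a; rewrite a in na.
have a : acts s by rewrite /acts E; apply/eqP => /(congr1 size) /=; lia.
rewrite E current_cons oe; have := low a; rewrite leq_eqVlt => /orP[/eqP ej|ej].
  rewrite ej leqnn oe eqxx.
  case: he => [[]|[ge [e0 [-> -> ]]]]; last by rewrite ge eqxx -ej eqxx => /negPf ->.
  rewrite /idle -ej; case: (current _ _) => [e0|_ /negPf ->] //.
  by move=> /negPf -> /negPf ->.
by rewrite [block s <= j]leqNgt ej /=; split=> // _ E'; move: ej; rewrite E' ltnn.
Qed.

Definition settled (j s0 : nat) : Prop := forall s, s0 <= s -> acts s -> j < block s.

Lemma phase_le2 s j : phase s j <= 2.
Proof. by rewrite /phase; case: (current _ _) => [e|] //; case: (_ == j) => //; case: (_ == _). Qed.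

(** Finite injury: once all stronger strategies have stopped, the phase of [j] never drops and rises
    with each of its actions, so at most two actions remain. *)
Lemma settle j : exists s0, settled j s0.
Proof.
suff core i s0 : (forall s, s0 <= s -> acts s -> i <= block s) -> exists s1, settled i s1.
  by elim: j => [|j [s0 h]]; [apply: (core 0 0) | apply: (core j.+1 s0)].
move=> low.
have mono s s' : s0 <= s -> s <= s' -> phase s i <= phase s' i.
  move=> s0s ss; rewrite -(subnK ss); elim: (s' - s) => // k IH; apply: leq_trans IH _.
  by have [|-> //] := @phase_step (k + s) i; apply: low; lia.
suff key k s1 : s0 <= s1 -> 2 - phase s1 i <= k -> exists s2, settled i s2.
  exact: (key _ s0 (leqnn _) (leqnn _)).
elim: k s1 => [|k IH] s1 s01 kP;
  (case: (pselect (exists s, [/\ s1 <= s, acts s & block s = i])) => [[s [ss sa si]]|none];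
   last first).
- exists s1 => s ss sa; rewrite ltn_neqAle low //; last by lia.
  by rewrite andbT; apply/eqP => si; apply: none; exists s.
- have [|_ /(_ sa si)] := @phase_step s i; first by apply: low; lia.
  have := mono s1 s s01 ss; have := phase_le2 s.+1 i; lia.
- exists s1 => s ss sa; rewrite ltn_neqAle low //; last by lia.
  by rewrite andbT; apply/eqP => si; apply: none; exists s.
- have [|_ /(_ sa si)] := @phase_step s i; first by apply: low; lia.
  have := mono s1 s s01 ss; have := phase_le2 s.+1 i => *.
  by apply: (IH s.+1); lia.
Qed.

Lemma settled_above j s0 s e : settled j s0 -> s0 <= s -> acts s ->
  log s.+1 = e :: log s -> acts_above e (bound (log s) (block s)) ->
  acts_above e (bound (log s0) j.+1).
Proof.
move=> st ss sa _ [h1 h2 h3]; have jb := st s ss sa.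
have le : bound (log s0) j.+1 <= bound (log s) (block s).
  apply: leq_trans (bound_mono j.+1 ss) _; move: jb; rewrite leq_eqVlt.
  by case/orP => [/eqP -> //|/(bound_lt (log s))/ltnW].
by split=> [b /h1 hb||]; [exact: leq_trans le hb | exact: leq_trans le h2 | exact: leq_trans le h3].
Qed.

(** The strategies still acting are weaker than [j] and work at or above [bound (log s0) j.+1], as
    bounds never decrease. *)
Lemma settled_stays j s0 s z : settled j s0 -> s0 <= s -> block z < bound (log s0) j.+1 ->
  believed (log s) z = believed (log s0) z /\ rep (log s) (block z) = rep (log s0) (block z).
Proof.
move=> st ss zb; rewrite -(subnK ss); elim: (s - s0) => // k [IH1 IH2].
rewrite addSn; case: (log_cases (k + s0)) => [/negPn/eqP -> //|[e [E _ _ ab _]]].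
have sa : acts (k + s0) by rewrite /acts E; apply/eqP => /(congr1 size) /=; lia.
have ab' := settled_above st (leq_addl _ _) sa E ab.
rewrite E (believed_above (coherent_ordered (coherent_log _)) ab' zb) IH1.
by rewrite (rep_above _ ab' zb) IH2.
Qed.

Definition believed_limit (z : nat) : Prop :=
  exists s0, forall s, s0 <= s -> believed (log s) z.

Lemma believed_limitP j s0 z : settled j s0 -> block z < bound (log s0) j.+1 ->
  believed (log s0) z -> believed_limit z.
Proof. by move=> st zb bz; exists s0 => s ss; rewrite (settled_stays st ss zb).1. Qed.

Lemma believed_limit_dec z : believed_limit z \/
  exists s0, forall s, s0 <= s -> ~~ believed (log s) z.
Proof.
have [s0 st] := settle (block z).
have zb : block z < bound (log s0) (block z).+1 by apply: leq_trans (bound_ge _ _).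
case: (boolP (believed (log s0) z)) => bz; first by left; apply: (believed_limitP st zb bz).
by right; exists s0 => s ss; rewrite (settled_stays st ss zb).1.
Qed.

(** Whatever its final state, strategy [j] supplies such an element: from the fresh block when idle,
    the blocker when waiting, a member of the refuted goal when finished. *)
Lemma believed_limit_infinite j : exists2 z, believed_limit z & j <= block z.
Proof.
have [s0 st] := settle j; have cl := coherent_log s0.
have lim (z : nat) : block z < bound (log s0) j.+1 -> believed (log s0) z ->
    bound (log s0) j <= block z -> exists2 z, believed_limit z & j <= block z.
  move=> zb bz jz; exists z; first exact: (believed_limitP st zb bz).
  exact: leq_trans (bound_ge _ _) jz.
case: (boolP (idle (log s0) j)) => [/(coherent_idle cl) fr|].
  by apply: (lim (pair_nat (bound (log s0) j) 0)); rewrite ?block_pair ?bound_lt //; apply: fresh_believed.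
rewrite /idle; case cur: (current _ _) => [e|] //; rewrite negbK => /eqP oj.
have [el _] := current_owner cur; have [_ _ /andP[h1 h2]] := coherent_event cl el.
have hb : horizon e <= bound (log s0) j.+1.
  by have := bound_horizon el (j := j.+1); rewrite oj => /(_ (ltnSn _)); lia.
case: (eqVneq (goal e) [::]) => [g0|g0].
  have [[G _ [bG [z zG zb]]]] := coherent_finished cl cur oj g0.
  by have [bz hz] := bG z zG; apply: (lim z) => //; apply: leq_trans hb.
have w := coherent_waits cl cur oj g0.
apply: (lim (blocker e)); [|exact: waits_blocker w|exact: waits_bound w].
by apply: leq_trans hb; apply: ltn_trans h2.
Qed.

(** * The system and its belief set *)

Definition add_if (b : bool) (c : conclusion) (F : {fset conclusion}) : {fset conclusion} :=
  if b then (c |` F)%fset else F.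

Definition gamma_cons (n : nat) (F : {fset nat}) : {fset conclusion} :=
  add_if (some_bot (log n) F) Bot (add_if (some_cex (log n) F) Cex [fset Arg x | x in F]%fset).

Lemma in_gamma n (F : {fset nat}) c : (c \in gamma_cons n F) =
  match c with Bot => some_bot (log n) F | Cex => some_cex (log n) F | Arg x => x \in F end.
Proof.
have aF x : (Arg x \in [fset Arg x | x in F]%fset) = (x \in F).
  by apply/imfsetP/idP => /= [[y yF [->]]|xF] //; exists x.
have bF : (Bot \in [fset Arg x | x in F]%fset) = false by apply/imfsetP => -[].
have cF : (Cex \in [fset Arg x | x in F]%fset) = false by apply/imfsetP => -[].
rewrite /gamma_cons /add_if; case: (some_bot _ _); case: (some_cex _ _);
  by case: c => [||x]; rewrite ?in_fset1U ?aF ?bF ?cF.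
Qed.

Lemma some_bot_eq lg (s s' : seq nat) : s =i s' -> some_bot lg s = some_bot lg s'.
Proof.
move=> ss; rewrite /some_bot; congr (_ || _ || _).
- exact: (eq_has_r ss).
- rewrite (eq_has_r ss); apply: eq_has => z; exact: (eq_has_r ss).
- by apply: eq_has => e; rewrite ss (eq_has_r ss).
Qed.

Lemma some_cex_eq lg (s s' : seq nat) : s =i s' -> some_cex lg s = some_cex lg s'.
Proof. by move=> ss; apply: (eq_has_r ss). Qed.

Lemma has_sub (T : eqType) (p q : pred T) (s s' : seq T) :
  {subset s <= s'} -> (forall x, x \in s -> p x -> q x) -> has p s -> has q s'.
Proof. by move=> ss pq /hasP[x xs px]; apply/hasP; exists x; [apply: ss | apply: pq]. Qed.

Lemma some_bot_mono m n (s s' : seq nat) : m <= n -> {subset s <= s'} ->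
  some_bot (log m) s -> some_bot (log n) s'.
Proof.
move=> mn ss; rewrite /some_bot -!orbA => /or3P[] h; apply/or3P.
- by apply: Or31; apply: (has_sub ss _ h) => z _; apply: dead_mono.
- by apply: Or32; apply: (has_sub ss _ h) => z _; apply: (has_sub ss (fun _ _ h => h)).
- apply: Or33; apply: (has_sub (log_sub mn) _ h) => e _ /andP[/ss -> /=].
  exact: (has_sub ss (fun _ _ h => h)).
Qed.

Lemma some_cex_mono m n (s s' : seq nat) : m <= n -> {subset s <= s'} ->
  some_cex (log m) s -> some_cex (log n) s'.
Proof.
move=> mn ss; apply: has_sub => // z _ zr; apply: leq_trans zr _; exact: rep_mono.
Qed.

(** [Arg x] has code [x + 2], so passing from [F] to its arguments multiplies the code by 4; [Cex]
    and [Bot] are the two low digits. *)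
Lemma gamma_code n (F : {fset nat}) :
  fset_code conclusion_code (gamma_cons n F) =
  (fset_code id F + fset_code id F + (fset_code id F + fset_code id F)) +
    (if some_cex (log n) F then 2 else 0) + some_bot (log n) F.
Proof.
have argE : fset_code conclusion_code [fset Arg x | x in F]%fset
    = fset_code id F + fset_code id F + (fset_code id F + fset_code id F).
  rewrite /fset_code big_imfset /=; last by move=> x y _ _ [].
  by rewrite -!big_split /=; apply: eq_bigr => x _; rewrite !expnS; lia.
have bF : Bot \notin add_if (some_cex (log n) F) Cex [fset Arg x | x in F]%fset.
  rewrite /add_if; case: ifP => _; rewrite ?in_fset1U /=; by apply/imfsetP => -[].
have cF : Cex \notin [fset Arg x | x in F]%fset by apply/imfsetP => -[].
have addE b c G : c \notin G -> fset_code conclusion_code (add_if b c G)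
    = fset_code conclusion_code G + (if b then 2 ^ conclusion_code c else 0).
  by move=> cG; rewrite /add_if; case: b; rewrite ?fset_codeU1 ?addn0.
rewrite /gamma_cons (addE _ _ _ bF) (addE _ _ _ cF) argE /=.
by case: (some_bot _ _); case: (some_cex _ _).
Qed.

Definition gamma_next (x : nat) : nat := pair_nat (block x) (index_in x).+1.

Lemma gamma_iter k x : iter k gamma_next x = pair_nat (block x) (index_in x + k).
Proof.
elim: k => [|k IH]; first by rewrite addn0 pair_nat_eta.
by rewrite iterS IH /gamma_next block_pair index_in_pair addnS.
Qed.

Definition gamma_list (n : nat) : nat := n.

Lemma gamma_list_computable : computable_on id id setT gamma_list.
Proof. exact: primrec_computable primrec_id. Qed.

Lemma gamma_list_inj : injective gamma_list.
Proof. by []. Qed.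

Lemma gamma_args : range gamma_list = setT.
Proof. by apply/seteqP; split=> // x _; exists x. Qed.

Lemma computable_sub (X Y : Type) (cX : X -> nat) (cY : Y -> nat) (D : set X) (f : X -> Y) h :
  computable_on id id setT h -> (forall x, h (cX x) = cY (f x)) -> computable_on cX cY D f.
Proof. by case=> M MP hE; exists M => x _; rewrite -hE; apply: MP. Qed.

Lemma gamma_next_computable : computable_on id id (range gamma_list) gamma_next.
Proof.
apply: (@computable_sub _ _ _ _ _ _ gamma_next) => //; apply: primrec_computable.
by apply/prim_nat; rewrite /gamma_next; prim.
Qed.

Lemma gamma_cons_computable : computable_on query_code (fset_code conclusion_code)
  [set q : nat * {fset nat} | ([set` q.2] `<=` range gamma_list)%classic]
  (fun q => gamma_cons q.1 q.2).
Proof.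
pose h m := (index_in m + index_in m + (index_in m + index_in m)) +
  (if some_cex (log (block m)) (elements (index_in m)) then 2 else 0) +
  some_bot (log (block m)) (elements (index_in m)).
apply: (@computable_sub _ _ _ _ _ _ h).
  apply: primrec_computable; apply/prim_nat; rewrite /h.
  by prim; [apply: prim_some_cex | apply: prim_some_bot]; try apply: prim_log; prim;
     apply: prim_elements; prim.
move=> [n F]; rewrite gamma_code /h /query_code block_pair index_in_pair /=.
by rewrite (some_bot_eq _ (mem_elements F)) (some_cex_eq _ (mem_elements F)).
Qed.

Lemma gamma_limit_arg Y x : limit_operator gamma_cons Y (Arg x) <-> Y x.
Proof.
split=> [[n [F [FY]]]|Yx]; first by rewrite in_gamma => xF; apply: FY.
exists 0, [fset x]%fset; rewrite in_gamma in_fset1 eqxx; split=> // y /=.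
by rewrite in_fset1 => /eqP ->.
Qed.

Lemma gamma_approximated : approximated (range gamma_list) gamma_cons.
Proof.
have monoC n (F G : {fset nat}) c : (F `<=` G)%fset -> c \in gamma_cons n F -> c \in gamma_cons n G.
  move=> /fsubsetP FG; rewrite !in_gamma; case: c => [||x]; last exact: FG.
    exact: some_bot_mono.
  exact: some_cex_mono.
split.
- exact: gamma_cons_computable.
- by rewrite gamma_args => n F _ [||x] _; rewrite /conclusions; [right; left | right; right | left; exists x].
- by move=> n F G _ _ FG; apply/fsubsetP => c; apply: monoC.
- move=> n F _; apply/fsubsetP => c /imfsetP[x /= xF ->]; by rewrite in_gamma.
- move=> n F _; apply/fsubsetP => c; rewrite !in_gamma; case: c => [||x] //.
    exact: some_bot_mono.
  exact: some_cex_mono.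
split.
- by exists 0; rewrite gamma_args.
- by rewrite gamma_args => F _ [||x] _; rewrite /conclusions; [right; left | right; right | left; exists x].
- by move=> F G _ _ FG c [n [K [KF cK]]]; exists n, K; split=> //; apply: subset_trans FG.
- by move=> F _ _ [x Fx <-]; apply/gamma_limit_arg.
- move=> F _; congr limit_operator; rewrite gamma_args setIT.
  by apply/seteqP; split=> x /= /gamma_limit_arg.
Qed.

Lemma gamma_next_range x : range gamma_list x -> range gamma_list (gamma_next x).
Proof. by rewrite gamma_args. Qed.

Lemma gamma_next_acyclic n x : 0 < n -> range gamma_list x -> iter n gamma_next x <> x.
Proof.
by move=> n0 _; rewrite gamma_iter => /(congr1 index_in); rewrite index_in_pair; lia.
Qed.

Lemma gamma_empty (c : conclusion) : (forall x, c <> Arg x) -> ~ limit_operator gamma_cons set0 c.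
Proof.
move=> nc [n [F [F0]]]; have F0' : (F : seq nat) =i [::] by move=> x; apply/negP => /F0.
rewrite in_gamma (some_bot_eq _ F0') (some_cex_eq _ F0').
case: c nc => [_|_|x /(_ x)] //; rewrite /some_bot /=.
by elim: (log n).
Qed.

Lemma gamma_empty_bot : ~ limit_operator gamma_cons set0 Bot.
Proof. exact: gamma_empty. Qed.

Lemma gamma_empty_cex : ~ limit_operator gamma_cons set0 Cex.
Proof. exact: gamma_empty. Qed.

Definition gamma : q_dialectical :=
  {| listing_computable := gamma_list_computable;
     listing_injective := gamma_list_inj;
     consequence_approximated := gamma_approximated;
     revision_computable := gamma_next_computable;
     revision_codomain := gamma_next_range;
     revision_acyclic := gamma_next_acyclic;
     empty_not_bot := gamma_empty_bot;
     empty_not_cex := gamma_empty_cex |}.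

Lemma some_botP lg (s : seq nat) : some_bot lg s <->
  [\/ exists2 z : nat, z \in s & dead lg (block z),
      exists z y : nat, [/\ z \in s, y \in s, block z = block y & z <> y] |
      exists (e : event) (z : nat), [/\ e \in lg, blocker e \in s, z \in s & block z = blocked e]].
Proof.
rewrite /some_bot -orbA; split=> [/or3P[]|].
- by move=> /hasP[z zs dz]; apply: Or31; exists z.
- move=> /hasP[z zs /hasP[y ys /andP[/eqP zy /eqP nzy]]].
  by apply: Or32; exists z, y.
- move=> /hasP[e el /andP[es /hasP[z zs /eqP ze]]].
  by apply: Or33; exists e, z.
move=> [[z zs dz]|[z [y [zs ys zy nzy]]]|[e [z [el es zs ze]]]]; apply/or3P.
- by apply: Or31; apply/hasP; exists z.
- apply: Or32; apply/hasP; exists z => //; apply/hasP; exists y => //.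
  by rewrite zy eqxx; apply/eqP.
- apply: Or33; apply/hasP; exists e => //; rewrite es; apply/hasP; exists z => //.
  by rewrite ze.
Qed.

Lemma gamma_conflict s w :
  conflict gamma s w = some_bot (log s) (ran w) || some_cex (log s) (ran w).
Proof. by rewrite /conflict !in_gamma. Qed.

Lemma mem_ran_rcons (w : arg_string) x y :
  (y \in ran (rcons w (Some x))) = (y == x) || (y \in ran w).
Proof. by rewrite !in_ran mem_rcons inE; congr (_ || _); apply/eqP/eqP => [[]|->]. Qed.

Lemma rep_limit b : exists K, forall n, rep (log n) b <= K.
Proof.
have [s0 st] := settle b; exists (rep (log s0) b) => n.
case: (leqP n s0) => [|/ltnW ns]; first exact: rep_mono.
have zb : block (pair_nat b 0) < bound (log s0) b.+1 by rewrite block_pair; exact: bound_ge.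
by have [_] := settled_stays st ns zb; rewrite block_pair => ->.
Qed.

(** The representatives of a block are bounded, so some revision has an index that none of them
    exceeds; it has no counterexample of its own, and a stable string contributes none. *)
Lemma gamma_loopless : loopless gamma.
Proof.
apply: settles_loopless => w sw; pose p := listing gamma (size w).
have [K KP] := rep_limit (block p); exists K; rewrite -/p => -[n].
rewrite in_gamma => /hasP[y]; rewrite mem_ran_rcons => /orP[/eqP ->|yw].
  by rewrite gamma_iter index_in_pair block_pair ltnNge (leq_trans (KP n)) // leq_addl.
move=> yr; have := stable_consistent n sw; rewrite gamma_conflict negb_or => /andP[_ /negP[]].
by apply/hasP; exists y.
Qed.

(** In Cantor's pairing, [pair_nat b 0] is the least code in all blocks from [b] on, so Gamma meets
    block [b] after arguments of smaller blocks only. *)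
Lemma leq_pair_block b z : z < pair_nat b 0 -> block z < b.
Proof.
move=> zb; rewrite ltnNge; apply/negP => bz; move: zb; rewrite -{1}(pair_nat_eta z).
have := Cantor.to_nat_spec (block z) (index_in z); have := Cantor.to_nat_spec b 0.
move: (block z) (index_in z) bz => x y bx; nia.
Qed.

(** * The belief set of Gamma read off the log *)

Section GammaLimit.
Variable l : nat -> option nat.
Hypotheses (ls : forall n, settles gamma (mkseq l n) (l n))
  (lc : forall n s, ~~ conflict gamma s (mkseq l n)).

Let held (y : nat) : Prop := exists n, l n = Some y.

Let held_ran y n m : l n = Some y -> n < m -> y \in ran (mkseq l m).
Proof. by move=> ly nm; rewrite in_ran -ly; apply/mapP; exists n; rewrite // mem_iota. Qed.

Let ran_held y n : y \in ran (mkseq l n) -> exists2 i, i < n & l i = Some y.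
Proof. by rewrite in_ran => /mapP[i]; rewrite mem_iota /= => ni ->; exists i. Qed.

Let held_block n y : l n = Some y -> block y = block n.
Proof.
move=> ly; have [k [_ [|[]]]] := ls n; rewrite ly // => -[->].
by rewrite gamma_iter block_pair size_mkseq.
Qed.

Let held_consistent s (F : seq nat) : (forall y, y \in F -> held y) ->
  ~~ some_bot (log s) F /\ ~~ some_cex (log s) F.
Proof.
move=> Fh; have [n Fn] : exists n, {subset F <= ran (mkseq l n)}.
  elim: F Fh => [|y F IH] Fh; first by exists 0.
  have [|n Fn] := IH; first by move=> z zF; apply: Fh; rewrite inE zF orbT.
  have [m lm] := Fh y (mem_head _ _); exists (maxn n m.+1) => z; rewrite inE.
  case/orP => [/eqP ->|/Fn/ran_held[i ni li]]; first by apply: held_ran lm _; lia.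
  by apply: held_ran li _; lia.
have := lc n s; rewrite gamma_conflict negb_or => /andP[nb nc].
by split; [move: nb | move: nc]; apply: contraNN;
  [exact: some_bot_mono (leqnn s) Fn | exact: some_cex_mono (leqnn s) Fn].
Qed.

Let held_alive s y : held y -> ~~ dead (log s) (block y).
Proof.
move=> hy; have [|nb _] := @held_consistent s [:: y]; first by move=> z; rewrite inE => /eqP ->.
by apply: contraNN nb => d; apply/some_botP/Or31; exists y; rewrite ?mem_head.
Qed.

Let held_rep s y : held y -> rep (log s) (block y) <= index_in y.
Proof.
move=> hy; have [|_ nc] := @held_consistent s [:: y]; first by move=> z; rewrite inE => /eqP ->.
by rewrite leqNgt; apply: contraNN nc => d; apply/hasP; exists y; rewrite ?mem_head.
Qed.

Let held_same y z : held y -> held z -> block y = block z -> y = z.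
Proof.
move=> hy hz yz; apply: contrapT => nyz.
have [|/negP nb _] := @held_consistent 0 [:: y; z].
  by move=> x; rewrite !inE => /orP[] /eqP ->.
by apply: nb; apply/some_botP/Or32; exists y, z; rewrite !inE !eqxx orbT.
Qed.

Let held_unblocked s (e : event) z : e \in log s -> held (blocker e) -> held z ->
  block z <> blocked e.
Proof.
move=> el hy hz ze.
have [|/negP nb _] := @held_consistent s [:: blocker e; z].
  by move=> x; rewrite !inE => /orP[] /eqP ->.
by apply: nb; apply/some_botP/Or33; exists e, z; rewrite !inE !eqxx orbT.
Qed.

Let low_held y b : y \in ran (mkseq l (pair_nat b 0)) -> held y /\ block y < b.
Proof.
move=> /ran_held[i ib li]; split; first by exists i.
by rewrite (held_block li); apply: leq_pair_block.
Qed.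

Let first_cex b k : entails gamma (ran (rcons (mkseq l (pair_nat b 0)) (Some (pair_nat b k)))) Cex ->
  exists s, k < rep (log s) b.
Proof.
case=> s; rewrite in_gamma => /hasP[y]; rewrite mem_ran_rcons => /orP[/eqP ->|/low_held[hy _]].
  by rewrite index_in_pair block_pair => h; exists s.
by rewrite ltnNge held_rep.
Qed.

Let first_bot b k : entails gamma (ran (rcons (mkseq l (pair_nat b 0)) (Some (pair_nat b k)))) Bot ->
  exists s, dead (log s) b \/
    exists e : event, [/\ e \in log s, held (blocker e) & blocked e = b].
Proof.
case=> s; rewrite in_gamma => /some_botP h; exists s; case: h.
- case=> y; rewrite mem_ran_rcons => /orP[/eqP ->|/low_held[hy _]].
    by rewrite block_pair; left.
  by move=> d; have := held_alive s hy; rewrite d.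
- case=> z [y []]; rewrite !mem_ran_rcons.
  case/orP => [/eqP ->|/low_held[hz bz]]; case/orP => [/eqP -> //|/low_held[hy by']].
  + by rewrite block_pair => E; move: by'; rewrite -E ltnn.
  + by rewrite block_pair => E; move: bz; rewrite E ltnn.
  + by move=> /(held_same hz hy).
- case=> e [z [el]]; have := coherent_ordered (coherent_log s) el; rewrite !mem_ran_rcons => eo.
  case/orP => [/eqP Ee|/low_held[he be]]; case/orP => [/eqP ->|/low_held[hz bz]].
  + by rewrite block_pair => E; move: eo; rewrite Ee block_pair E ltnn.
  + by move=> E; move: eo; rewrite Ee block_pair -E; lia.
  + by rewrite block_pair => E; right; exists e.
  + by move=> E; case: (held_unblocked el he hz E).
Qed.

Let first_settles b : exists k, (forall i, i < k -> exists s, i < rep (log s) b) /\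
  (l (pair_nat b 0) = Some (pair_nat b k) \/
   l (pair_nat b 0) = None /\
   exists s, dead (log s) b \/ exists e : event, [/\ e \in log s, held (blocker e) & blocked e = b]).
Proof.
have [k [low hk]] := ls (pair_nat b 0); exists k.
have ch i : iter i (revision gamma) (listing gamma (size (mkseq l (pair_nat b 0)))) = pair_nat b i.
  by rewrite gamma_iter size_mkseq block_pair index_in_pair add0n.
split=> [i /low|]; first by rewrite ch => /first_cex.
by case: hk => [->|[-> eB]]; [left; rewrite ch | right; split=> //; move: eB; rewrite ch => /first_bot].
Qed.

(** The first position of the block decides. A placeholder there would come from a discarded block
    or from a held blocker, but a held blocker is the representative of its block, so its event is
    live, against belief in [z]. Otherwise the revisions stop exactly at the representative. *)
Let believed_held z : believed_limit z -> held z.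
Proof.
case=> s0 bz; pose b := block z.
have late s : exists s', [/\ s0 <= s', s <= s' & believed (log s') z].
  by exists (maxn s0 s); split; [lia | lia | apply: bz; lia].
have [k [low [lk|[ln [s [ds|[e [el he eb]]]]]]]] := first_settles b.
- have hk : held (pair_nat b k) by exists (pair_nat b 0).
  have kz : k <= index_in z.
    case: k low {lk hk} => // k /(_ k (ltnSn k))[s]; have [s' [_ ss /believedP[_ -> _]]] := late s.
    by move=> h; apply: leq_trans h _; apply: rep_mono.
  have zk : index_in z <= k.
    have := held_rep s0 hk; rewrite block_pair index_in_pair.
    by have /believedP[_ -> _] := bz s0 (leqnn _).
  suff -> : z = pair_nat b k by [].
  by rewrite -[LHS]pair_nat_eta; congr (pair_nat _ _); lia.
- have [s' [_ ss /believedP[/negP nd _ _]]] := late s; case: nd; exact: dead_mono ds.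
- have [s' [_ ss /believedP[_ _ /(_ e)]]] := late s.
  have el' := log_sub ss el; move=> /(_ el') h; exfalso; apply: h => //.
  by rewrite /live held_alive //= eqn_leq (rep_ge el') held_rep.
Qed.

(** A live event against the block of [y] would have a believed blocker by [coherent_chain]. The
    blocker lies in a smaller block, already frozen at [s0], so it is believed in the limit and
    held, and it contradicts [y]. *)
Let held_believed y : held y -> believed_limit y.
Proof.
move=> hy; pose b := block y; have [s0 st] := settle b.
have zb z : block z <= b -> block z < bound (log s0) b.+1.
  by move=> h; apply: leq_trans (bound_ge _ _).
have repE s : s0 <= s -> rep (log s) b = rep (log s0) b.
  by move=> ss; have [_] := settled_stays st ss (zb y (leqnn _)).
have rep_le s : rep (log s) b <= rep (log s0) b.
  by case: (leqP s s0) => [|/ltnW/repE ->//]; apply: rep_mono.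
have Ey : index_in y = rep (log s0) b.
  apply/eqP; rewrite eqn_leq held_rep // andbT.
  have [k [low [lk|[ln [s [ds|[e [el he eb]]]]]]]] := first_settles b.
  - have -> : y = pair_nat b k.
      by apply: held_same => //; [exists (pair_nat b 0) | rewrite block_pair].
    rewrite index_in_pair; case: k low {lk} => // k /(_ k (ltnSn k))[s h].
    exact: leq_trans h (rep_le s).
  - by have := held_alive s hy; rewrite ds.
  - by case: (held_unblocked el he hy).
exists s0 => s ss; apply/believedP; split; first exact: held_alive.
  by rewrite Ey repE.
move=> e el lv eb; have cl := coherent_log s.
have := coherent_chain cl el lv; rewrite eb held_alive // => /(_ isT) be.
have eo := coherent_ordered cl el.
have eb' : block (blocker e) <= b by rewrite -[b]eb; apply: ltnW.
have be0 : believed (log s0) (blocker e) by rewrite -(settled_stays st ss (zb _ eb')).1.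
have he := believed_held (believed_limitP st (zb _ eb') be0).
by case: (held_unblocked el he hy).
Qed.

Lemma held_limit y : (exists n, l n = Some y) <-> believed_limit y.
Proof. by split; [apply: held_believed | apply: believed_held]. Qed.

End GammaLimit.

Lemma gamma_belief y : belief_set gamma y <-> believed_limit y.
Proof.
have [l [ls lc _ lb]] := loopless_limits gamma_loopless.
by rewrite lb; apply: held_limit.
Qed.

(** * Diagonalization *)

Lemma bit_fset_code_inj (K : choiceType) (c : K -> nat) (F : {fset K}) x :
  injective c -> bit (fset_code c F) (c x) = (x \in F).
Proof.
move=> ci; have -> : fset_code c F = \sum_(y <- map c F) 2 ^ y by rewrite big_map.
by rewrite bit_sum ?map_inj_uniq ?fset_uniq // mem_map.
Qed.

Lemma stage_exists j (g : guess) s1 : exists s,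
  [/\ s1 <= s, block s = j & dec (block (index_in s)) = g].
Proof.
exists (pair_nat j (pair_nat (enc g) s1)); rewrite index_in_pair !block_pair encK; split=> //.
apply: leq_trans (leq_trans (leq_addr _ _) (leq_pair j _)).
exact: leq_trans (leq_addr _ _) (leq_pair _ _).
Qed.

Lemma eventually_all (T : eqType) (Q : nat -> T -> bool) (s : seq T) :
  (forall y, y \in s -> exists n0, forall n, n0 <= n -> Q n y) ->
  exists n0, forall n, n0 <= n -> all (Q n) s.
Proof.
elim: s => [|y s IH] h; first by exists 0.
have [n0 h0] := h y (mem_head _ _).
have [|n1 h1] := IH; first by move=> z zs; apply: h; rewrite inE zs orbT.
by exists (maxn n0 n1) => n nn /=; rewrite h0 ?h1 //; lia.
Qed.

(* Stages of the consequence operator come before computation times, which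
   depend on them. *)
Definition eventually (P : nat -> nat -> bool) : Prop :=
  exists n0, forall n, n0 <= n -> exists t0, forall t, t0 <= t -> P n t.

Lemma eventually_and P Q : eventually P -> eventually Q ->
  eventually (fun n t => P n t && Q n t).
Proof.
move=> [n0 h0] [n1 h1]; exists (maxn n0 n1) => n nn.
have [|t0 k0] := h0 n; first by lia.
have [|t1 k1] := h1 n; first by lia.
by exists (maxn t0 t1) => t tt; rewrite k0 ?k1 //; lia.
Qed.

(** * What a guess forces upon a p-dialectical opponent *)

Section Opponent.
Variable Lam : q_dialectical.
Notation A := (arguments Lam).
Notation r := (revision Lam).
Variables m1 m2 m3 : machine_code.
Hypotheses (m1P : evaluates m1 id id setT (listing Lam))
  (m2P : evaluates m2 query_code (fset_code conclusion_code)
     [set q : nat * {fset nat} | ([set` q.2] `<=` A)%classic] (fun q => consequence Lam q.1 q.2))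
  (m3P : evaluates m3 id id A r).

Notation M := ((m1, (m2, m3)) : codes).

Definition refutes (s : seq nat) : Prop := entails Lam [fset x in s]%fset Cex.

Lemma iter_arg k x : A x -> A (iter k r x).
Proof. by move=> Ax; elim: k => //= k; apply: revision_codomain. Qed.

Lemma returns_listing t q x : returns m1 t q x -> x = listing Lam q.
Proof.
rewrite /returns; case E: (eval m1 q t) => [v|] // /eqP <-.
by have [_ h] := @m1P q I; apply: h E.
Qed.

Lemma returns_revision t x y : A x -> returns m3 t x y -> y = r x.
Proof.
move=> Ax; rewrite /returns; case E: (eval m3 x t) => [v|] // /eqP <-.
by have [_ h] := m3P Ax; apply: h E.
Qed.

Lemma eventually_listing q : eventually (fun _ t => returns m1 t q (listing Lam q)).
Proof.
exists 0 => n _; have [[t0 h] _] := @m1P q I; exists t0 => t tt.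
by rewrite /returns (h t tt).
Qed.

Lemma eventually_revision x : A x -> eventually (fun _ t => returns m3 t x (r x)).
Proof.
move=> Ax; exists 0 => n _; have [[t0 h] _] := m3P Ax; exists t0 => t tt.
by rewrite /returns (h t tt).
Qed.

Lemma query_codeE n (s : seq nat) : pair_nat n (code_of s) = query_code (n, [fset x in s]%fset).
Proof. by rewrite /query_code code_ofE. Qed.

Lemma refuted_bit n F : odd (fset_code conclusion_code (consequence Lam n F))./2
  = (Cex \in consequence Lam n F).
Proof.
by rewrite -(bit_fset_code_inj _ _ (can_inj conclusion_codeK)).
Qed.

Lemma seq_args (s : seq nat) : (forall x, x \in s -> A x) -> ([set` [fset x in s]%fset] `<=` A)%classic.
Proof. by move=> sA x /=; rewrite !inE; apply: sA. Qed.

Lemma refuted_refutes n t (s : seq nat) : (forall x, x \in s -> A x) ->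
  refuted m2 n t s -> refutes s.
Proof.
move=> sA; rewrite /refuted query_codeE.
have [_ h] := @m2P (n, [fset x in s]%fset) (seq_args sA).
by case E: (eval _ _ _) => [v|] //; rewrite (h _ _ E) refuted_bit => c; exists n.
Qed.

Lemma eventually_refuted (s : seq nat) : (forall x, x \in s -> A x) -> refutes s ->
  eventually (fun n t => refuted m2 n t s).
Proof.
move=> sA [n0 c]; exists n0 => n nn.
have [[t0 h] _] := @m2P (n, [fset x in s]%fset) (seq_args sA).
exists t0 => t tt; rewrite /refuted query_codeE (h t tt) refuted_bit.
by apply: consequence_mono nn _ _ c => //; apply: seq_args.
Qed.

Lemma path_revision (P : nat -> bool) t x s : A x ->
  path (fun y z => returns m3 t y z && P y) x s ->
  s = traject r (r x) (size s) /\ forall i, i < size s -> P (iter i r x).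
Proof.
elim: s x => [|y s IH] x Ax //= /andP[/andP[/(returns_revision Ax) -> Px] ps].
have [Es h] := IH _ (revision_codomain Ax) ps.
split; first by congr cons.
by case=> [|i] //; rewrite ltnS iterSr => /h.
Qed.

Lemma eventually_path (L : seq nat) x k : A x -> (forall y, y \in L -> A y) ->
  (forall i, i < k -> refutes (iter i r x :: L)) ->
  eventually (fun n t => path (fun y z => returns m3 t y z && refuted m2 n t (y :: L)) x
    (traject r (r x) k)).
Proof.
move=> + LA; elim: k x => [|k IH] x Ax h; first by exists 0 => n _; exists 0.
rewrite /=; apply: eventually_and.
  apply: eventually_and; first exact: eventually_revision.
  apply: eventually_refuted; last exact: (h 0).
  by move=> y; rewrite inE => /orP[/eqP -> //|/LA].
apply: IH => [|i ik]; first exact: revision_codomain.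
by rewrite -iterSr; apply: h.
Qed.

Lemma eventually_returns_path x k : A x ->
  eventually (fun n t => path (returns m3 t) x (traject r (r x) k)).
Proof.
elim: k x => [|k IH] x Ax; first by exists 0 => n _; exists 0.
apply: eventually_and; first exact: eventually_revision.
exact: IH (revision_codomain Ax).
Qed.

Hypothesis pL : p_dialectical Lam.
Variable l : nat -> option nat.
Hypotheses (ls : forall n, settles Lam (mkseq l n) (l n))
  (lc : forall n s, ~~ conflict Lam s (mkseq l n))
  (lv : forall n, valid Lam (mkseq l n)).

Let held (y : nat) : Prop := exists n, l n = Some y.

Lemma held_arg y : held y -> A y.
Proof.
by case=> n ly; apply: (lv (n := n.+1)); rewrite -ly; apply: map_f; rewrite mem_iota; lia.
Qed.

Lemma held_consistent (s : seq nat) : (forall y, y \in s -> held y) -> ~ refutes s.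
Proof.
move=> sh [n c]; have [m sm] : exists m, {subset s <= ran (mkseq l m)}.
  elim: s sh {c} => [|y s IH] sh; first by exists 0.
  have [|m hm] := IH; first by move=> z zs; apply: sh; rewrite inE zs orbT.
  have [k lk] := sh y (mem_head _ _); exists (maxn m k.+1) => z; rewrite inE in_ran.
  case/orP => [/eqP ->|/hm]; rewrite ?in_ran.
    by rewrite -lk; apply: map_f; rewrite mem_iota; lia.
  by case/mapP => i; rewrite mem_iota => im ->; apply: map_f; rewrite mem_iota; lia.
have /negP[] := lc m n; rewrite /conflict.
suff -> : Cex \in consequence Lam n (ran (mkseq l m)) by rewrite orbT.
apply: consequence_mono c => //; last by apply: valid_ran.
by apply/fsubsetP => x; rewrite !inE => /sm; rewrite !inE.
Qed.

(** A placeholder would require a contradiction among arguments, which a p-system does not have. *)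
Lemma settles_held n : exists k, [/\ l n = Some (iter k r (listing Lam n)) &
  forall i, i < k -> entails Lam (ran (rcons (mkseq l n) (Some (iter i r (listing Lam n))))) Cex].
Proof.
have [k []] := ls n; rewrite size_mkseq => ch [->|[_ [m b]]]; first by exists k.
case: pL; exists m; eexists; split; last exact: b.
apply: valid_ran => x; rewrite mem_rcons inE => /orP[/eqP[->]|]; last exact: lv.
by apply: iter_arg; exists n.
Qed.

Lemma entails_refutes (L : seq nat) n x : mkseq l n = map Some (rev L) ->
  entails Lam (ran (rcons (mkseq l n) (Some x))) Cex <-> refutes (x :: L).
Proof.
move=> E; rewrite /refutes; suff -> : ran (rcons (mkseq l n) (Some x)) = [fset y in x :: L]%fset by [].
apply/fsetP => y; rewrite mem_ran_rcons E in_ran !inE mem_map; last by move=> ? ? [].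
by rewrite mem_rev.
Qed.

(* A certificate forces the entry of the limit string unless its last element
   is refuted. *)
Lemma row_okP n t (L : seq nat) row : mkseq l (size L) = map Some (rev L) ->
  row_ok M n t L row ->
  exists k, [/\ size row.2 <= k, l (size L) = Some (iter k r (listing Lam (size L))),
    last row.1 row.2 = iter (size row.2) r (listing Lam (size L)) &
    forall i, i < k -> refutes (iter i r (listing Lam (size L)) :: L)].
Proof.
move=> EL /andP[/returns_listing Ex]; set x0 := listing Lam (size L) in Ex *.
rewrite Ex => pa; have Ax : A x0 by exists (size L).
have [Es ref] := path_revision Ax pa.
have [k [lk ch]] := settles_held (size L); exists k; split=> //.
- rewrite leqNgt; apply/negP => /ref /refuted_refutes.
  have LA y : y \in L -> held y.
    move=> yL; have: Some y \in mkseq l (size L) by rewrite EL map_f // mem_rev.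
    by case/mapP => i _ E; exists i.
  have kA y : y \in iter k r x0 :: L -> held y.
    by rewrite inE => /orP[/eqP ->|/LA //]; exists (size L).
  by move=> h; apply: (held_consistent kA); apply: h => y /kA/held_arg.
- by rewrite {1}Es last_traject.
- by move=> i /ch/(entails_refutes _ EL).
Qed.

(** A row never runs past the limit entry. It does not stop short of it either: its last argument is
    held, hence not refuted together with the preceding entries. *)
Lemma certifyP n t rows : (certify M n t rows).1 ->
  (forall y, y \in (certify M n t rows).2 -> held y) ->
  mkseq l (size (certify M n t rows).2) = map Some (rev (certify M n t rows).2).
Proof.
elim/last_ind: rows => // rows row IH; rewrite /certify foldl_rcons -/(certify M n t rows).
case: (certify M n t rows) IH => [ok L] /= IH /andP[okL rok] LH.
have EL := IH okL (fun y yL => LH y (mem_behead (s := _ :: _) yL)).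
have [k [ks lk Ela ref]] := row_okP EL rok.
rewrite /mkseq -[(size L).+1]addn1 iotaD map_cat add0n -/(mkseq l (size L)) EL rev_cons map_rcons cats1.
rewrite /= lk; congr (rcons _ (Some _)); rewrite Ela; congr iter.
apply/eqP; rewrite eqn_leq ks andbT leqNgt; apply/negP => /ref h.
by apply: (held_consistent LH); rewrite Ela.
Qed.

(** The limit entry after [g_old] lies on the orbit at or after [g_arg], but it is held, so it is
    none of the arguments up to the target. The opponent has thus revised the target too, which
    takes a refutation. *)
Lemma certified_refutes g : certified M g ->
  (forall y, y \in g_old M g -> held y) ->
  (forall y, y \in g_arg g :: g_next g -> ~ held y) ->
  A (g_target g) /\ refutes (g_target g :: g_old M g).
Proof.
rewrite /certified => /andP[/andP[/andP[/andP[ok rok] pa] _] _] LH nH.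
have EL := certifyP ok LH.
have [k [ks lk Ea ref]] := row_okP EL rok.
set x0 := listing Lam _ in lk Ea ref; have Ax : A x0 by eexists.
have {pa}: path (fun y z => returns m3 (g_time g) y z && true) (g_arg g) (g_next g).
  by apply: sub_path pa => y z ->.
have Aa : A (g_arg g) by rewrite /g_arg Ea; apply: iter_arg.
move=> /(path_revision Aa)[En _].
have memi i : i <= size (g_next g) -> iter (i + size g.2.1.2) r x0 \in g_arg g :: g_next g.
  rewrite iterD -Ea -/(g_arg g) inE; case: i => [|i] im; first by rewrite eqxx.
  by rewrite En; apply/orP; right; apply/trajectP; exists i; rewrite // iterSr.
have -> : g_target g = iter (size (g_next g) + size g.2.1.2) r x0.
  by rewrite /g_target {1}En last_traject iterD /g_arg Ea.
split; first exact: iter_arg.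
apply: ref; rewrite ltnNge; apply/negP => kle.
apply: (nH (iter k r x0)); last by exists (size (g_old M g)).
have -> : k = (k - size g.2.1.2) + size g.2.1.2 by lia.
by apply: memi; lia.
Qed.

Lemma eventually_certify p : exists rows L, map Some (rev L) = mkseq l p /\
  eventually (fun n t => certify M n t rows == (true, L)).
Proof.
elim: p => [|p [rows [L [EL ev]]]]; first by exists [::], [::]; split=> //; exists 0 => n _; exists 0.
have [k [lk ch]] := settles_held p.
have sL : size L = p by rewrite -(size_rev L) -(size_map Some) EL size_mkseq.
exists (rcons rows (listing Lam p, traject r (r (listing Lam p)) k)), (iter k r (listing Lam p) :: L).
split; first by rewrite rev_cons map_rcons EL -lk /mkseq -[p.+1]addn1 iotaD map_cat cats1.
have Ap : A (listing Lam p) by exists p.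
have LA y : y \in L -> A y.
  move=> yL; have: Some y \in mkseq l p by rewrite -EL map_f // mem_rev.
  exact: lv.
have ch' i : i < k -> refutes (iter i r (listing Lam p) :: L).
  by move=> ik; apply/(entails_refutes _ (esym EL)); apply: ch.
have [n0 h] := eventually_and ev (eventually_and (eventually_listing p) (eventually_path Ap LA ch')).
exists n0 => n nn; have [t0 ht] := h n nn; exists t0 => t tt.
have /andP[/eqP E1 E2] := ht t tt; rewrite /certify foldl_rcons -/(certify M n t rows) E1 /=.
by rewrite /row_ok /= sL E2 last_traject.
Qed.

End Opponent.

Lemma leq_block z : block z <= z.
Proof.
rewrite -{2}(pair_nat_eta z); exact: leq_trans (leq_addl _ _) (leq_pair _ _).
Qed.

Lemma believed_limit_block y z : believed_limit y -> believed_limit z ->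
  block y = block z -> y = z.
Proof.
move=> [s0 h0] [s1 h1]; apply: (believed_block (lg := log (maxn s0 s1))).
  by apply: h0; lia.
by apply: h1; lia.
Qed.

Lemma settled_current j s0 s : settled j s0 -> s0 <= s ->
  current (log s) j = current (log s0) j /\ bound (log s) j = bound (log s0) j.
Proof.
move=> st ss; rewrite -(subnK ss); elim: (s - s0) => // k [IH1 IH2].
rewrite addSn; case: (log_cases (k + s0)) => [/negPn/eqP -> //|[e [E oe _ _ _]]].
have sa : acts (k + s0) by rewrite /acts E; apply/eqP => /(congr1 size) /=; lia.
have jb := st _ (leq_addl _ _) sa.
by rewrite E current_cons bound_cons oe leqNgt jb ltnNge (ltnW jb).
Qed.

Lemma unsettled j s0 s e : settled j s0 -> s0 <= s -> block s = j ->
  log s.+1 = e :: log s -> False.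
Proof.
move=> st ss bs E; have := st s ss; rewrite bs ltnn => h; apply: notF; apply: h.
by rewrite /acts E; apply/eqP => /(congr1 size) /=; lia.
Qed.

Section Diagonalization.
Variable Lam : q_dialectical.
Notation A := (arguments Lam).
Notation r := (revision Lam).
Variables m1 m2 m3 : machine_code.
Hypotheses (m1P : evaluates m1 id id setT (listing Lam))
  (m2P : evaluates m2 query_code (fset_code conclusion_code)
     [set q : nat * {fset nat} | ([set` q.2] `<=` A)%classic] (fun q => consequence Lam q.1 q.2))
  (m3P : evaluates m3 id id A r).
Hypothesis pL : p_dialectical Lam.
Variable l : nat -> option nat.
Hypotheses (ls : forall n, settles Lam (mkseq l n) (l n))
  (lc : forall n s, ~~ conflict Lam s (mkseq l n))
  (lv : forall n, valid Lam (mkseq l n)).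
Hypothesis lB : forall x, (exists n, l n = Some x) <-> believed_limit x.

Notation M := ((m1, (m2, m3)) : codes).
Let j : nat := enc M.
Let jM : codes_of j = M. Proof. exact: encK. Qed.

Let limit_arg y : believed_limit y -> A y.
Proof. by move=> /lB; apply: held_arg lv _. Qed.

Let limit_consistent (s : seq nat) : (forall y, y \in s -> believed_limit y) -> ~ refutes Lam s.
Proof. by move=> sB; apply: (held_consistent lc lv) => y ys; apply/lB; apply: sB. Qed.

(** The opponent has refuted the old goal, all of which is believed in the limit. *)
Lemma not_finished s0 e : settled j s0 -> current (log s0) j = Some e -> owner e = j ->
  goal e != [::].
Proof.
move=> st cur oj; apply/eqP => g0; have cl := coherent_log s0.
have [[G [n [t rG]] [bG _]]] := coherent_finished cl cur oj g0.
have [el _] := current_owner cur.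
have hb : horizon e <= bound (log s0) j.+1.
  by have := bound_horizon el (j := j.+1); rewrite oj => /(_ (ltnSn _)); lia.
have GB y : y \in G -> believed_limit y.
  by move=> /bG[by' hy]; apply: (believed_limitP st) => //; apply: leq_trans hb.
move: rG; rewrite jM => rG; apply: (limit_consistent GB).
by apply: (refuted_refutes m2P) rG => y /GB/limit_arg.
Qed.

Lemma not_waiting s0 e : settled j s0 -> current (log s0) j = Some e -> owner e = j -> False.
Proof.
move=> st cur oj; have g0 := not_finished st cur oj.
have [b1 b2 [g cg [Eg oB nB hB]] wg _] := coherent_waits (coherent_log s0) cur oj g0.
have [el _] := current_owner cur.
have hb : horizon e <= bound (log s0) j.+1.
  by have := bound_horizon el (j := j.+1); rewrite oj => /(_ (ltnSn _)); lia.
rewrite jM in cg Eg oB.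
have LB y : y \in g_old M g -> exists n, l n = Some y.
  move=> yL; apply/lB; apply: (believed_limitP st); last exact: oB.
  by apply: leq_trans hb; have [] := wg y; rewrite // Eg inE yL orbT.
have nH y : y \in g_arg g :: g_next g -> ~ (exists n, l n = Some y).
  move=> yg /lB[s1 h]; have /negP[] := nB y yg.
  have yb := leq_trans (hB y yg) hb.
  have [<- _] := settled_stays st (leq_maxl s0 s1) yb.
  by apply: h; lia.
have [Ax ref] := certified_refutes m1P m2P m3P pL ls lc lv cg LB nH.
have GA y : y \in goal e -> A y.
  by rewrite Eg inE => /orP[/eqP -> //|/LB]; apply: held_arg lv _.
rewrite -Eg in ref.
have [n0 h] := eventually_refuted m2P GA ref; have [t0 ht] := h n0 (leqnn _).
(* A closing reads only the stage and the time of the guess; the other components are arbitrary. *)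
pose g' : guess := ([::], ((0, [::]), ([::], (0, (n0, t0))))).
have [s [ss bs gs]] := stage_exists j g' s0.
have [cs _] := settled_current st ss.
apply: (@unsettled j s0 s (closing e s j)) => //.
rewrite /= /log_step bs gs cs cur oj eqxx /try_close -/(codes_of j) jM ht // andbT.
by move: g0; case: (goal e).
Qed.

Let o k : nat := iter k r (listing Lam 0).

Let o_arg k : A (o k).
Proof. by apply: iter_arg; exists 0. Qed.

Let oD k i : o (i + k) = iter i r (o k).
Proof. exact: iterD. Qed.

Let o_inj k i : o k = o i -> k = i.
Proof.
wlog: k i / k <= i => [w E|]; first by case: (leqP k i) => [|/ltnW] h; [|symmetry]; apply: w.
rewrite leq_eqVlt => /orP[/eqP //|ki] E; exfalso.
apply: (@revision_acyclic Lam (i - k) (o k)); first by lia.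
  exact: o_arg.
by rewrite -oD subnK // ltnW.
Qed.

(** [o K] is listed at some position [p], and the limit entry at [p] is an iterate of it. *)
Let o_hits K : exists2 k, K <= k & believed_limit (o k).
Proof.
have [p _ Ep] := o_arg K; have [k [lk _]] := settles_held pL ls lv p.
exists (k + K); first exact: leq_addl.
by apply/lB; exists p; rewrite lk Ep -oD.
Qed.

(** A block has at most one believed member and the orbit never repeats, so each block below [N]
    excludes only one point of the orbit. *)
Let o_tail N : exists m, forall k, m <= k -> believed_limit (o k) -> N <= block (o k).
Proof.
elim: N => [|N [m IH]]; first by exists 0.
case: (pselect (exists k, [/\ m <= k, believed_limit (o k) & block (o k) = N])) => [[k [mk bk kN]]|none].
  exists k.+1 => i ki bi; have mi : m <= i by lia.
  have := IH i mi bi; rewrite leq_eqVlt => /orP[/eqP E|//].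
  by have := o_inj (believed_limit_block bk bi (etrans kN E)); lia.
exists m => k mk bk; have := IH k mk bk; rewrite leq_eqVlt => /orP[/eqP E|//].
by case: none; exists k.
Qed.

Lemma not_idle s0 : settled j s0 -> idle (log s0) j -> False.
Proof.
move=> st idl; pose N := bound (log s0) j; have [m mP] := o_tail N.
have [p [[k0 mk0 lp] pmin]] : exists p, (exists2 k, m <= k & l p = Some (o k)) /\
    forall q, (exists2 k, m <= k & l q = Some (o k)) -> p <= q.
  have ex : exists p, `[< exists2 k, m <= k & l p = Some (o k) >].
    have [k mk /lB[p lp]] := o_hits m; exists p; apply/asboolP; by exists k.
  case: (ex_minnP ex) => p /asboolP hp min; exists p; split=> // q hq.
  by apply: min; apply/asboolP.
have Ba : believed_limit (o k0) by apply/lB; exists p.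
(* The target [o k1] is taken so far out that its block exceeds that of [a = o k0]. *)
have [m' mP'] := o_tail (block (o k0)).+1.
have [k1 k1m Bx] := o_hits (maxn m' k0.+1).
have k01 : k0 < k1 by lia.
have ax : block (o k0) < block (o k1) by apply: mP' => //; lia.
pose ys := traject r (r (o k0)) (k1 - k0).
have ysP y : y \in ys -> exists2 k, k0 < k & y = o k.
  by move=> /trajectP[i _ ->]; exists (i.+1 + k0); [lia | rewrite oD iterSr].
have [rows [L [EL evL]]] := eventually_certify m1P m2P m3P pL ls lv p.
have sL : size L = p by rewrite -(size_rev L) -(size_map Some) EL size_mkseq.
have memL y : (y \in L) = (Some y \in mkseq l p).
  by rewrite -EL mem_map ?mem_rev // => ? ? [].
have LB y : y \in L -> believed_limit y.
  by rewrite memL => /mapP[q _ E]; apply/lB; exists q.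
(* An earlier position holding a point of the orbit beyond [m] would contradict the minimality of
   [p]. *)
have notL k : m <= k -> o k \notin L.
  move=> mk; rewrite memL; apply/mapP => -[q]; rewrite mem_iota => qp E.
  by have := pmin q; rewrite leqNgt => /(_ _)/negP; case; [exists k | lia].
have [k [lk ch]] := settles_held pL ls lv p.
have Ap : A (listing Lam p) by exists p.
have ch' i : i < k -> refutes Lam (iter i r (listing Lam p) :: L).
  by move=> ik; apply/(entails_refutes Lam _ (esym EL)); apply: ch.
have LA y : y \in L -> A y by move=> /LB/limit_arg.
have [n ev] := eventually_and evL (eventually_and (eventually_listing m1P p)
  (eventually_and (eventually_path m2P m3P Ap LA ch')
     (eventually_returns_path m3P (k1 - k0) (o_arg k0)))).
have [t /(_ t (leqnn _)) /and4P[/eqP tL t1 t2 t3]] := ev n (leqnn _).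
(* [kc] exceeds the index of [a] and of all its revisions up to the target, so the new
   representative is none of them. *)
pose kc := (sumn (map index_in (o k0 :: ys))).+1.
pose g : guess := (rows, ((listing Lam p, traject r (r (listing Lam p)) k), (ys, (kc, (n, t))))).
have Earg : g_arg g = o k0.
  by rewrite /g_arg /= last_traject; have := lk; rewrite lp => -[].
have Enext : g_next g = ys by [].
have Etarget : g_target g = o k1.
  by rewrite /g_target Earg last_traject -oD subnK // ltnW.
have Eold : g_old M g = L by rewrite /g_old /g_cert /g_stage /g_time /= tL.
have cg : certified M g.
  rewrite /certified Eold Earg Enext /g_cert /g_stage /g_time /= tL /row_ok /= sL t1 t2 t3 notL //=.
  apply/allP => y /ysP[i ki ->]; apply: notL; lia.
have [s1 h1] : exists s1, forall s, s1 <= s -> all (believed (log s)) (o k1 :: o k0 :: L).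
  apply: eventually_all => y; rewrite !inE => /or3P[/eqP -> //|/eqP -> //|]; exact: LB.
(* By the choice of [m], the revisions believed in the limit have blocks from [N] on; the others are
   eventually unbelieved for good. *)
have [s2 h2] : exists s2, forall s, s2 <= s ->
    all (fun y => ~~ (believed (log s) y && (block y < N))) ys.
  apply: eventually_all => y /ysP[i ki Ey]; case: (believed_limit_dec y) => [By|[s2 h]].
    have := mP i _; rewrite -Ey => /(_ _ By) yN; exists 0 => s _.
    by rewrite negb_and -leqNgt yN ?orbT //; lia.
  by exists s2 => s /h /negPf ->.
have [s3 h3] : exists s3, forall s, s3 <= s -> all (fun y => block y < s) (o k0 :: L ++ ys).
  by apply: eventually_all => y _; exists (block y).+1.
have [s [ss bs gs]] := stage_exists j g (maxn (maxn s0 s1) (maxn s2 s3)).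
move: ss; rewrite !geq_max => /andP[/andP[s0s s1s] /andP[s2s s3s]].
have [cs Nb] := settled_current st s0s.
have op : opens M (log s) s j g.
  have := h1 s s1s; rewrite /= => /and3P[b1 b0 bL].
  have := h3 s s3s; rewrite /= all_cat => /and3P[c0 cL cy].
  rewrite /opens cg Eold Earg Enext Etarget /= b0 bL b1 Nb ax c0 cL cy !andbT.
  have -> : N <= block (o k0) by apply: mP.
  have kcP y : y \in o k0 :: ys -> index_in y < kc.
    rewrite /kc ltnS; elim: (o k0 :: ys) => // z zs IH; rewrite inE /=.
    by case/orP => [/eqP ->|/IH h]; [exact: leq_addr | exact: leq_trans h (leq_addl _ _)].
  rewrite (kcP (o k0)) ?mem_head // !andbT andTb.
  apply/allP => y yy; rewrite (allP (h2 s s2s) y yy) /=.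
  apply/eqP => E; have := kcP y; rewrite inE yy orbT => /(_ isT).
  by rewrite E /g_new /= index_in_pair ltnn.
apply: (@unsettled j s0 s (opening M (log s) s j g)) => //.
move: idl; rewrite /idle -cs.
rewrite /= /log_step bs gs -/(codes_of j) jM /try_open op.
by case: (current (log s) j) => [e|] // /negPf ->.
Qed.

Lemma belief_distinct : False.
Proof.
have [s0 st] := settle j.
case: (boolP (idle (log s0) j)) => [|]; first exact: not_idle st.
rewrite /idle; case cur: (current _ _) => [e|] //; rewrite negbK => /eqP oj.
exact: not_waiting st cur oj.
Qed.

End Diagonalization.

Theorem theorem4 :
  exists Gamma : q_dialectical,
    loopless Gamma /\
    forall Lambda : q_dialectical,
      p_dialectical Lambda -> belief_set Gamma <> belief_set Lambda.
Proof.
exists gamma; split; first exact: gamma_loopless.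
move=> Lam pL E.
have EB x : belief_set Lam x <-> believed_limit x by rewrite -E; apply: gamma_belief.
have lL : loopless Lam.
  apply: infinite_loopless => b; have [z Bz bz] := believed_limit_infinite b.
  by exists z; [apply: leq_trans (leq_block z) | apply/EB].
have [l [ls lc lv lB]] := loopless_limits lL.
have [m1 m1P] := computable_on_evaluates (listing_computable Lam).
have [m2 m2P] := computable_on_evaluates (approximated_computable (consequence_approximated Lam)).
have [m3 m3P] := computable_on_evaluates (revision_computable Lam).
apply: (@belief_distinct Lam m1 m2 m3 m1P m2P m3P pL l ls lc lv) => x.
by rewrite -lB.
Qed.
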